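(* Let $\Lambda$ be a filtered ring such that $\mathrm{gr}\Lambda$ is a commutative Noetherian ring and let $M$ be a filtered (left) $\Lambda$-module with a good filtration. Assume that the $\mathrm{gr}\Lambda$-module $\mathrm{gr}M$ has finite Gorenstein dimension. Then $$\mathrm{grade}_{\Lambda}M=\mathrm{grade}_{\mathrm{gr}\Lambda}\,\mathrm{gr}M .$$
   Context: A filtered ring is a ring $\Lambda$ with additive subgroups $\mathcal F_p\Lambda$ ($p\in\mathbb N=\{0,1,2,\dots\}$) such that $1\in\mathcal F_0\Lambda$, $\mathcal F_p\Lambda\subset\mathcal F_{p+1}\Lambda$, $(\mathcal F_p\Lambda)(\mathcal F_q\Lambda)\subset\mathcal F_{p+q}\Lambda$, $\Lambda=\bigcup_p\mathcal F_p\Lambda$; put $\mathcal F_p\Lambda=0$ for $p<0$ and $\mathrm{gr}\Lambda=\bigoplus_{p\ge 0}\mathcal F_p\Lambda/\mathcal F_{p-1}\Lambda$, a graded ring. When $\mathrm{gr}\Lambda$ is commutative Noetherian, $\Lambda$ is left and right Noetherian. A filtration of a $\Lambda$-module $M$ is a family of additive subgroups $\mathcal F_pM$ ($p\in\mathbb Z$) with $\mathcal F_pM\subset\mathcal F_{p+1}M$, $\mathcal F_{-p}M=0$ for $p\gg0$, $(\mathcal F_p\Lambda)(\mathcal F_qM)\subset\mathcal F_{p+q}M$, $M=\bigcup_p\mathcal F_pM$; put $\mathrm{gr}M=\bigoplus_{p\in\mathbb Z}\mathcal F_pM/\mathcal F_{p-1}M$, a graded $\mathrm{gr}\Lambda$-module.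 The filtration is good if there are $p_1,\dots,p_r\in\mathbb Z$ and $m_1,\dots,m_r\in M$ with $\mathcal F_pM=\sum_{k=1}^r(\mathcal F_{p-p_k}\Lambda)m_k$ for all $p\in\mathbb Z$ (then $M$ is finitely generated over $\Lambda$ and $\mathrm{gr}M$ is finitely generated over $\mathrm{gr}\Lambda$). For a left and right Noetherian ring $\Gamma$ and a finitely generated $\Gamma$-module $X$: $\mathrm{grade}_\Gamma X=\inf\{k:\mathrm{Ext}^k_\Gamma(X,\Gamma)\ne0\}$. Put $X^*=\mathrm{Hom}_\Gamma(X,\Gamma)$. One says $\text{G-dim}_\Gamma X=0$ if the canonical map $X\to X^{**}$ is an isomorphism and $\mathrm{Ext}^k_\Gamma(X,\Gamma)=0=\mathrm{Ext}^k_{\Gamma^{\rm op}}(X^*,\Gamma)$ for all $k>0$. For $k>0$, $\text{G-dim}_\Gamma X\le k$ means there is an exact sequence $0\to G_k\to\cdots\to G_0\to X\to0$ of finitely generated modules with $\text{G-dim}\,G_i=0$ for all $i$. The Gorenstein dimension of $X$ is $\text{G-dim}_\Gamma X$, the least such $k$ ($\infty$ if none exists). *)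

(* Defs.v *)
From HB Require Import structures.
From mathcomp Require Import all_boot all_order all_algebra.
From mathcomp Require Import boolp classical_sets functions cardinality fsbigop.

Set Implicit Arguments.
Unset Strict Implicit.
Unset Printing Implicit Defensive.

Import GRing.Theory Quotient.

Local Open Scope classical_set_scope.
Local Open Scope ring_scope.
Local Open Scope quotient_scope.

Record subgrp (V : zmodType) := Subgrp {
  sg_set :> V -> Prop;
  sg0 : sg_set 0;
  sgB : forall x y, sg_set x -> sg_set y -> sg_set (x - y)
}.

Section Subgrp.
Variables (V : zmodType) (A : subgrp V).

Definition sg_pred : {pred V} := [pred x | `[< A x >]].

Lemma sg_predP x : reflect (A x) (x \in sg_pred).
Proof. exact: asboolP. Qed.

Lemma sg_zmod_closed : zmod_closed sg_pred.
Proof.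
split=> [|x y /sg_predP Ax /sg_predP Ay]; first exact/sg_predP/sg0.
exact/sg_predP/sgB.
Qed.
HB.instance Definition _ := GRing.isZmodClosed.Build V sg_pred sg_zmod_closed.

Lemma sgN x : A x -> A (- x).
Proof. by rewrite -sub0r; apply: sgB; exact: sg0. Qed.

Lemma sgD x y : A x -> A y -> A (x + y).
Proof. by move=> Ax Ay; rewrite -[y]opprK; apply: sgB => //; exact: sgN. Qed.

Record sg_type := SgElt { sg_val : V; _ : sg_val \in sg_pred }.
HB.instance Definition _ := [isSub for sg_val].
HB.instance Definition _ := [Choice of sg_type by <:].
HB.instance Definition _ := [SubChoice_isSubZmodule of sg_type by <:].

End Subgrp.

Section Subquotient.
Variables (V : zmodType) (A B : subgrp V).

Definition sq_pred : {pred sg_type A} := [pred x | `[< B (val x) >]].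

Lemma sq_predP x : reflect (B (val x)) (x \in sq_pred).
Proof. exact: asboolP. Qed.

Lemma sq_zmod_closed : zmod_closed sq_pred.
Proof.
split=> [|x y /sq_predP Bx /sq_predP By]; apply/sq_predP.
  by rewrite raddf0; exact: sg0.
by rewrite raddfB; exact: sgB.
Qed.
HB.instance Definition _ :=
  GRing.isZmodClosed.Build (sg_type A) sq_pred sq_zmod_closed.

(* A / (A `&` B); only used with B `<=` A *)
Definition subquot : zmodType := {quot sq_pred}.

(* junk value 0 outside A *)
Definition sq_class (x : V) : subquot := \pi_subquot (insubd 0 x).
Definition sq_rep (x : subquot) : V := val (repr x).

Lemma sq_repP x : A (sq_rep x).
Proof. exact/sg_predP/valP. Qed.

Lemma sq_repK x : sq_class (sq_rep x) = x.
Proof. by rewrite /sq_class /sq_rep valKd reprK. Qed.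

Lemma sq_classD x y : A x -> A y -> sq_class (x + y) = sq_class x + sq_class y.
Proof.
move=> /sg_predP Ax /sg_predP Ay; rewrite /sq_class -raddfD; congr (\pi_subquot _).
by apply: val_inj; rewrite raddfD /= !insubdK // rpredD.
Qed.

Lemma sq_class0 : sq_class 0 = 0.
Proof.
have /sg_predP A0 := sg0 A; rewrite /sq_class -(raddf0 \pi_subquot).
by congr (\pi_subquot _); apply: val_inj; rewrite /= insubdK.
Qed.

Lemma sq_class_eq x y : A x -> A y -> B (x - y) -> sq_class x = sq_class y.
Proof.
move=> /sg_predP Ax /sg_predP Ay Bxy; apply/eqP.
by rewrite -idealrBE; apply/sq_predP; rewrite raddfB /= !insubdK.
Qed.

Lemma sq_class_eqP x y : A x -> A y -> sq_class x = sq_class y -> B (x - y).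
Proof.
move=> /sg_predP Ax /sg_predP Ay /eqP.
by rewrite -idealrBE => /sq_predP; rewrite raddfB /= !insubdK.
Qed.

Lemma sq_rep_class x : A x -> B (sq_rep (sq_class x) - x).
Proof. by move=> Ax; apply: sq_class_eqP => //; [exact: sq_repP|rewrite sq_repK]. Qed.

End Subquotient.

Section DirectProduct.
Variables (I : Type) (T : I -> zmodType).
Definition dprod := forall i, T i.
HB.instance Definition _ := Choice.on dprod.
Implicit Types f g h : dprod.

Let addA : associative (fun f g => (fun i => f i + g i) : dprod).
Proof. by move=> f g h; apply: functional_extensionality_dep => i; rewrite addrA. Qed.
Let addC : commutative (fun f g => (fun i => f i + g i) : dprod).
Proof. by move=> f g; apply: functional_extensionality_dep => i; rewrite addrC. Qed.
Let add0 : left_id ((fun=> 0) : dprod) (fun f g => (fun i => f i + g i) : dprod).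
Proof. by move=> f; apply: functional_extensionality_dep => i; rewrite add0r. Qed.
Let addN : left_inverse ((fun=> 0) : dprod) (fun f => (fun i => - f i) : dprod)
                        (fun f g => (fun i => f i + g i) : dprod).
Proof. by move=> f; apply: functional_extensionality_dep => i; rewrite addNr. Qed.
HB.instance Definition _ := GRing.isZmodule.Build dprod addA addC add0 addN.
End DirectProduct.

Section DirectSum.
Variables (I : choiceType) (T : I -> zmodType).

Definition ds_pred : {pred dprod T} :=
  [pred f | `[< finite_set [set i | f i != 0] >]].

Lemma ds_zmod_closed : zmod_closed ds_pred.
Proof.
split=> [|f g /asboolP ff /asboolP fg]; apply/asboolP.
  by apply: (sub_finite_set _ (finite_set0 I)) => i /=; rewrite eqxx.
have /sub_finite_set : [set i | (f - g) i != 0] `<=`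
    [set i | f i != 0] `|` [set i | g i != 0].
  move=> i /= fgi; apply/orP; apply: contraNT fgi.
  rewrite negb_or !negbK => /andP[/eqP fi /eqP gi].
  by apply/eqP; have -> : (f - g) i = f i - g i by []; rewrite fi gi subrr.
by apply; rewrite finite_setU.
Qed.
HB.instance Definition _ := GRing.isZmodClosed.Build (dprod T) ds_pred ds_zmod_closed.

Record dsum := DSum {
  ds_fun :> forall i, T i;
  _ : (ds_fun : dprod T) \in ds_pred
}.
HB.instance Definition _ := [isSub of dsum for (ds_fun : dsum -> dprod T)].
HB.instance Definition _ := [Choice of dsum by <:].
HB.instance Definition _ := [SubChoice_isSubZmodule of dsum by <:].

Lemma dsum_finite (f : dsum) : finite_set [set i | f i != 0].
Proof. exact: (asboolP _ (valP f)). Qed.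

Lemma dsumP (f g : dsum) : (forall i, f i = g i) -> f = g.
Proof. by move=> fg; apply/val_inj/functional_extensionality_dep. Qed.

Lemma dsumDE (f g : dsum) i : (f + g) i = f i + g i. Proof. by []. Qed.
Lemma dsum0E i : (0 : dsum) i = 0. Proof. by []. Qed.
Lemma dsumNE (f : dsum) i : (- f) i = - f i. Proof. by []. Qed.

End DirectSum.

Section Graded.
Variables (V : zmodType) (F : int -> subgrp V).

Definition gr_piece (p : int) : zmodType := subquot (F p) (F (p - 1)).
Definition grd : zmodType := dsum gr_piece.

Lemma grdP (f g : grd) : (forall i, f i = g i) -> f = g.
Proof. exact: dsumP. Qed.
Lemma grdDE (f g : grd) i : (f + g) i = f i + g i. Proof. by []. Qed.
Lemma grd0E i : (0 : grd) i = 0. Proof. by []. Qed.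
Lemma grdNE (f : grd) i : (- f) i = - f i. Proof. by []. Qed.
Lemma grd_finite (f : grd) : finite_set [set i | f i != 0].
Proof. exact: dsum_finite. Qed.

Definition gr_hom_fun (p : int) (x : V) : dprod gr_piece :=
  fun q => if q == p then sq_class (F q) (F (q - 1)) x else 0.

Lemma gr_hom_subproof p x : gr_hom_fun p x \in (@ds_pred _ gr_piece).
Proof.
apply/asboolP; apply: (sub_finite_set _ (finite_set1 p)) => q /=.
by rewrite /gr_hom_fun; case: (q =P p) => // _; rewrite eqxx.
Qed.

Definition gr_hom p x : grd := DSum (gr_hom_subproof p x).

Lemma gr_homE p x q :
  gr_hom p x q = if q == p then sq_class (F q) (F (q - 1)) x else 0.
Proof. by []. Qed.

Lemma gr_homD p x y : F p x -> F p y -> gr_hom p (x + y) = gr_hom p x + gr_hom p y.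
Proof.
move=> Fx Fy; apply: grdP => q; rewrite grdDE !gr_homE.
by case: eqP => [->|_]; rewrite ?addr0 // sq_classD.
Qed.

Lemma grd_ind (P : grd -> Prop) : P 0 -> (forall x y, P x -> P y -> P (x + y)) ->
  (forall p x, F p x -> P (gr_hom p x)) -> forall x, P x.
Proof.
move=> P0 PD Phom f.
have [s fs] : exists s : seq int, [set i | f i != 0] `<=` [set` s].
  by have /finite_seqP[s ->] := grd_finite f; exists s.
elim: s => [|p s IHs] in f fs *.
  suff -> : f = 0 by [].
  by apply: grdP => i; rewrite grd0E; apply/eqP; apply: contraT => /fs.
pose h := gr_hom p (sq_rep (f p)).
rewrite -(subrK h f) addrC; apply: (PD); first exact/Phom/sq_repP.
apply: IHs => i; rewrite /mkset grdDE grdNE /h gr_homE.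
case: (i =P p) => [->|/eqP ip]; first by rewrite sq_repK subrr eqxx.
by rewrite subr0 => /fs /=; rewrite inE (negPf ip).
Qed.

End Graded.

Lemma fsumT (V : zmodType) (I : choiceType) (S : set I) (f : I -> V) :
  (forall i, ~ S i -> f i = 0) -> \sum_(i \in setT) f i = \sum_(i \in S) f i.
Proof. by move=> f0; apply/esym/fsbig_widen => // i [_]; exact: f0. Qed.

Section GradedProduct.
Variables (U V W : zmodType) (b : U -> V -> W).
Variables (FU : int -> subgrp U) (FV : int -> subgrp V) (FW : int -> subgrp W).
Hypothesis bDl : forall x y z, b (x + y) z = b x z + b y z.
Hypothesis bDr : forall x y z, b x (y + z) = b x y + b x z.
Hypothesis Fb : forall p q x y, FU p x -> FV q y -> FW (p + q) (b x y).

(* A filtered biadditive map b induces FU_i/FU_(i-1) x FV_j/FV_(j-1) ->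
   FW_(i+j)/FW_(i+j-1), computed on representatives; the degree q part of a
   product is the finite sum over i of these terms with j = q - i. *)
Definition gr_mul_term (a : grd FU) (m : grd FV) (q i : int) : gr_piece FW q :=
  sq_class (FW q) (FW (q - 1)) (b (sq_rep (a i)) (sq_rep (m (q - i)))).

Definition gr_mul_fun (a : grd FU) (m : grd FV) : dprod (gr_piece FW) :=
  fun q => \sum_(i \in setT) gr_mul_term a m q i.

Let b0l y : b 0 y = 0.
Proof. by apply: (addrI (b 0 y)); rewrite -bDl !addr0. Qed.
Let b0r x : b x 0 = 0.
Proof. by apply: (addrI (b x 0)); rewrite -bDr !addr0. Qed.
Let bBl x y z : b (x - y) z = b x z - b y z.
Proof. by apply: (addIr (b y z)); rewrite -bDl !subrK. Qed.
Let bBr x y z : b x (y - z) = b x y - b x z.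
Proof. by apply: (addIr (b x z)); rewrite -bDr !subrK. Qed.
Let Fb' (p q i : int) x y : p + q = i -> FU p x -> FV q y -> FW i (b x y).
Proof. by move=> <-; exact: Fb. Qed.

Let term_class (q i : int) x y (x' : gr_piece FU i) (y' : gr_piece FV (q - i)) :
    FU i x -> FV (q - i) y ->
    x' = sq_class _ _ x -> y' = sq_class _ _ y ->
  sq_class (FW q) (FW (q - 1)) (b (sq_rep x') (sq_rep y'))
  = sq_class (FW q) (FW (q - 1)) (b x y).
Proof.
move=> Fx Fy -> ->.
have iq : i + (q - i) = q by rewrite addrC subrK.
apply: sq_class_eq; try by apply: (Fb' iq) => //; exact: sq_repP.
set u := sq_rep _; set v := sq_rep _.
have -> : b u v - b x y = b (u - x) v + b x (v - y).
  by rewrite bBl bBr addrA subrK.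
have Bu : FU (i - 1) (u - x) by exact: sq_rep_class.
have Bv : FV (q - i - 1) (v - y) by exact: sq_rep_class.
have Fv : FV (q - i) v by exact: sq_repP.
have H1 : FW (q - 1) (b (u - x) v) by apply: Fb' Bu Fv; rewrite addrAC iq.
have H2 : FW (q - 1) (b x (v - y)) by apply: Fb' Fx Bv; rewrite addrA iq.
exact: sgD.
Qed.

Let rep_class (V' : zmodType) (F : int -> subgrp V') p (x : gr_piece F p) :
  x = sq_class _ _ (sq_rep x).
Proof. by rewrite sq_repK. Qed.

Let term0l (a : grd FU) (m : grd FV) (q i : int) : a i = 0 -> gr_mul_term a m q i = 0.
Proof.
move=> ai0; rewrite /gr_mul_term ai0 (term_class (x := 0) (y := sq_rep (m (q - i)))).
- by rewrite b0l sq_class0.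
- exact: sg0.
- exact: sq_repP.
- by rewrite sq_class0.
- exact: rep_class.
Qed.

Let term0r (a : grd FU) (m : grd FV) (q i : int) : m (q - i) = 0 -> gr_mul_term a m q i = 0.
Proof.
move=> mi0; rewrite /gr_mul_term mi0 (term_class (x := sq_rep (a i)) (y := 0)).
- by rewrite b0r sq_class0.
- exact: sq_repP.
- exact: sg0.
- exact: rep_class.
- by rewrite sq_class0.
Qed.

Let termDl (a a' : grd FU) (m : grd FV) (q i : int) :
  gr_mul_term (a + a') m q i = gr_mul_term a m q i + gr_mul_term a' m q i.
Proof.
have iq : i + (q - i) = q by rewrite addrC subrK.
have [Fa Fa'] : FU i (sq_rep (a i)) /\ FU i (sq_rep (a' i)) by split; exact: sq_repP.
have Fm : FV (q - i) (sq_rep (m (q - i))) by exact: sq_repP.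
rewrite /gr_mul_term (term_class (x := sq_rep (a i) + sq_rep (a' i))
  (y := sq_rep (m (q - i)))) //.
- by rewrite bDl sq_classD //; apply: Fb' iq _ _.
- exact: sgD.
- by rewrite sq_classD // !sq_repK.
Qed.

Let termDr (a : grd FU) (m m' : grd FV) (q i : int) :
  gr_mul_term a (m + m') q i = gr_mul_term a m q i + gr_mul_term a m' q i.
Proof.
have iq : i + (q - i) = q by rewrite addrC subrK.
set j := q - i in iq *.
have [Fm Fm'] : FV j (sq_rep (m j)) /\ FV j (sq_rep (m' j)) by split; exact: sq_repP.
have Fa : FU i (sq_rep (a i)) by exact: sq_repP.
rewrite /gr_mul_term (term_class (x := sq_rep (a i)) (y := sq_rep (m j) + sq_rep (m' j))) //.
- by rewrite bDr sq_classD //; apply: Fb' iq _ _.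
- exact: sgD.
- by rewrite sq_classD // !sq_repK.
Qed.

Lemma gr_mul_subproof a m : gr_mul_fun a m \in (@ds_pred _ (gr_piece FW)).
Proof.
apply/asboolP.
have := finite_image2 +%R (grd_finite a) (grd_finite m).
apply: sub_finite_set => q /= /eqP qn0.
apply: contrapT => nq; apply: qn0; apply: fsbig1 => i _.
have [/term0l->//|an0] := eqVneq (a i) 0.
have [/term0r->//|mn0] := eqVneq (m (q - i)) 0.
by case: nq; exists i => //; exists (q - i) => //; rewrite addrC subrK.
Qed.

Definition gr_mul (a : grd FU) (m : grd FV) : grd FW := DSum (gr_mul_subproof a m).

Lemma gr_mulDl a a' m : gr_mul (a + a') m = gr_mul a m + gr_mul a' m.
Proof.
apply: grdP => q; rewrite grdDE /= /gr_mul_fun.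
pose S := [set i | a i != 0] `|` [set i | a' i != 0].
have S0 i : ~ S i -> a i = 0 /\ a' i = 0.
  by move=> /not_orP[/negP + /negP]; rewrite !negbK => /eqP-> /eqP->.
have finS : finite_set S by rewrite finite_setU; split; exact: grd_finite.
rewrite !(@fsumT _ _ S) => [|i /S0[_ /term0l]//|i /S0[/term0l]//|i /S0[ai a'i]].
  by rewrite -fsbig_split //; apply: eq_fsbigr => i _; rewrite termDl.
by rewrite term0l // grdDE ai a'i addr0.
Qed.

Lemma gr_mulDr a m m' : gr_mul a (m + m') = gr_mul a m + gr_mul a m'.
Proof.
apply: grdP => q; rewrite grdDE /= /gr_mul_fun.
pose S := [set i | a i != 0].
have S0 i : ~ S i -> a i = 0 by move=> /negP; rewrite negbK => /eqP->.
have finS : finite_set S by exact: grd_finite.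
rewrite !(@fsumT _ _ S) => [|i /S0/term0l//|i /S0/term0l//|i /S0/term0l//].
by rewrite -fsbig_split //; apply: eq_fsbigr => i _; rewrite termDr.
Qed.

Lemma gr_mul0l m : gr_mul 0 m = 0.
Proof. by apply: (addrI (gr_mul 0 m)); rewrite -gr_mulDl !addr0. Qed.

Lemma gr_mul0r a : gr_mul a 0 = 0.
Proof. by apply: (addrI (gr_mul a 0)); rewrite -gr_mulDr !addr0. Qed.

Lemma gr_mul_hom i j u v : FU i u -> FV j v ->
  gr_mul (gr_hom FU i u) (gr_hom FV j v) = gr_hom FW (i + j) (b u v).
Proof.
move=> Fu Fv; apply: grdP => q; rewrite gr_homE /= /gr_mul_fun.
rewrite (@fsumT _ _ [set i]); last first.
  by move=> k /= /eqP/negPf ki; rewrite term0l // gr_homE ki.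
rewrite fsbig_set1; case: eqP => [->|qn].
  have eqj : i + j - i = j by rewrite addrAC subrr add0r.
  apply: term_class => //; rewrite ?gr_homE ?eqxx // ?eqj //.
  by rewrite eqxx.
rewrite term0r // gr_homE ifF //; apply/eqP => qij; apply: qn.
by rewrite -qij addrC subrK.
Qed.

End GradedProduct.

Record ring_filtration (L : pzRingType) := RingFiltration {
  rf :> nat -> subgrp L;
  rf1 : rf 0 1;
  rf_incr : forall p x, rf p x -> rf p.+1 x;
  rfM : forall p q x y, rf p x -> rf q y -> rf (p + q) (x * y);
  rf_exh : forall x, exists p, rf p x
}.

Lemma eq0_subgrp (V : zmodType) (x y : V) : x = 0 -> y = 0 -> x - y = 0.
Proof. by move=> -> ->; rewrite subrr. Qed.
Definition sg_zero (V : zmodType) : subgrp V :=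
  @Subgrp V (fun x => x = 0) erefl (@eq0_subgrp V).

(* F_p extended to all integers, with F_p = 0 for p < 0 *)
Definition rfz (L : pzRingType) (F : ring_filtration L) (p : int) : subgrp L :=
  if p is Posz n then F n else sg_zero L.

Record mod_filtration (L : pzRingType) (F : ring_filtration L) (M : lmodType L) :=
ModFiltration {
  mf :> int -> subgrp M;
  mf_incr : forall p x, mf p x -> mf (p + 1) x;
  mf_bounded : exists n : nat, forall p : nat, (n <= p)%N ->
    forall x, mf (- p%:Z) x -> x = 0;
  mfZ : forall (p : nat) (q : int) a x, F p a -> mf q x -> mf (p%:Z + q) (a *: x);
  mf_exh : forall x, exists p, mf p x
}.

Definition good_filtration (L : pzRingType) (F : ring_filtration L)
    (M : lmodType L) (FM : mod_filtration F M) :=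
  exists (r : nat) (ps : 'I_r -> int) (ms : 'I_r -> M), forall (p : int) (x : M),
    FM p x <-> exists a : 'I_r -> L,
      (forall k, rfz F (p - ps k) (a k)) /\ x = \sum_k a k *: ms k.

Section GrRing.
Variables (L : pzRingType) (F : ring_filtration L).

Lemma rfzM p q x y : rfz F p x -> rfz F q y -> rfz F (p + q) (x * y).
Proof.
case: p => [p|p] /=; last by move=> -> _; rewrite mul0r; exact: sg0.
case: q => [q|q] /=; last by move=> _ ->; rewrite mulr0; exact: sg0.
exact: rfM.
Qed.

(* The summands of degree p < 0 are 0 / 0, so this is the direct sum over
   p >= 0 of the groups F_p / F_(p-1). *)
Definition gr_ring : Type := grd (rfz F).
HB.instance Definition _ := GRing.Zmodule.on gr_ring.

Definition gr_ring_mul : gr_ring -> gr_ring -> gr_ring :=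
  gr_mul (@mulrDl L) (@mulrDr L) rfzM.
Definition gr_ring_one : gr_ring := gr_hom (rfz F) 0 1.

Let mulA : associative gr_ring_mul.
Proof.
move=> x y z; elim/grd_ind: x => [|x x' IH IH'|p x Fx].
- by rewrite /gr_ring_mul !gr_mul0l.
- by rewrite /gr_ring_mul !gr_mulDl; congr (_ + _).
elim/grd_ind: y => [|y y' IH IH'|q y Fy].
- by rewrite /gr_ring_mul !(gr_mul0l, gr_mul0r).
- by rewrite /gr_ring_mul !(gr_mulDl, gr_mulDr); congr (_ + _).
elim/grd_ind: z => [|z z' IH IH'|r z Fz].
- by rewrite /gr_ring_mul !gr_mul0r.
- by rewrite /gr_ring_mul !gr_mulDr; congr (_ + _).
by rewrite /gr_ring_mul !gr_mul_hom ?addrA ?mulrA //; exact: rfzM.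
Qed.

Let mul1 : left_id gr_ring_one gr_ring_mul.
Proof.
move=> x; elim/grd_ind: x => [|x x' IH IH'|p x Fx].
- by rewrite /gr_ring_mul gr_mul0r.
- by rewrite /gr_ring_mul gr_mulDr; congr (_ + _).
by rewrite /gr_ring_mul gr_mul_hom ?add0r ?mul1r //; exact: rf1.
Qed.

Let mul1' : right_id gr_ring_one gr_ring_mul.
Proof.
move=> x; elim/grd_ind: x => [|x x' IH IH'|p x Fx].
- by rewrite /gr_ring_mul gr_mul0l.
- by rewrite /gr_ring_mul gr_mulDl; congr (_ + _).
by rewrite /gr_ring_mul gr_mul_hom ?addr0 ?mulr1 //; exact: rf1.
Qed.

Let mulDl : left_distributive gr_ring_mul +%R.
Proof. by move=> x y z; exact: gr_mulDl. Qed.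
Let mulDr : right_distributive gr_ring_mul +%R.
Proof. by move=> x y z; exact: gr_mulDr. Qed.

HB.instance Definition _ :=
  GRing.Zmodule_isPzRing.Build gr_ring mulA mul1 mul1' mulDl mulDr.

Section GrMod.
Variables (M : lmodType L) (FM : mod_filtration F M).

Lemma mfzZ p q a x : rfz F p a -> FM q x -> FM (p + q) (a *: x).
Proof.
case: p => [p|p] /=; last by move=> -> _; rewrite scale0r; exact: sg0.
exact: mfZ.
Qed.

Definition gr_mod : Type := grd FM.
HB.instance Definition _ := GRing.Zmodule.on gr_mod.

Definition gr_scale : gr_ring -> gr_mod -> gr_mod :=
  gr_mul (fun a b (x : M) => scalerDl x a b) (@scalerDr L M) mfzZ.

Let scaleA a b x : gr_scale a (gr_scale b x) = gr_scale (a * b) x.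
Proof.
have -> : a * b = gr_ring_mul a b by [].
elim/grd_ind: a => [|a a' IH IH'|p a Fa].
- by rewrite /gr_ring_mul /gr_scale !gr_mul0l.
- by rewrite /gr_ring_mul /gr_scale !gr_mulDl; congr (_ + _).
elim/grd_ind: b => [|b b' IH IH'|q b Fb].
- by rewrite /gr_ring_mul /gr_scale !(gr_mul0l, gr_mul0r).
- by rewrite /gr_ring_mul /gr_scale !(gr_mulDl, gr_mulDr); congr (_ + _).
elim/grd_ind: x => [|x x' IH IH'|r x Fx].
- by rewrite /gr_ring_mul /gr_scale !gr_mul0r.
- by rewrite /gr_ring_mul /gr_scale !gr_mulDr; congr (_ + _).
rewrite /gr_ring_mul /gr_scale !gr_mul_hom ?addrA ?scalerA //.
  exact: rfzM.
exact: mfzZ.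
Qed.

Let scale1 : left_id 1 gr_scale.
Proof.
move=> x; have -> : 1 = gr_ring_one :> gr_ring by [].
elim/grd_ind: x => [|x x' IH IH'|p x Fx].
- by rewrite /gr_scale gr_mul0r.
- by rewrite /gr_scale gr_mulDr; congr (_ + _).
by rewrite /gr_scale gr_mul_hom ?add0r ?scale1r //; exact: rf1.
Qed.

Let scaleDr : right_distributive gr_scale +%R.
Proof. by move=> x y z; exact: gr_mulDr. Qed.
Let scaleDl x : {morph gr_scale^~ x : a b / a + b}.
Proof. by move=> a b; exact: gr_mulDl. Qed.

HB.instance Definition _ :=
  GRing.Zmodule_isLmodule.Build gr_ring gr_mod scaleA scale1 scaleDr scaleDl.
End GrMod.
End GrRing.

Section LinearGroup.
Variables (R : pzRingType) (X Y : lmodType R).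
Implicit Types f g h : {linear X -> Y}.

Lemma linear_ext f g : f =1 g -> f = g.
Proof.
case: f => f cf; case: g => g cg /funext /= fg.
move: cf cg; rewrite {}fg => -[[a] [b]] [[a'] [b']].
by rewrite (Prop_irrelevance a a') (Prop_irrelevance b b').
Qed.

HB.instance Definition _ := gen_eqMixin {linear X -> Y}.
HB.instance Definition _ := gen_choiceMixin {linear X -> Y}.

Let addA : associative (fun f g => f \+ g : {linear X -> Y}).
Proof. by move=> f g h; apply: linear_ext => x /=; rewrite addrA. Qed.
Let addC : commutative (fun f g => f \+ g : {linear X -> Y}).
Proof. by move=> f g; apply: linear_ext => x /=; rewrite addrC. Qed.
Let add0 : left_id (\0 : {linear X -> Y}) (fun f g => f \+ g : {linear X -> Y}).
Proof. by move=> f; apply: linear_ext => x /=; rewrite add0r. Qed.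
Let addN : left_inverse (\0 : {linear X -> Y}) (fun f => \- f : {linear X -> Y})
                        (fun f g => f \+ g : {linear X -> Y}).
Proof. by move=> f; apply: linear_ext => x /=; rewrite addNr. Qed.
HB.instance Definition _ :=
  GRing.isZmodule.Build {linear X -> Y} addA addC add0 addN.

Lemma linear_addE f g x : (f + g) x = f x + g x. Proof. by []. Qed.
Lemma linear_oppE f x : (- f) x = - f x. Proof. by []. Qed.
Lemma linear_zeroE x : (0 : {linear X -> Y}) x = 0. Proof. by []. Qed.

End LinearGroup.

(* Right modules are left modules over the opposite ring R^c; the bidual is then
   a left module over (R^c)^c, which is convertible to R. *)

Section Dual.
Variables (R : pzRingType) (X : lmodType R).

Definition dual : Type := {linear X -> R^o}.
HB.instance Definition _ := GRing.Zmodule.on dual.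
Implicit Types f g : dual.

Definition dual_fun f : X -> R := f.

Definition dual_scale_fun (r : R^c) f : X -> R^o := fun x => (dual_fun f x : R) * r.

Lemma dual_scale_linear r f : linear (dual_scale_fun r f).
Proof.
move=> a x y; rewrite /dual_scale_fun /dual_fun linearP.
by rewrite [LHS]mulrDl -[in LHS]mulrA.
Qed.
HB.instance Definition _ r f :=
  GRing.isLinear.Build R X R^o *:%R (dual_scale_fun r f) (dual_scale_linear r f).

Definition dual_scale (r : R^c) f : dual := (dual_scale_fun r f : {linear X -> R^o}).

Let scaleA a b f : dual_scale a (dual_scale b f) = dual_scale (a * b) f.
Proof. by apply: linear_ext => x /=; rewrite /dual_scale_fun /dual_fun /= mulrA. Qed.
Let scale1 : left_id 1 dual_scale.
Proof. by move=> f; apply: linear_ext => x /=; rewrite /dual_scale_fun mulr1. Qed.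
Let scaleDr : right_distributive dual_scale +%R.
Proof. by move=> r f g; apply: linear_ext => x; exact: mulrDl. Qed.
Let scaleDl f : {morph dual_scale^~ f : a b / a + b}.
Proof. by move=> a b; apply: linear_ext => x; exact: mulrDr. Qed.
HB.instance Definition _ :=
  GRing.Zmodule_isLmodule.Build R^c dual scaleA scale1 scaleDr scaleDl.

End Dual.

Section Bidual.
Variables (R : pzRingType) (X : lmodType R).

Definition eval_fun (x : X) : dual X -> (R^c)^o := fun f => dual_fun f x.
Lemma eval_linear x : linear (eval_fun x).
Proof. by []. Qed.
HB.instance Definition _ x :=
  GRing.isLinear.Build R^c (dual X) (R^c)^o *:%R (eval_fun x) (eval_linear x).

Definition bidual_map (x : X) : dual (dual X) :=
  (eval_fun x : {linear dual X -> (R^c)^o}).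
End Bidual.

Definition surj_map (A B : Type) (f : A -> B) := forall y, exists x, f x = y.

Definition exact_at (A : Type) (B C : zmodType) (f : A -> B) (g : B -> C) :=
  forall y, g y = 0 <-> exists x, f x = y.

Definition projective (R : pzRingType) (P : lmodType R) :=
  forall (A B : lmodType R) (g : {linear A -> B}) (f : {linear P -> B}),
    surj_map g -> exists h : {linear P -> A}, forall x, g (h x) = f x.

Record resolution (R : pzRingType) (X : lmodType R) := Resolution {
  res_mod :> nat -> lmodType R;
  res_d : forall n, {linear res_mod n.+1 -> res_mod n};
  res_aug : {linear res_mod 0 -> X};
  res_proj : forall n, projective (res_mod n);
  res_aug_surj : surj_map res_aug;
  res_exact0 : exact_at (res_d 0) res_aug;
  res_exact : forall n, exact_at (res_d n.+1) (res_d n)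
}.

Section Cohomology.
Variables (R : pzRingType) (X Y : lmodType R) (P : resolution X) (n : nat).

(* kernel and image in degree n of the complex Hom (P_n, Y) *)
Definition cocycle_set (f : {linear P n -> Y}) := forall x, f (res_d P n x) = 0.

Definition coboundary_set : {linear P n -> Y} -> Prop :=
  match n return {linear P n -> Y} -> Prop with
  | 0 => fun f => f = 0
  | k.+1 => fun f => exists g : {linear P k -> Y}, forall x, f x = g (res_d P k x)
  end.

Lemma cocycle0 : cocycle_set 0. Proof. by []. Qed.
Lemma cocycleB f g : cocycle_set f -> cocycle_set g -> cocycle_set (f - g).
Proof. by move=> cf cg x; rewrite linear_addE linear_oppE cf cg subrr. Qed.
Definition cocycle := Subgrp cocycle0 cocycleB.

Lemma coboundary0 : coboundary_set 0.
Proof. by rewrite /coboundary_set; case: n => // k; exists 0 => x. Qed.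
Lemma coboundaryB f g : coboundary_set f -> coboundary_set g -> coboundary_set (f - g).
Proof.
rewrite /coboundary_set; case: n f g => [|k] f g; first exact: eq0_subgrp.
move=> [f' ff'] [g' gg']; exists (f' - g') => x.
by rewrite !linear_addE !linear_oppE ff' gg'.
Qed.
Definition coboundary := Subgrp coboundary0 coboundaryB.

Definition cohomology : zmodType := subquot cocycle coboundary.
End Cohomology.

Section Free.
Variables (R : pzRingType) (S : choiceType).

Definition free_pred : {pred S -> R^o} :=
  [pred f | `[< finite_set [set x | f x != 0] >]].

Lemma free_submod_closed : submod_closed free_pred.
Proof.
split=> [|a f g /asboolP ff /asboolP fg]; apply/asboolP.
  by apply: (sub_finite_set _ (finite_set0 S)) => i /=; rewrite eqxx.
have /sub_finite_set : [set i | (a *: f + g) i != 0] `<=`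
    [set i | f i != 0] `|` [set i | g i != 0].
  move=> i /= fgi; apply/orP; apply: contraNT fgi.
  rewrite negb_or !negbK => /andP[/eqP fi /eqP gi].
  by apply/eqP; have -> : (a *: f + g) i = a *: f i + g i by []; rewrite fi gi scaler0 addr0.
by apply; rewrite finite_setU.
Qed.
HB.instance Definition _ :=
  GRing.isSubmodClosed.Build R (S -> R^o) free_pred free_submod_closed.

(* the free module on S: finitely supported functions *)
Record free := Free { free_fun :> S -> R; _ : (free_fun : S -> R^o) \in free_pred }.
HB.instance Definition _ := [isSub of free for (free_fun : free -> (S -> R^o))].
HB.instance Definition _ := [Choice of free by <:].
HB.instance Definition _ := [SubChoice_isSubLmodule of free by <:].

Lemma freeP (f g : free) : (forall x, f x = g x) -> f = g.
Proof. by move=> fg; apply/val_inj/funext. Qed.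
Lemma freeDE (f g : free) x : (f + g) x = f x + g x. Proof. by []. Qed.
Lemma freeZE a (f : free) x : (a *: f) x = a * f x. Proof. by []. Qed.
Lemma free_finite (f : free) : finite_set [set x | f x != 0].
Proof. exact: (asboolP _ (valP f)). Qed.

Lemma free_unit_subproof (x : S) :
  ((fun y => (y == x)%:R) : S -> R^o) \in free_pred.
Proof.
apply/asboolP; apply: (sub_finite_set _ (finite_set1 x)) => y /=.
by apply: contra_neqP => /eqP/negPf ->.
Qed.
Definition free_unit x : free := Free (free_unit_subproof x).

Variable X : lmodType R.

Definition free_lift_fun (v : S -> X) (f : free) : X := \sum_(x \in setT) f x *: v x.

Lemma free_lift_linear v : linear (free_lift_fun v).
Proof.
move=> a f g; rewrite /free_lift_fun.
pose A := [set x | f x != 0] `|` [set x | g x != 0].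
have A0 x : ~ A x -> f x = 0 /\ g x = 0.
  by move=> /not_orP[/negP + /negP]; rewrite !negbK => /eqP-> /eqP->.
have finA : finite_set A by rewrite finite_setU; split; exact: free_finite.
rewrite !(@fsumT _ _ A) => [|x /A0[_ ->]|x /A0[-> _]|x /A0[fx gx]];
  rewrite ?scale0r //; last by rewrite freeDE freeZE fx gx mulr0 addr0 scale0r.
rewrite !fsbig_finite // scaler_sumr -big_split; apply: eq_bigr => x _.
by rewrite freeDE freeZE scalerDl scalerA.
Qed.
HB.instance Definition _ v :=
  GRing.isLinear.Build R free X *:%R (free_lift_fun v) (free_lift_linear v).

Definition free_lift v : {linear free -> X} := free_lift_fun v.

Lemma free_lift_unit v x : free_lift v (free_unit x) = v x.
Proof.
rewrite /= /free_lift_fun (@fsumT _ _ [set x]).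
  by rewrite fsbig_set1 /= eqxx scale1r.
by move=> y /= /eqP/negPf ->; rewrite scale0r.
Qed.

Lemma free_ext (u w : {linear free -> X}) :
  (forall x, u (free_unit x) = w (free_unit x)) -> forall f, u f = w f.
Proof.
move=> uw f.
have [s fs] : exists s : seq S, [set i | f i != 0] `<=` [set` s].
  by have /finite_seqP[s ->] := free_finite f; exists s.
elim: s => [|p s IHs] in f fs *.
  suff -> : f = 0 by rewrite !linear0.
  by apply: freeP => i; apply/eqP; apply: contraT => /fs.
have -> : f = (f - f p *: free_unit p) + f p *: free_unit p by rewrite subrK.
rewrite (linearD u) (linearD w) (linearZZ u) (linearZZ w) uw.
suff -> : u (f - f p *: free_unit p) = w (f - f p *: free_unit p) by [].
apply: IHs => i; rewrite /mkset -scaleNr freeDE freeZE /=.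
case: (i =P p) => [->|/eqP ip]; first by rewrite mulr1 subrr eqxx.
by rewrite mulr0 addr0 => /fs /=; rewrite inE (negPf ip).
Qed.

End Free.

Lemma free_projective (R : pzRingType) (S : choiceType) : projective (free R S).
Proof.
move=> A B g f /(_ (f (free_unit R _))) gs.
pose v x := projT1 (cid (gs x)).
exists (free_lift v) => x; move: x.
apply: (free_ext (u := (g \o free_lift v : {linear _ -> _})) (w := f)) => x.
by rewrite [LHS]/= free_lift_unit; exact: (projT2 (cid (gs x))).
Qed.

(* The canonical free resolution: P_n is free on the underlying set of the n-th
   syzygy, which is the kernel of the evaluation onto the previous one *)

Section Kernel.
Variables (R : pzRingType) (X Y : lmodType R) (f : {linear X -> Y}).

Definition ker_pred : {pred X} := [pred x | f x == 0].
Lemma ker_submod_closed : submod_closed ker_pred.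
Proof.
split=> [|a x y]; rewrite !inE ?linear0 // => /eqP fx /eqP fy.
by rewrite linearP fx fy scaler0 addr0.
Qed.
HB.instance Definition _ :=
  GRing.isSubmodClosed.Build R X ker_pred ker_submod_closed.

Record ker := Ker { ker_val : X; _ : ker_val \in ker_pred }.
HB.instance Definition _ := [isSub for ker_val].
HB.instance Definition _ := [Choice of ker by <:].
HB.instance Definition _ := [SubChoice_isSubLmodule of ker by <:].
End Kernel.

Section StandardResolution.
Variables (R : pzRingType) (X : lmodType R).

Fixpoint syzygy (n : nat) : lmodType R :=
  if n is k.+1 then ker (@free_lift R (syzygy k) (syzygy k) id) else X.

Definition std_mod n : lmodType R := free R (syzygy n).
Definition std_aug n : {linear std_mod n -> syzygy n} := free_lift id.
Definition std_d n : {linear std_mod n.+1 -> std_mod n} :=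
  (val : syzygy n.+1 -> std_mod n) \o std_aug n.+1.

Lemma std_aug_surj n : surj_map (std_aug n).
Proof. by move=> x; exists (free_unit R x); exact: free_lift_unit. Qed.

Lemma std_exact_aug n : exact_at (std_d n) (std_aug n).
Proof.
move=> y; split=> [y0|[x <-]]; last first.
  by apply/eqP; exact: (valP (std_aug n.+1 x : ker _)).
have yk : y \in ker_pred (std_aug n) by exact/eqP.
have [x xy] := std_aug_surj (Ker yk : syzygy n.+1).
by exists x; rewrite /std_d [LHS]/= xy.
Qed.

Lemma std_exact n : exact_at (std_d n.+1) (std_d n).
Proof.
move=> y; rewrite -std_exact_aug.
have -> : std_d n y = (val : ker _ -> std_mod n) (std_aug n.+1 y) by [].
split=> [y0|->]; last by [].
exact/val_inj.
Qed.

Definition std_resolution : resolution X :=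
  Resolution (res_d := std_d) (res_aug := std_aug 0)
    (fun n => @free_projective R (syzygy n)) (@std_aug_surj 0)
    (@std_exact_aug 0) std_exact.
End StandardResolution.

Definition Ext (R : pzRingType) (n : nat) (X Y : lmodType R) : zmodType :=
  cohomology Y (std_resolution X) n.

(* left Noetherian; only applied to commutative rings *)
Definition noetherian (R : pzRingType) :=
  forall I : R -> Prop, I 0 -> (forall a x y, I x -> I y -> I (a * x + y)) ->
    exists (n : nat) (g : 'I_n -> R),
      forall x, I x <-> exists c : 'I_n -> R, x = \sum_i c i * g i.

Definition fin_gen (R : pzRingType) (X : lmodType R) :=
  exists (n : nat) (g : 'I_n -> X),
    forall x, exists c : 'I_n -> R, x = \sum_i c i *: g i.

(* infimum in {0, 1, 2, ...} with infinity, the latter written None *)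
Definition nat_inf (A : nat -> Prop) : option nat :=
  if pselect (exists n, `[< A n >]) is left exA then Some (ex_minn exA) else None.

Definition is_trivial (V : zmodType) := forall x : V, x = 0.

Definition grade (R : pzRingType) (X : lmodType R) : option nat :=
  nat_inf (fun k => ~ is_trivial (Ext k X R^o)).

Definition Gdim_eq0 (R : pzRingType) (X : lmodType R) :=
  [/\ bijective (@bidual_map R X),
      forall k, (0 < k)%N -> is_trivial (Ext k X R^o) &
      forall k, (0 < k)%N -> is_trivial (Ext k (dual X : lmodType R^c) (R^c)^o)].

(* 0 -> G_k -> ... -> G_0 -> X -> 0, padded on the left with G_i = 0 for i > k *)
Definition has_Gresolution (R : pzRingType) (X : lmodType R) (k : nat) :=
  exists (G : nat -> lmodType R) (d : forall i, {linear G i.+1 -> G i})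
         (e : {linear G 0 -> X}),
    [/\ forall i, (i <= k)%N -> fin_gen (G i) /\ Gdim_eq0 (G i),
        forall i, (k < i)%N -> is_trivial (G i),
        surj_map e, exact_at (d 0) e & forall i, exact_at (d i.+1) (d i)].

Definition Gdim_le (R : pzRingType) (X : lmodType R) (k : nat) :=
  if k is 0 then Gdim_eq0 X else has_Gresolution X k.

Definition Gdim (R : pzRingType) (X : lmodType R) : option nat :=
  nat_inf (Gdim_le X).

(* Main.v *)
(** Let A = gr L and N = gr M.  A filtered free resolution of M whose symbols
resolve N gives Ext^j(N, A) = 0 -> Ext^j(M, L) = 0, and, comparing the complex
Hom(P, L) with its associated graded (Artin-Rees supplies the convergence), if
Ext^g(M, L) = 0 = Ext^(g-1)(N, A) then Ext^g(N, A) is an iterated extension of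
subquotients of Ext^(g+1)(N, A).

So it suffices to find a prime p at which Ext^(g+1)(N, A) vanishes locally and
Ext^g(N, A) does not, g being the grade of N.  Take g least such that
Ext^g(A/a, A) <> 0 for some ideal a containing the annihilator of N, and p
maximal among these ideals a.  Then p is prime, Ext^g(A/p, A) is torsion-free
over A/p, and a nonzero map N -> A/p shows that Ext^g(N, A) is nonzero at p.
Finite Gorenstein dimension embeds N in a module H of finite projective
dimension with the same higher Ext into A; as Ext^j(A/p, A) = 0 for j < g,
the g-th syzygy of H is projective at p, whence Ext^(g+1)(N, A) = 0 at p.

Localization at p is never formed: "zero at p" is "each element is killed by
some s outside p". *)

From HB Require Import structures.
Require Import Defs.
From mathcomp Require Import all_boot all_order all_algebra zify.
From mathcomp Require Import boolp classical_sets functions cardinality fsbigop.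

Set Implicit Arguments.
Unset Strict Implicit.
Unset Printing Implicit Defensive.

Import Order.TTheory GRing.Theory Num.Theory Quotient.
Local Open Scope classical_set_scope.
Local Open Scope ring_scope.
Local Open Scope quotient_scope.

(** * Modules and resolutions *)

(** The hard inequality is grade M <= grade N. In the spectral sequence from Ext(N, A) to Ext(M, L),
    the term Ext^g(N, A) receives differentials from Ext^(g-1)(N, A), which vanishes, but emits
    differentials into Ext^(g+1)(N, A), and these could destroy it. Finite Gorenstein dimension
    controls Ext^(g+1) locally: at the chosen p the ring has depth g, so the Auslander-Bridger
    formula bounds the Gorenstein dimension of N there by g. An argument with a single class of
    Ext^g(A/p, A) replaces that formula, and neither depth nor regular sequences appear. The
    maximality of p gives, besides primality, the torsion-freeness that makes a nonzero class
    survive at p.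

    Torsion by elements s outside p must be compatible with symbols although p need not be graded;
    it is enough that some homogeneous component of s lies outside p. Since the filtrations are
    bounded below, repeated corrections by terms of lower degree stop; Artin-Rees bounds how far the
    degree of D z has to drop before D z comes from a cochain of lower degree than z. *)

Definition mklin (R : pzRingType) (X Y : lmodType R) (f : X -> Y)
    (fP : linear f) : {linear X -> Y} :=
  HB.pack f (GRing.isLinear.Build R X Y *:%R f fP).

Definition submod (R : pzRingType) (X : lmodType R) (U : X -> Prop) :=
  U 0 /\ forall a x y, U x -> U y -> U (a *: x + y).

Section Submod.
Variables (R : pzRingType) (X : lmodType R) (U : X -> Prop).
Hypothesis UP : submod U.

Lemma submod0 : U 0. Proof. exact: UP.1. Qed.
Lemma submodZ a x : U x -> U (a *: x).
Proof. by move=> Ux; rewrite -[a *: x]addr0; apply: UP.2 => //; exact: submod0. Qed.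
Lemma submodD x y : U x -> U y -> U (x + y).
Proof. by move=> Ux Uy; rewrite -[x]scale1r; apply: UP.2. Qed.
Lemma submodN x : U x -> U (- x).
Proof. by rewrite -scaleN1r; exact: submodZ. Qed.
Lemma submodB x y : U x -> U y -> U (x - y).
Proof. by move=> Ux Uy; apply: submodD => //; exact: submodN. Qed.
Lemma submod_sum I (r : seq I) (P : pred I) F :
  (forall i, P i -> U (F i)) -> U (\sum_(i <- r | P i) F i).
Proof. by apply: big_ind; [exact: submod0|exact: submodD]. Qed.
End Submod.

Section QuotientModule.
Variables (R : pzRingType) (X : lmodType R) (U : X -> Prop).
Hypothesis UP : submod U.

(** The proof of [submod U] is an argument so that the structures declared on [qm_pred UP] can
    recover it after the section is closed. *)
Definition qm_pred of submod U : {pred X} := [pred x | `[< U x >]].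

Lemma qm_zmod_closed : zmod_closed (qm_pred UP).
Proof.
split=> [|x y /asboolP Ux /asboolP Uy]; apply/asboolP; first exact: (submod0 UP).
exact: (submodB UP).
Qed.
HB.instance Definition _ :=
  GRing.isZmodClosed.Build X (qm_pred UP) qm_zmod_closed.

Definition qmod : Type := {quot (qm_pred UP)}.
HB.instance Definition _ := GRing.Zmodule.on qmod.

Definition qm_proj (x : X) : qmod := \pi_{quot (qm_pred UP)} x.

Lemma qm_projP x y : (qm_proj x = qm_proj y) <-> U (x - y).
Proof.
split=> [/eqP|Uxy]; first by rewrite -idealrBE => /asboolP.
by apply/eqP; rewrite -idealrBE; apply/asboolP.
Qed.

Lemma qm_projD x y : qm_proj (x + y) = qm_proj x + qm_proj y.
Proof. exact: raddfD. Qed.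

Definition qm_rep (x : qmod) : X := repr (x : {quot (qm_pred UP)}).
Lemma qm_repK x : qm_proj (qm_rep x) = x. Proof. exact: reprK. Qed.

Definition qm_scale (a : R) (x : qmod) : qmod := qm_proj (a *: qm_rep x).

Lemma qm_scale_proj a x : qm_scale a (qm_proj x) = qm_proj (a *: x).
Proof.
apply/qm_projP; rewrite -scalerBr; apply: submodZ => //.
by apply/qm_projP; rewrite qm_repK.
Qed.

Let scaleA a b x : qm_scale a (qm_scale b x) = qm_scale (a * b) x.
Proof. by rewrite -[x]qm_repK !qm_scale_proj scalerA. Qed.
Let scale1 : left_id 1 qm_scale.
Proof. by move=> x; rewrite -[x]qm_repK !qm_scale_proj scale1r. Qed.
Let scaleDr : right_distributive qm_scale +%R.
Proof.
by move=> a x y; rewrite -[x]qm_repK -[y]qm_repK -qm_projD !qm_scale_proj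
  scalerDr qm_projD.
Qed.
Let scaleDl x : {morph qm_scale^~ x : a b / a + b}.
Proof. by move=> a b; rewrite -[x]qm_repK !qm_scale_proj scalerDl qm_projD. Qed.
HB.instance Definition _ :=
  GRing.Zmodule_isLmodule.Build R qmod scaleA scale1 scaleDr scaleDl.

Lemma quotient_exists : exists (Q : lmodType R) (q : {linear X -> Q}),
  surj_map q /\ forall x, q x = 0 <-> U x.
Proof.
have lin : linear (qm_proj : X -> qmod).
  move=> a x y; rewrite qm_projD; congr (_ + _); symmetry; exact: qm_scale_proj.
exists (qmod : lmodType R), (mklin lin); split=> [y|x].
  by exists (qm_rep y); exact: qm_repK.
have -> : mklin lin x = qm_proj x by [].
have -> : (0 : qmod) = qm_proj 0 by symmetry; exact: raddf0.
by rewrite qm_projP subr0.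
Qed.
End QuotientModule.

Lemma linear_sum_eq (R : pzRingType) (X Y : lmodType R) (f : {linear X -> Y}) n
  (c : 'I_n -> R) (x : 'I_n -> X) :
  f (\sum_i c i *: x i) = \sum_i c i *: f (x i).
Proof. by rewrite linear_sum; apply: eq_bigr => i _; rewrite linearZ. Qed.

Section Factor.
Variable R : pzRingType.
Implicit Types X Y Z P Q : lmodType R.

Lemma factor_surj X Q Y (q : {linear X -> Q}) (f : {linear X -> Y}) :
  surj_map q -> (forall x, q x = 0 -> f x = 0) ->
  exists g : {linear Q -> Y}, forall x, g (q x) = f x.
Proof.
move=> qs kq; pose r y := projT1 (cid (qs y)).
have rK y : q (r y) = y by exact: projT2 (cid (qs y)).
have fE x y : q x = q y -> f x = f y.
  by move=> qxy; apply/eqP; rewrite -subr_eq0 -linearB kq // linearB qxy subrr.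
have lin : linear (fun y => f (r y)).
  by move=> a x y; rewrite -linearP; apply: fE; rewrite linearP !rK.
by exists (mklin lin) => x; apply: fE; rewrite rK.
Qed.

Lemma factor_inj X Y Z (i : {linear X -> Y}) (f : {linear Z -> Y}) :
  injective i -> (forall z, exists x, i x = f z) ->
  exists g : {linear Z -> X}, forall z, i (g z) = f z.
Proof.
move=> ii im; pose r z := projT1 (cid (im z)).
have rK z : i (r z) = f z by exact: projT2 (cid (im z)).
have lin : linear r by move=> a x y; apply: ii; rewrite linearP !rK linearP.
by exists (mklin lin).
Qed.

Lemma sub_exists X (U : X -> Prop) : submod U ->
  exists (K : lmodType R) (i : {linear K -> X}),
    injective i /\ forall x, U x <-> exists k, i k = x.
Proof.
move=> UP; have [Q [q [qs qU]]] := quotient_exists UP.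
have lin : linear (val : ker q -> X) by [].
exists (ker q : lmodType R), (mklin lin); split=> [|x]; first exact: val_inj.
split=> [/qU/eqP qx|[k <-]]; first by exists (Ker qx).
by apply/qU; apply/eqP; exact: (valP k).
Qed.

(** Corestricted to the kernel of [h], the map [g] becomes surjective, and projectivity applies
    there. *)
Lemma proj_lift P X Y Z (g : {linear X -> Y}) (h : {linear Y -> Z})
    (f : {linear P -> Y}) :
  projective P -> exact_at g h -> (forall x, h (f x) = 0) ->
  exists f' : {linear P -> X}, forall x, g (f' x) = f x.
Proof.
move=> projP gh hf.
have lin : linear (val : ker h -> Y) by [].
have [g1 g1E] : exists g1 : {linear X -> ker h}, forall x, val (g1 x) = g x.
  apply: (@factor_inj _ _ _ (mklin lin) g); first exact: val_inj.
  move=> x; have /eqP hx : h (g x) = 0 by apply/gh; exists x.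
  by exists (Ker hx).
have [f1 f1E] : exists f1 : {linear P -> ker h}, forall x, val (f1 x) = f x.
  apply: (@factor_inj _ _ _ (mklin lin) f); first exact: val_inj.
  by move=> x; have /eqP hx := hf x; exists (Ker hx).
have [|f' f'E] := projP _ _ g1 f1.
  move=> y; have /gh[x xy] : h (val y) = 0 by apply/eqP; exact: (valP y).
  by exists x; apply: val_inj; rewrite g1E.
by exists f' => x; rewrite -g1E f'E.
Qed.

Definition ses X Y Z (i : {linear X -> Y}) (q : {linear Y -> Z}) :=
  [/\ injective i, exact_at i q & surj_map q].

Lemma prod_projective X Y : projective X -> projective Y ->
  projective (X * Y)%type.
Proof.
move=> pX pY A B g f gs.
have l1 : linear (fun x : X => f (x, 0)).
  move=> a x y; rewrite -linearP; congr (f _).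
  by congr pair => /=; rewrite ?scaler0 ?addr0.
have l2 : linear (fun y : Y => f (0, y)).
  move=> a x y; rewrite -linearP; congr (f _).
  by congr pair => /=; rewrite ?scaler0 ?addr0.
have [h1 h1E] := pX _ _ g (mklin l1) gs.
have [h2 h2E] := pY _ _ g (mklin l2) gs.
have lin : linear (fun u : X * Y => h1 u.1 + h2 u.2).
  by move=> a [x y] [x' y'] /=; rewrite !linearP scalerDr addrACA.
exists (mklin lin) => -[x y].
have -> : mklin lin (x, y) = h1 x + h2 y by [].
rewrite linearD h1E h2E -[mklin l1 x]/(f (x, 0)) -[mklin l2 y]/(f (0, y)) -linearD.
by congr (f (_, _)); rewrite /= ?addr0 ?add0r.
Qed.
End Factor.

(** * Comparison of resolutions, and torsion in Ext *)

Section Cochains.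
Variables (R : pzRingType) (X Y : lmodType R) (P : resolution X).

Definition coc n (f : P n -> Y) := forall x, f (res_d P n x) = 0.

(** Stated for bare functions, so that expressions such as [fun x => f x * s] need not be bundled as
    linear maps and can be exchanged for pointwise equal ones ([cob_ext]). *)
Definition cob n : (P n -> Y) -> Prop :=
  match n return (P n -> Y) -> Prop with
  | 0 => fun f => forall x, f x = 0
  | k.+1 => fun f => exists g : {linear P k -> Y}, forall x, f x = g (res_d P k x)
  end.

Lemma cob_ext n (f g : P n -> Y) : f =1 g -> cob f -> cob g.
Proof.
case: n f g => [|n] f g fg /=; first by move=> f0 x; rewrite -fg.
by move=> [h hE]; exists h => x; rewrite -fg.
Qed.

Lemma cobD n (f g : P n -> Y) : cob f -> cob g -> cob (fun x => f x + g x).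
Proof.
case: n f g => [|n] f g /=; first by move=> f0 g0 x; rewrite f0 g0 addr0.
by move=> [h hE] [k kE]; exists (h + k) => x; rewrite hE kE.
Qed.

Lemma res_dd n (x : P n.+2) : res_d P n (res_d P n.+1 x) = 0.
Proof. by apply/res_exact; exists x. Qed.

Lemma res_augd (x : P 1%N) : res_aug P (res_d P 0 x) = 0.
Proof. by apply/res_exact0; exists x. Qed.

End Cochains.

Lemma cob_comp (R : pzRingType) (X Y Z : lmodType R) (P : resolution X)
    (u : {linear Y -> Z}) n (f : P n -> Y) : cob f -> cob (fun x => u (f x)).
Proof.
case: n f => [|n] f /=; first by move=> f0 x; rewrite f0 linear0.
by move=> [h hE]; exists (u \o h : {linear _ -> _}) => x; rewrite hE.
Qed.

Section Scaling.
Variable R : pzRingType.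
Lemma rs_linear (X : lmodType R) (f : {linear X -> R^o}) (s : R) :
  linear (fun x => f x * s : R^o).
Proof. by move=> a x y; rewrite linearP [LHS]mulrDl -[in LHS]mulrA. Qed.
Definition rs (X : lmodType R) (f : {linear X -> R^o}) (s : R) : {linear X -> R^o} :=
  mklin (rs_linear f s).

Lemma cob_rs (X : lmodType R) (P : resolution X) n (f : P n -> R^o) s :
  cob f -> cob (fun x => f x * s : R^o).
Proof.
case: n f => [|n] f /=; first by move=> f0 x; rewrite f0 mul0r.
by move=> [h hE]; exists (rs h s) => x; rewrite hE.
Qed.
End Scaling.

Section Lifts.
Variables (R : pzRingType) (X X' : lmodType R) (P : resolution X) (P' : resolution X').
Variable u : {linear X -> X'}.

Record lift_of := Lift {
  lf :> forall n, {linear P n -> P' n};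
  lf_aug : forall x, res_aug P' (lf 0 x) = u (res_aug P x);
  lf_d : forall n x, res_d P' n (lf n.+1 x) = lf n (res_d P n x)
}.

(** The condition under which [proj_lift] yields the next component; the recursion carries it
    along. *)
Let C n : {linear P n -> P' n} -> Prop :=
  match n return {linear P n -> P' n} -> Prop with
  | 0 => fun f => forall x, res_aug P' (f (res_d P 0 x)) = 0
  | k.+1 => fun f => forall x, res_d P' k (f (res_d P k.+1 x)) = 0
  end.

Let step n (f : {f | C (n := n) f}) :
  {g : {linear P n.+1 -> P' n.+1} | C g /\
     forall x, res_d P' n (g x) = sval f (res_d P n x)}.
Proof.
apply: cid; case: f => f Cf; case: n f Cf => [|n] f Cf.
  have [||g gE] := @proj_lift R _ _ _ _ (res_d P' 0) (res_aug P')
    (f \o res_d P 0 : {linear _ -> _}) (@res_proj _ _ P 1).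
  - exact: res_exact0.
  - exact: Cf.
  by exists g; split=> // x; rewrite /= gE /= res_dd linear0.
have [||g gE] := @proj_lift R _ _ _ _ (res_d P' n.+1) (res_d P' n)
  (f \o res_d P n.+1 : {linear _ -> _}) (@res_proj _ _ P n.+2).
- exact: res_exact.
- exact: Cf.
by exists g; split=> // x; rewrite /= gE /= res_dd linear0.
Qed.

Lemma lift_exists : exists _ : lift_of, True.
Proof.
have [f0 f0E] := @res_proj _ _ P 0 _ _ (res_aug P') (u \o res_aug P : {linear _ -> _})
  (@res_aug_surj _ _ P').
have Cf0 : C f0 by move=> x; rewrite f0E /= res_augd linear0.
pose F n : {f | C (n := n) f} := nat_rect (fun n => {f | C (n := n) f}) (exist _ f0 Cf0)
  (fun n f => exist _ (sval (step f)) (svalP (step f)).1) n.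
unshelve eexists (Lift (lf := fun n => sval (F n)) _ _); first exact: f0E.
  by move=> n x; exact: (svalP (step (F n))).2.
by [].
Qed.

Lemma lift_coc (Y : lmodType R) (phi : lift_of) n (f : {linear P' n -> Y}) :
  coc f -> coc (fun x => f (phi n x)).
Proof. by move=> cf x; rewrite -lf_d cf. Qed.

Lemma lift_cob (Y : lmodType R) (phi : lift_of) n (f : P' n -> Y) :
  cob f -> cob (fun x => f (phi n x)).
Proof.
case: n f => [|n] f /=; first by move=> f0 x; exact: f0.
move=> [h hE]; exists (h \o phi n : {linear _ -> _}) => x /=.
by rewrite hE lf_d.
Qed.

Lemma lift_unique (Y : lmodType R) (phi psi : lift_of) n (f : {linear P' n -> Y}) :
  coc f -> cob (fun x => f (phi n x) - f (psi n x)).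
Proof.
case: n f => [|n] f cf /=.
  move=> x; rewrite -linearB.
  have /res_exact0[y <-] : res_aug P' (phi 0%N x - psi 0%N x) = 0.
    by rewrite linearB !lf_aug subrr.
  exact: cf.
pose de k : {linear P k -> P' k} := phi k \- psi k.
have deE k x : de k x = phi k x - psi k x by [].
have ded k x : res_d P' k (de k.+1 x) = de k (res_d P k x).
  by rewrite !deE linearB !lf_d.
(* Half of a chain homotopy suffices: [de - h d] takes values in cycles, hence in boundaries, where
   the cocycle [f] vanishes. *)
have : exists h : {linear P n -> P' n.+1}, forall x,
    res_d P' n (de n.+1 x - h (res_d P n x)) = 0.
  elim: n {f cf} => [|n [h hE]].
    have [||h hE] := @proj_lift R (P 0) (P' 1%N) (P' 0) X' (res_d P' 0)
      (res_aug P') (de 0%N) (@res_proj _ _ P 0).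
    - exact: res_exact0.
    - by move=> x; rewrite deE linearB !lf_aug subrr.
    by exists h => x; rewrite linearB ded hE subrr.
  have [||k kE] := @proj_lift R (P n.+1) (P' n.+2) (P' n.+1) (P' n) (res_d P' n.+1)
      (res_d P' n) (de n.+1 \- (h \o res_d P n)) (@res_proj _ _ P n.+1).
  - exact: res_exact.
  - by move=> x; rewrite /= hE.
  by exists k => x; rewrite linearB ded kE /= res_dd linear0 subr0 subrr.
move=> [h hE]; exists (f \o h : {linear _ -> _}) => x.
apply/eqP; rewrite -subr_eq0 -linearB -linearB.
have /res_exact[y <-] := hE x.
by rewrite cf.
Qed.
End Lifts.

Section LiftOps.
Variable R : pzRingType.
Lemma lift_id (X : lmodType R) (P : resolution X) :
  exists phi : lift_of P P (idfun : {linear X -> X}), forall n x, phi n x = x.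
Proof.
by unshelve eexists (@Lift _ _ _ _ _ _ (fun n => (idfun : {linear P n -> P n})) _ _).
Qed.

Lemma lift_comp (X Y Z : lmodType R) (P : resolution X) (Q : resolution Y)
    (T : resolution Z) (u : {linear X -> Y}) (v : {linear Y -> Z})
    (w : {linear X -> Z}) (phi : lift_of P Q u)
    (psi : lift_of Q T v) : (forall x, w x = v (u x)) ->
  exists xi : lift_of P T w, forall n x, xi n x = psi n (phi n x).
Proof.
move=> wE.
unshelve eexists (@Lift _ _ _ _ _ _ (fun n => (psi n \o phi n : {linear P n -> T n})) _ _).
- by move=> x /=; rewrite !lf_aug wE.
- by move=> n x /=; rewrite !lf_d.
by [].
Qed.
End LiftOps.

Section ExtNull.
Variable R : pzRingType.
Implicit Types (S : R -> Prop) (X : lmodType R).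

Definition mulcl S := S 1 /\ forall s t, S s -> S t -> S (s * t).

(* Ext^n(X, R), computed with P, is S-torsion *)
Definition nullP S X (P : resolution X) n := forall f : {linear P n -> R^o},
  coc f -> exists2 s, S s & cob (fun x => f x * s : R^o).

Definition ext_null S n X := forall P : resolution X, nullP S P n.
(** Taking S = {1} makes vanishing a case of torsion, so that one long exact sequence serves
    both. *)
Definition ext0 n X := ext_null (fun s => s = 1) n X.

Lemma nullP_indep S X n (P P' : resolution X) : nullP S P' n -> nullP S P n.
Proof.
move=> nP f cf.
have [phi _] := lift_exists P P' (idfun : {linear X -> X}).
have [psi _] := lift_exists P' P (idfun : {linear X -> X}).
have [xi xiE] := lift_comp phi psi (w := (idfun : {linear X -> X})) (fun=> erefl).
have [iota iotaE] := lift_id P.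
have [s Ss cs] := nP (f \o psi n : {linear _ -> _}) (lift_coc psi cf).
exists s => //.
have c1 := lift_cob phi cs.
have c2 := cob_rs s (lift_unique iota xi cf).
apply: cob_ext (cobD c1 c2) => x /=.
by rewrite iotaE xiE -mulrDl addrC subrK.
Qed.

Lemma ext_nullI S X n (P : resolution X) : nullP S P n -> ext_null S n X.
Proof. by move=> nP P'; exact: nullP_indep nP. Qed.

Lemma ext0P X n (P : resolution X) : ext0 n X <->
  forall f : {linear P n -> R^o}, coc f -> cob f.
Proof.
split=> [e f cf|e].
  have [s -> c1] := e P f cf.
  by apply: cob_ext c1 => x; rewrite mulr1.
apply: (@ext_nullI _ _ _ P) => f cf; exists 1 => //.
by apply: cob_ext (e f cf) => x; rewrite mulr1.
Qed.

Lemma ext0_null S n X : mulcl S -> ext0 n X -> ext_null S n X.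
Proof. by move=> [S1 _] e P f cf; have [s -> c] := e P f cf; exists 1. Qed.

Lemma mulcl1 : mulcl (fun s => s = 1).
Proof. by split=> // s t -> ->; rewrite mulr1. Qed.

Lemma Ext_trivialP n X (P : resolution X) : is_trivial (Ext n X R^o) <-> ext0 n X.
Proof.
rewrite (ext0P n (std_resolution X)).
have cobE (f : {linear std_resolution X n -> R^o}) : coboundary_set f <-> cob f.
  case: n f => [|n] f //=; split=> [->//|f0]; exact: linear_ext.
split=> [tr f cf|e x].
  have cf' : cocycle R^o (std_resolution X) n f by [].
  have := tr (sq_class (cocycle R^o (std_resolution X) n)
     (coboundary R^o (std_resolution X) n) f).
  rewrite -[RHS](sq_class0 (cocycle R^o (std_resolution X) n)
     (coboundary R^o (std_resolution X) n)) => /(sq_class_eqP cf' (sg0 _)).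
  by rewrite subr0 => /cobE.
rewrite -[x]sq_repK -[RHS](sq_class0 (cocycle R^o (std_resolution X) n)
     (coboundary R^o (std_resolution X) n)).
apply: sq_class_eq; [exact: sq_repP|exact: sg0|rewrite subr0].
by apply/cobE/e; exact: (sq_repP x).
Qed.
End ExtNull.

(** * Long exact sequences *)

Section Cone.
Variables (R : pzRingType) (X' X X'' : lmodType R).
Variables (i : {linear X' -> X}) (q : {linear X -> X''}).
Hypothesis iq : ses i q.
Variables (P' : resolution X') (P : resolution X) (phi : lift_of P' P i).

(* The mapping cone of phi resolves X''. *)
Definition cone_mod (n : nat) : lmodType R :=
  if n is m.+1 then (P m.+1 * P' m)%type else P 0.

Lemma cone_d0_linear : linear (fun u : P 1%N * P' 0%N => res_d P 0 u.1 + phi 0%N u.2).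
Proof. by move=> a [x y] [x' y'] /=; rewrite !linearP scalerDr addrACA. Qed.

Lemma cone_dS_linear n : linear (fun u : P n.+2 * P' n.+1 =>
  (res_d P n.+1 u.1 + phi n.+1 u.2, - res_d P' n u.2) : P n.+1 * P' n).
Proof.
move=> a [x y] [x' y'] /=; congr pair => /=; first by rewrite !linearP scalerDr addrACA.
by rewrite linearP opprD scalerN.
Qed.

Definition cone_d n : {linear cone_mod n.+1 -> cone_mod n} :=
  match n return {linear cone_mod n.+1 -> cone_mod n} with
  | 0 => mklin cone_d0_linear
  | k.+1 => mklin (@cone_dS_linear k)
  end.

Lemma cone_proj n : projective (cone_mod n).
Proof.
case: n => [|n]; first exact: (@res_proj _ _ P).
by apply: prod_projective; exact: res_proj.
Qed.

Let ii : injective i. Proof. by case: iq. Qed.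
Let exq : exact_at i q. Proof. by case: iq. Qed.
Let qs : surj_map q. Proof. by case: iq. Qed.

Definition cone_aug : {linear cone_mod 0 -> X''} := q \o res_aug P.

Lemma cone_aug_surj : surj_map cone_aug.
Proof.
move=> z; have [y <-] := qs z; have [x <-] := res_aug_surj P y.
by exists x.
Qed.

Lemma cone_exact0 : exact_at (cone_d 0) cone_aug.
Proof.
move=> y; split=> [|[[x x'] <-]]; last first.
  rewrite -[LHS]/(q (res_aug P (res_d P 0 x + phi 0%N x'))) linearD res_augd add0r.
  by rewrite lf_aug; apply/exq; eexists.
move=> /exq[x' ix']; have [w wx'] := res_aug_surj P' x'.
have /res_exact0[z zE] : res_aug P (y - phi 0%N w) = 0.
  by rewrite linearB lf_aug wx' ix' subrr.
by exists (z, w); rewrite -[cone_d 0 _]/(res_d P 0 z + phi 0%N w) zE subrK.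
Qed.

Lemma cone_exact n : exact_at (cone_d n.+1) (cone_d n).
Proof.
case: n => [|n] [z w]; split.
- rewrite -[cone_d 0 _]/(res_d P 0 z + phi 0%N w) => h.
  have /res_exact0[v vE] : res_aug P' w = 0.
    apply: ii; rewrite -(lf_aug phi) linear0.
    by have := congr1 (res_aug P) h; rewrite linearD res_augd add0r linear0.
  have /res_exact[u uE] : res_d P 0 (z + phi 1%N v) = 0.
    by rewrite linearD lf_d vE.
  (* The sign of v undoes the sign in the second component of the cone differential. *)
  exists (u, - v).
  rewrite -[LHS]/(res_d P 1 u + phi 1%N (- v), - res_d P' 0 (- v)).
  by rewrite uE !linearN vE opprK addrK.
- move=> [[u v] <-].
  rewrite -[LHS]/(res_d P 0 (res_d P 1 u + phi 1%N v) + phi 0%N (- res_d P' 0 v)).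
  by rewrite linearD res_dd add0r lf_d linearN subrr.
- rewrite -[cone_d _ _]/(res_d P n.+1 z + phi n.+1 w, - res_d P' n w) => -[h1 h2].
  have /res_exact[v vE] : res_d P' n w = 0 by rewrite -[LHS]opprK h2 oppr0.
  have /res_exact[u uE] : res_d P n.+1 (z + phi n.+2 v) = 0.
    by rewrite linearD lf_d vE.
  exists (u, - v).
  rewrite -[LHS]/(res_d P n.+2 u + phi n.+2 (- v), - res_d P' n.+1 (- v)).
  by rewrite uE !linearN vE opprK addrK.
- move=> [[u v] <-].
  rewrite -[LHS]/(res_d P n.+1 (res_d P n.+2 u + phi n.+2 v) +
     phi n.+1 (- res_d P' n.+1 v), - res_d P' n (- res_d P' n.+1 v)).
  by rewrite linearD res_dd add0r lf_d (linearN (phi _)) (linearN (res_d _ _)) res_dd subrr !oppr0.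
Qed.

Definition cone : resolution X'' :=
  Resolution (res_d := cone_d) (res_aug := cone_aug)
    cone_proj cone_aug_surj cone_exact0 cone_exact.

End Cone.

Section LES.
Variables (R : pzRingType) (X' X X'' : lmodType R).
Variables (i : {linear X' -> X}) (q : {linear X -> X''}).
Hypothesis iq : ses i q.
Variable S : R -> Prop.
Hypothesis Sm : mulcl S.

Let SM s t : S s -> S t -> S (s * t). Proof. exact: Sm.2. Qed.

Section PairLinear.
Variables (A B : lmodType R) (Y : lmodType R) (f : {linear A -> Y}) (g : {linear B -> Y}).
Lemma pair_linear : linear (fun u : A * B => f u.1 + g u.2).
Proof. by move=> a [x y] [x' y'] /=; rewrite !linearP scalerDr addrACA. Qed.
Lemma inl_linear : linear (fun a : A => (a, 0) : A * B).
Proof. by move=> a x y; congr pair => /=; rewrite ?scaler0 ?addr0. Qed.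
Lemma inr_linear : linear (fun b : B => (0, b) : A * B).
Proof. by move=> a x y; congr pair => /=; rewrite ?scaler0 ?addr0. Qed.
End PairLinear.

(* exactness at Ext^n(X): a class killed by restriction to X' comes from X'' *)
Lemma les_mid_elt n (P' : resolution X') (P : resolution X) (phi : lift_of P' P i)
    (z : {linear P n -> R^o}) :
  ext_null S n X'' -> coc z -> cob (fun x => z (phi n x)) ->
  exists2 s, S s & cob (fun x => z x * s : R^o).
Proof.
move=> e cz cb; have := e (cone iq phi) ; case: n z cz cb {e} => [|n] z cz cb e.
  have [|s Ss /= s0] := e z.
    move=> [x x']; rewrite -[res_d _ _ _]/(res_d P 0 x + phi 0%N x') linearD cz add0r.
    exact: cb.
  by exists s.
case: cb => w wE.
(* As [w] bounds the restriction of [z], the pair (z, w) is a cocycle on the cone; a primitive of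
   (z, w) s restricts to P as a primitive of z s. *)
have [|s Ss [g gE]] := e (mklin (pair_linear z w)).
  case: n z cz w wE {e} => [|n] z cz w wE [x x'].
    rewrite -[LHS]/(z (res_d P 1 x + phi 1%N x') + w (- res_d P' 0 x')).
    by rewrite linearD cz add0r (linearN w) wE subrr.
  rewrite -[LHS]/(z (res_d P n.+2 x + phi n.+2 x') + w (- res_d P' n.+1 x')).
  by rewrite linearD cz add0r (linearN w) wE subrr.
exists s => //; case: n z cz w wE e g gE => [|n] z cz w wE e g gE /=.
  exists g => x; have := gE (x, 0).
  rewrite -[mklin _ _]/(z x + w 0) linear0 addr0 => ->.
  by rewrite -[res_d _ _ _]/(res_d P 0 x + phi 0%N 0) linear0 addr0.
exists (g \o mklin (@inl_linear (P n.+1) (P' n)) : {linear _ -> _}) => x.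
have := gE (x, 0).
rewrite -[mklin _ _]/(z x + w 0) linear0 addr0 => ->.
rewrite -[res_d _ _ _]/(res_d P n.+1 x + phi n.+1 0, - res_d P' n 0).
by rewrite !linear0 addr0 ?oppr0.
Qed.

Lemma les_mid n : ext_null S n X' -> ext_null S n X'' -> ext_null S n X.
Proof.
move=> e' e'' P z cz.
pose P' := std_resolution X'.
have [phi _] := lift_exists P' P i.
have [s Ss cs] := e' P' (z \o phi n : {linear _ -> _}) (lift_coc phi cz).
have [||t St ct] := @les_mid_elt n P' P phi (rs z s) e''.
- by move=> x; rewrite -[LHS]/(z _ * s) cz mul0r.
- exact: cs.
exists (s * t); first exact: SM.
by apply: cob_ext ct => x; rewrite -[rs z s x]/(z x * s) mulrA.
Qed.

Lemma les_right0 : ext_null S 0 X -> ext_null S 0 X''.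
Proof.
move=> e; pose P' := std_resolution X'; pose P := std_resolution X.
have [phi _] := lift_exists P' P i.
apply: (@ext_nullI _ _ _ _ (cone iq phi)) => z cz.
apply: (e P (z : {linear P 0%N -> R^o})) => x.
have := cz (x, 0).
by rewrite -[res_d _ _ _]/(res_d P 0 x + phi 0%N 0) linear0 addr0.
Qed.

(* exactness at Ext^(n+1)(X''), with a hypothesis on the classes of Ext^n(X')
   that also covers those coming from X *)
Lemma les_right_elt n (P' : resolution X') (P : resolution X) (phi : lift_of P' P i) :
  ext_null S n.+1 X ->
  (forall w : {linear P' n -> R^o}, coc w -> exists2 s, S s &
     exists u : {linear P n -> R^o}, coc u /\ cob (fun x => w x * s - u (phi n x) : R^o)) ->
  ext_null S n.+1 X''.
Proof.
move=> e ew; apply: (@ext_nullI _ _ _ _ (cone iq phi)) => f cf.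
pose z := f \o mklin (@inl_linear (P n.+1) (P' n)) : {linear P n.+1 -> R^o}.
pose w := f \o mklin (@inr_linear (P n.+1) (P' n)) : {linear P' n -> R^o}.
have fE x y : f (x, y) = z x + w y.
  by rewrite /= -linearD; congr (f (_, _)); rewrite ?addr0 ?add0r.
have cz : coc z.
  move=> x; rewrite -(cf (x, 0)).
  rewrite -[res_d (cone iq phi) _ _]/(res_d P n.+1 x + phi n.+1 0, - res_d P' n 0).
  by rewrite !linear0 addr0 ?oppr0.
have zw x : z (phi n.+1 x) = w (res_d P' n x).
  have := cf (0, x).
  rewrite -[res_d (cone iq phi) _ _]/(res_d P n.+1 0 + phi n.+1 x, - res_d P' n x).
  by rewrite fE linear0 add0r linearN => /eqP; rewrite subr_eq0 => /eqP.
have [s Ss [y yE]] := e P z cz.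
(* The P-component of f s is bounded by [y]; what [y] leaves over on P' is the cocycle [w1], to
   which [ew] applies. *)
pose w1 : {linear P' n -> R^o} := rs w s \- (y \o phi n).
have w1E x : w1 x = w x * s - y (phi n x) by [].
have cw1 : coc w1.
  by move=> x; rewrite w1E -zw -(lf_d phi) -yE subrr.
have [t St [u [cu cb]]] := ew w1 cw1.
exists (s * t); first exact: SM.
pose g1 : {linear P n -> R^o} := rs y t \+ u.
have g1E x : g1 x = y x * t + u x by [].
case: n f z w e ew cf fE cz zw y yE w1 w1E cw1 u cu cb g1 g1E
  => [|n] f z w e ew cf fE cz zw y yE w1 w1E _ u cu cb g1 g1E.
  exists g1 => -[x x'].
  rewrite -[res_d (cone iq phi) _ _]/(res_d P 0 x + phi 0%N x') fE linearD !g1E.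
  rewrite cu addr0 -yE mulrDl -!mulrA; congr (_ + _); rewrite mulrA.
  by have /eqP := cb x'; rewrite subr_eq0 w1E mulrBl subr_eq addrC => /eqP.
case: cb => v vE.
exists (mklin (pair_linear g1 (- v : {linear _ -> _}))) => -[x x'].
rewrite -[RHS]/(g1 (res_d P n.+1 x + phi n.+1 x') - v (- res_d P' n x')).
rewrite fE linearD !g1E cu addr0 (linearN v) opprK -vE w1E -yE.
have aux (V : zmodType) (a b c : V) : c = a + b + (c - a - b).
  by rewrite addrC -[c - a - b]addrA -opprD subrK.
rewrite mulrDl !mulrA mulrBl -[RHS]addrA; congr (_ + _); exact: aux.
Qed.

Lemma les_right n : ext_null S n.+1 X -> ext_null S n X' -> ext_null S n.+1 X''.
Proof.
move=> e e'; pose P' := std_resolution X'; pose P := std_resolution X.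
have [phi _] := lift_exists P' P i.
apply: (les_right_elt (phi := phi) e) => w cw.
have [s Ss cb] := e' P' w cw; exists s => //; exists 0; split=> //.
by apply: cob_ext cb => x; rewrite subr0.
Qed.

(* exactness at Ext^n(X') *)
Lemma les_left_elt n (P' : resolution X') (P : resolution X) (phi : lift_of P' P i)
    (w : {linear P' n -> R^o}) :
  ext_null S n.+1 X'' -> coc w -> exists2 s, S s &
     exists u : {linear P n -> R^o}, coc u /\ cob (fun x => w x * s - u (phi n x) : R^o).
Proof.
move=> e cw; have := e (cone iq phi).
(* Up to sign, (0, w) represents the image of w under the connecting map into Ext^(n+1)(X''). *)
move=> /(_ (mklin (pair_linear (0 : {linear P n.+1 -> R^o}) w))).
case=> [|s Ss [g gE]].
  move=> [x x']; rewrite -[LHS]/(0 + w (- res_d P' n x')).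
  by rewrite linearN cw subrr.
exists s => //.
case: n w cw {e} g gE => [|n] w cw g gE.
  exists g; split.
    move=> x; have := gE (x, 0).
    rewrite -[res_d (cone iq phi) _ _]/(res_d P 0 x + phi 0%N 0).
    by rewrite -[mklin _ _]/(0 + w 0) !linear0 !addr0 mul0r => <-.
  move=> x /=; have := gE (0, x).
  rewrite -[res_d (cone iq phi) _ _]/(res_d P 0 0 + phi 0%N x).
  by rewrite -[mklin _ _]/(0 + w x) linear0 !add0r => ->; rewrite subrr.
pose u := g \o mklin (@inl_linear (P n.+1) (P' n)) : {linear P n.+1 -> R^o}.
pose v := g \o mklin (@inr_linear (P n.+1) (P' n)) : {linear P' n -> R^o}.
have gE' x y : g (x, y) = u x + v y.
  by rewrite /= -linearD; congr (g (_, _)); rewrite ?addr0 ?add0r.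
exists u; split.
  move=> x; have := gE (x, 0).
  rewrite -[res_d (cone iq phi) _ _]/(res_d P n.+1 x + phi n.+1 0, - res_d P' n 0).
  by rewrite -[mklin _ _]/(0 + w 0) gE' !linear0 ?oppr0 ?linear0 !addr0 mul0r => <-.
exists (- v : {linear _ -> _}) => x; have := gE (0, x).
rewrite -[res_d (cone iq phi) _ _]/(res_d P n.+1 0 + phi n.+1 x, - res_d P' n x).
rewrite -[mklin _ _]/(0 + w x) gE' linear0 !add0r => ->.
by rewrite addrC addKr linearN.
Qed.

Lemma les_left n : ext_null S n X -> ext_null S n.+1 X'' -> ext_null S n X'.
Proof.
move=> e e'' P' w cw; pose P := std_resolution X.
have [phi _] := lift_exists P' P i.
have [s Ss [u [cu cb]]] := les_left_elt phi e'' cw.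
have [t St ct] := e P u cu.
exists (s * t); first exact: SM.
have := cobD (cob_rs t cb) (lift_cob phi ct); apply: cob_ext => x.
by rewrite /= -mulrDl subrK mulrA.
Qed.

(** Degree 0 of [les_left_elt]: a 0-cocycle is a functional on the resolved module. *)
Lemma ext1_extend (f : {linear X' -> R^o}) : ext_null S 1 X'' ->
  exists2 s, S s & exists F : {linear X -> R^o}, forall x, F (i x) = f x * s.
Proof.
move=> e; pose P' := std_resolution X'; pose P := std_resolution X.
have [phi _] := lift_exists P' P i.
have [|s Ss [u [cu /= cb]]] := @les_left_elt 0 P' P phi (f \o res_aug P' : {linear _ -> _}) e.
  by move=> x; rewrite -[LHS]/(f (res_aug P' (res_d P' 0 x))) res_augd linear0.
exists s => //.
have [|F FE] := @factor_surj R _ _ _ (res_aug P) u (res_aug_surj P).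
  by move=> x /res_exact0[y <-]; exact: cu.
exists F => x; have [y <-] := res_aug_surj P' x.
rewrite -(lf_aug phi) FE; apply/eqP; rewrite eq_sym -subr_eq0; apply/eqP; exact: cb.
Qed.

(** Extendability up to S makes the image of the connecting map from Hom(X', R) to Ext^1(X'', R)
    S-torsion. *)
Lemma extend_ext1 : ext_null S 1 X -> (forall f : {linear X' -> R^o},
  exists2 s, S s & exists F : {linear X -> R^o}, forall x, F (i x) = f x * s) ->
  ext_null S 1 X''.
Proof.
move=> e ex; pose P' := std_resolution X'; pose P := std_resolution X.
have [phi _] := lift_exists P' P i.
apply: (les_right_elt (phi := phi) e) => w cw.
have [|f fE] := @factor_surj R _ _ _ (res_aug P') w (res_aug_surj P').
  by move=> x /res_exact0[y <-]; exact: cw.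
have [s Ss [F FE]] := ex f; exists s => //.
exists (F \o res_aug P : {linear _ -> _}); split=> x.
  by rewrite -[LHS]/(F (res_aug P (res_d P 0 x))) res_augd linear0.
apply/eqP; rewrite subr_eq0 -fE -FE -(lf_aug phi); exact/eqP.
Qed.

End LES.

(** * Finite generation *)

Section RowSpaces.
Variable R : pzRingType.
Implicit Types X Y : lmodType R.

Lemma rvlin_linear X n (v : 'I_n -> X) :
  linear (fun x : 'rV[R]_n => \sum_k x 0 k *: v k).
Proof.
move=> a x y; rewrite scaler_sumr -big_split; apply: eq_bigr => k _.
by rewrite !mxE scalerDl scalerA.
Qed.
Definition rvlin X n (v : 'I_n -> X) : {linear 'rV[R]_n -> X} := mklin (rvlin_linear v).

Lemma rvlinE X n (v : 'I_n -> X) x : rvlin v x = \sum_k x 0 k *: v k.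
Proof. by []. Qed.

Lemma rvlin_delta X n (v : 'I_n -> X) k : rvlin v (delta_mx 0 k) = v k.
Proof.
rewrite rvlinE (bigD1 k) //= !mxE !eqxx scale1r big1 ?addr0 // => j jk.
by rewrite mxE (negPf jk) andbF scale0r.
Qed.

Lemma rv_expand X n (f : {linear 'rV[R]_n -> X}) x :
  f x = \sum_k x 0 k *: f (delta_mx 0 k).
Proof.
by rewrite {1}[x]row_sum_delta linear_sum; apply: eq_bigr => k _; rewrite linearZ.
Qed.

Lemma rV_projective n : projective ('rV[R]_n : lmodType R).
Proof.
move=> A B g f gs; pose v k := projT1 (cid (gs (f (delta_mx 0 k)))).
have vE k : g (v k) = f (delta_mx 0 k) by exact: projT2 (cid (gs _)).
exists (rvlin v) => x; rewrite rvlinE linear_sum [RHS]rv_expand.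
by apply: eq_bigr => k _; rewrite linearZ -vE.
Qed.

Lemma fin_genP X : fin_gen X <-> exists n (q : {linear 'rV[R]_n -> X}), surj_map q.
Proof.
split=> [[n [g gP]]|[n [q qs]]].
  exists n, (rvlin g) => x; have [c ->] := gP x.
  by exists (\row_k c k); rewrite rvlinE; apply: eq_bigr => k _; rewrite mxE.
exists n, (fun k => q (delta_mx 0 k)) => x; have [c <-] := qs x.
by exists (fun k => c 0 k); exact: rv_expand.
Qed.

Definition proj_res_mod X (n : nat) : lmodType R := if n is 0 then X else 'rV[R]_0.

Lemma rV0_eq0 (x : 'rV[R]_0) : x = 0. Proof. by apply/rowP => -[]. Qed.

Lemma projective_resolution X : projective X ->
  exists P : resolution X, forall n (x : P n.+1), x = 0.
Proof.
move=> pX.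
unshelve eexists (@Resolution R X (proj_res_mod X) (fun n => 0)
  (idfun : {linear X -> X}) _ _ _ _).
- by case=> [|n] //=; exact: rV_projective.
- by move=> x; exists x.
- move=> x; split=> [/= ->|[z <-]] //; by exists 0.
- move=> n x; split=> [_|[z <-]] //; exists 0; rewrite linear0.
  by apply/esym/rV0_eq0.
by move=> n x; exact: rV0_eq0.
Qed.

Lemma ext0_projective X n : projective X -> ext0 n.+1 X.
Proof.
move=> /projective_resolution[P P0]; apply/(ext0P n.+1 P) => f _ /=.
by exists 0 => x; rewrite (P0 n x) linear0.
Qed.

Definition noeth_mod X := forall U : X -> Prop, submod U ->
  exists (n : nat) (g : 'I_n -> X), forall x, U x <-> exists c : 'I_n -> R,
    x = \sum_i c i *: g i.

(** Devissage: induction on the number of generators, splitting off the cyclic submodule spanned by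
    the first one. *)
Lemma fg_ind (T : lmodType R -> Prop) :
  (forall (B : lmodType R) (q : {linear R^o -> B}), surj_map q -> T B) ->
  (forall (X' X X'' : lmodType R) (i : {linear X' -> X}) (q : {linear X -> X''}),
     ses i q -> T X' -> T X'' -> T X) ->
  forall X, fin_gen X -> T X.
Proof.
move=> Tc Te X [n [g gP]]; elim: n X g gP => [|n IHn] X g gP.
  apply: (Tc _ 0) => x; exists 0; have [c ->] := gP x.
  by rewrite big_ord0.
have lr : linear (fun a : R^o => (a : R) *: g ord0 : X) by move=> a x y; rewrite scalerDl scalerA.
pose r := mklin lr.
have UP : submod (fun x => exists a, x = r a).
  split; first by exists 0; rewrite linear0.
  by move=> a x y [b ->] [c ->]; exists (a *: (b : R^o) + c); rewrite linearP.
have [X'' [q [qs qU]]] := quotient_exists UP.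
have kP : submod (fun a => r a = 0).
  by split=> [|a x y rx ry]; rewrite ?linear0 // linearP rx ry scaler0 addr0.
(* B is R modulo the annihilator of the first generator, which presents the cyclic submodule as a
   quotient of R. *)
have [B [qB [qBs qBk]]] := quotient_exists kP.
have [|i iE] := @factor_surj _ _ _ _ qB r qBs; first by move=> x /qBk.
apply: (Te _ _ _ i q).
- split=> // [x y|y].
    have [a <-] := qBs x; have [b <-] := qBs y; rewrite !iE => rab.
    apply/eqP; rewrite -subr_eq0 -linearB; apply/eqP/qBk.
    by rewrite linearB rab subrr.
  split=> [/qU[a ->]|[x <-]]; first by exists (qB a); rewrite iE.
  by have [a <-] := qBs x; rewrite iE; apply/qU; exists a.
- exact: Tc qBs.
apply: (IHn _ (fun k => q (g (lift ord0 k)))) => y.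
have [x <-] := qs y; have [c ->] := gP x; exists (fun k => c (lift ord0 k)).
rewrite linear_sum_eq big_ord_recl (qU _).2 ?scaler0 ?add0r //.
by exists 1; rewrite -[r 1]/(1 *: g ord0) scale1r.
Qed.

Lemma noeth_quot X Y (q : {linear X -> Y}) : surj_map q -> noeth_mod X -> noeth_mod Y.
Proof.
move=> qs nX U [U0 UP].
have VP : submod (fun x => U (q x)).
  by split=> [|a x y Ux Uy]; rewrite ?linear0 ?linearP //; exact: UP.
have [n [g gP]] := nX _ VP; exists n, (fun k => q (g k)) => y; split.
  have [x <-] := qs y => /gP[c ->]; exists c; exact: linear_sum_eq.
move=> [c ->]; rewrite -linear_sum_eq; apply/gP; by exists c.
Qed.

Lemma gen_in X (U : X -> Prop) n (g : 'I_n -> X) (Ug : forall x, U x <->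
  exists c : 'I_n -> R, x = \sum_i c i *: g i) k : U (g k).
Proof.
apply/Ug; exists (fun j => (j == k)%:R); rewrite (bigD1 k) //= eqxx scale1r.
by rewrite big1 ?addr0 // => j /negPf->; rewrite scale0r.
Qed.

(** U is generated by generators of its intersection with X' together with lifts to U of generators
    of its image in X''. *)
Lemma noeth_ses X' X X'' (i : {linear X' -> X}) (q : {linear X -> X''}) :
  ses i q -> noeth_mod X' -> noeth_mod X'' -> noeth_mod X.
Proof.
move=> [ii ex qs] n' n'' U UP.
have V'P : submod (fun x => U (i x)).
  by split=> [|a x y Ux Uy]; rewrite ?linear0 ?linearP; [exact: UP.1|exact: UP.2].
have V''P : submod (fun y => exists2 x, U x & q x = y).
  split=> [|a x y [u Uu <-] [v Uv <-]].
    by exists 0; rewrite ?linear0 //; exact: UP.1.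
  by exists (a *: u + v); rewrite ?linearP //; exact: UP.2.
have [m [g gP]] := n' _ V'P; have [n [h hP]] := n'' _ V''P.
have hU k : exists2 x, U x & q x = h k by exact: (gen_in hP).
pose h' k := projT1 (cid2 (hU k)).
have h'U k : U (h' k) by rewrite /h'; case: (cid2 _).
have h'E k : q (h' k) = h k by rewrite /h'; case: (cid2 _).
exists (m + n)%N, (fun k : 'I_(m + n) => match fintype.split k with inl a => i (g a) | inr b => h' b end) => x.
have sumE (c : 'I_(m + n) -> R) : \sum_k c k *: match fintype.split k with inl a => i (g a)
    | inr b => h' b end = i (\sum_k c (lshift n k) *: g k) + \sum_k c (rshift m k) *: h' k.
  rewrite big_split_ord linear_sum_eq; congr (_ + _); apply: eq_bigr => k _.
    by rewrite -[lshift n k]/(unsplit (inl k)) unsplitK.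
  by rewrite -[rshift m k]/(unsplit (inr k)) unsplitK.
have sumU (c : 'I_n -> R) : U (\sum_k c k *: h' k).
  by apply: (submod_sum UP) => k _; exact: (submodZ UP).
split=> [Ux|[c ->]]; last first.
  rewrite sumE; apply: (submodD UP) => //.
  by apply/gP; exists (fun k => c (lshift n k)).
have [d dE] : exists c, q x = \sum_k c k *: h k by apply/hP; exists x.
have /ex[y yE] : q (x - \sum_k d k *: h' k) = 0.
  by rewrite linearB linear_sum_eq dE; under [X in _ - X]eq_bigr do rewrite h'E; rewrite subrr.
have [c cE] : exists c, y = \sum_k c k *: g k.
  by apply/gP; rewrite yE; apply: (submodB UP).
exists (fun k : 'I_(m + n) => match fintype.split k with inl a => c a | inr b => d b end).
rewrite sumE.
under [X in i X]eq_bigr do rewrite -[lshift _ _]/(unsplit (inl _)) unsplitK.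
under [X in _ + X]eq_bigr do rewrite -[rshift _ _]/(unsplit (inr _)) unsplitK.
by rewrite -cE yE subrK.
Qed.

Lemma noeth_fin_gen X : noetherian R -> fin_gen X -> noeth_mod X.
Proof.
move=> nR; apply: (fg_ind (T := noeth_mod)); last exact: noeth_ses.
move=> B q qs; apply: (noeth_quot qs) => U [U0 UP].
by have [n [g gP]] := nR U U0 UP; exists n, g.
Qed.

Lemma rV_fin_gen n : fin_gen ('rV[R]_n).
Proof. by apply/fin_genP; exists n, idfun => x; exists x. Qed.

Lemma sub_fin_gen X (K : lmodType R) (i : {linear K -> X}) : noetherian R -> fin_gen X ->
  injective i -> fin_gen K.
Proof.
move=> nR fX ii.
have UP : submod (fun x => exists k, i k = x).
  split=> [|a x y [u <-] [v <-]]; first by exists 0; rewrite linear0.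
  by exists (a *: u + v); rewrite linearP.
have [n [g gP]] := noeth_fin_gen nR fX UP.
have gk k : exists x, i x = g k by exact: (gen_in gP).
pose h k := projT1 (cid (gk k)).
have hE k : i (h k) = g k by exact: projT2 (cid (gk k)).
exists n, h => x.
have [c cE] : exists c, i x = \sum_k c k *: g k by apply/gP; exists x.
exists c; apply: ii; rewrite cE linear_sum_eq.
by under [RHS]eq_bigr do rewrite hE.
Qed.

Lemma chain_stable X (U : nat -> X -> Prop) : noeth_mod X ->
  (forall n, submod (U n)) -> (forall n x, U n x -> U n.+1 x) ->
  exists N, forall n x, U n x -> U N x.
Proof.
move=> nX UP Ui.
have Um m n x : (m <= n)%N -> U m x -> U n x.
  by move=> /subnKC <-; elim: (n - m)%N => [|k IH] Ux; rewrite ?addn0 // addnS; auto.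
have VP : submod (fun x => exists n, U n x).
  split=> [|a x y [m Um'] [n Un']]; first by exists 0%N; exact: (UP _).1.
  exists (maxn m n); apply: (UP _).2; [apply: Um Um'|apply: Um Un'].
    exact: leq_maxl.
  exact: leq_maxr.
have [n [g gP]] := nX _ VP.
have gN k : exists N, U N (g k) by exact: (gen_in gP).
pose N k := projT1 (cid (gN k)).
have NE k : U (N k) (g k) by exact: projT2 (cid (gN k)).
exists (\max_k N k) => m x Ux.
have /gP[c ->] : exists m, U m x by exists m.
apply: (submod_sum (UP _)) => k _; apply: (submodZ (UP _)).
by apply: Um (NE k); exact: leq_bigmax.
Qed.

End RowSpaces.

(** * Finite Gorenstein dimension *)

Section ShortExact.
Variable R : pzRingType.
Implicit Types X Y Z G H N W : lmodType R.

Lemma coker_exists X Y (i : {linear X -> Y}) : injective i ->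
  exists (Z : lmodType R) (q : {linear Y -> Z}), ses i q.
Proof.
move=> ii.
have UP : submod (fun y => exists x, i x = y).
  split=> [|a x y [u <-] [v <-]]; first by exists 0; rewrite linear0.
  by exists (a *: u + v); rewrite linearP.
by have [Z [q [qs qU]]] := quotient_exists UP; exists Z, q.
Qed.

Lemma kernel_exists Y Z (q : {linear Y -> Z}) : surj_map q ->
  exists (X : lmodType R) (i : {linear X -> Y}), ses i q.
Proof.
move=> qs.
have UP : submod (fun y => q y = 0).
  by split=> [|a x y qx qy]; rewrite ?linear0 // linearP qx qy scaler0 addr0.
by have [X [i [ii iU]]] := sub_exists UP; exists X, i.
Qed.

Lemma ses0 X Y Z (i : {linear X -> Y}) (q : {linear Y -> Z}) : ses i q ->
  forall x, q (i x) = 0.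
Proof. by move=> [_ ex _] x; apply/ex; exists x. Qed.

(** Third isomorphism theorem for X in Y in Z, with W = Z / X. *)
Lemma ses_comp X Y Z Y' Z' (i : {linear X -> Y}) (j : {linear Y -> Z})
    (p : {linear Y -> Y'}) (q : {linear Z -> Z'}) :
  ses i p -> ses j q -> exists (W : lmodType R) (r : {linear Z -> W})
    (a : {linear Y' -> W}) (b : {linear W -> Z'}),
    ses (j \o i : {linear X -> Z}) r /\ ses a b.
Proof.
move=> s1 s2; have [[ii ei ps] [ij ej qs]] := (s1, s2).
have [|W [r sr]] := @coker_exists _ _ (j \o i : {linear X -> Z}).
  exact: inj_comp.
have [_ er rs] := sr.
have [|a aE] := @factor_surj _ _ _ _ p (r \o j : {linear Y -> W}) ps.
  by move=> y /ei[x <-]; exact: (ses0 sr).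
have [|b bE] := @factor_surj _ _ _ _ r q rs.
  by move=> z /er[x <-]; exact: (ses0 s2).
exists W, r, a, b; split=> //; split=> [y1 y2|w|z].
- have [u <-] := ps y1; have [v <-] := ps y2.
  rewrite !aE /= => /eqP; rewrite -subr_eq0 -!linearB => /eqP/er[x /ij xuv].
  by apply/eqP; rewrite -subr_eq0 -linearB -xuv; apply/eqP/(ses0 s1).
- split=> [|[y' <-]].
    have [z <-] := rs w; rewrite bE => /ej[y <-].
    by exists (p y); rewrite aE.
  by have [y <-] := ps y'; rewrite aE bE; exact: (ses0 s2).
- by have [y <-] := qs z; exists (r y).
Qed.

Lemma row_mx_linear X m n (f : {linear X -> 'rV[R]_m}) (g : {linear X -> 'rV[R]_n}) :
  linear (fun x => row_mx (f x) (g x)).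
Proof. by move=> a x y; rewrite !linearP scale_row_mx add_row_mx. Qed.

Lemma ext0_extend X Y Z (i : {linear X -> Y}) (q : {linear Y -> Z}) :
  ses i q -> ext0 1 Z -> forall n (f : {linear X -> 'rV[R]_n}),
  exists F : {linear Y -> 'rV[R]_n}, forall x, F (i x) = f x.
Proof.
move=> iq eZ n f.
have lk k : linear (fun x => f x 0 k : R^o) by move=> a x y; rewrite linearP !mxE.
have Fk k : exists F : {linear Y -> R^o}, forall x, F (i x) = f x 0 k.
  have [s -> [F FE]] := ext1_extend iq (mklin (lk k)) eZ.
  by exists F => x; rewrite FE mulr1.
pose F k := projT1 (cid (Fk k)).
have FE k x : F k (i x) = f x 0 k by exact: (projT2 (cid (Fk k))).
have lin : linear (fun y => \row_k F k y).
  by move=> a x y; apply/rowP => k; rewrite !mxE linearP.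
exists (mklin lin) => x; apply/rowP => k.
by rewrite -[mklin _ _]/(\row_k F k (i x)) mxE FE.
Qed.

(** Horseshoe lemma for embeddings into free modules: Ext^1(Y'', R) = 0 allows [i'] to be extended
    from Y' to Y, and the extension is paired with [i''] after [b]. *)
Lemma ses_embed Y' Y Y'' (a : {linear Y' -> Y}) (b : {linear Y -> Y''})
    n' n'' Z' Z'' (i' : {linear Y' -> 'rV[R]_n'}) (p' : {linear 'rV[R]_n' -> Z'})
    (i'' : {linear Y'' -> 'rV[R]_n''}) (p'' : {linear 'rV[R]_n'' -> Z''}) :
  ses a b -> ses i' p' -> ses i'' p'' -> ext0 1 Y'' ->
  exists (Z : lmodType R) (i : {linear Y -> 'rV[R]_(n' + n'')})
    (p : {linear 'rV[R]_(n' + n'') -> Z}) (c : {linear Z' -> Z}) (d : {linear Z -> Z''}),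
    ses i p /\ ses c d.
Proof.
move=> ab s' s'' e; have [be beE] := ext0_extend ab e i'.
have [ai eab bs] := ab; have [i'i e' p's] := s'; have [i''i e'' p''s] := s''.
pose i := mklin (row_mx_linear be (i'' \o b : {linear _ -> _})).
have iE y : i y = row_mx (be y) (i'' (b y)) by [].
have [|Z [p ip]] := @coker_exists _ _ i.
  move=> x y; rewrite !iE => /eq_row_mx[h1 /i''i/eqP].
  rewrite -subr_eq0 -linearB => /eqP/eab[z zE].
  apply/eqP; rewrite -subr_eq0 -zE; apply/eqP.
  suff -> : z = 0 by rewrite linear0.
  by apply: i'i; rewrite -beE zE linearB h1 subrr linear0.
have [_ ep ps] := ip.
have linl : linear (fun u : 'rV[R]_n' => row_mx u (0 : 'rV[R]_n'')).
  by move=> k x y; rewrite scale_row_mx add_row_mx scaler0 addr0.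
have linr : linear (fun u : 'rV[R]_(n' + n'') => rsubmx u).
  by move=> k x y; rewrite !linearP.
have [|c cE] := @factor_surj _ _ _ _ p' (p \o mklin linl : {linear _ -> _}) p's.
  move=> u /e'[y yE]; apply/ep; exists (a y).
  by rewrite iE beE yE (ses0 ab) linear0.
have [|d dE] := @factor_surj _ _ _ _ p (p'' \o mklin linr : {linear _ -> _}) ps.
  move=> u /ep[y yE].
  rewrite -[LHS]/(p'' (rsubmx u)) -yE iE row_mxKr; exact: (ses0 s'').
exists Z, i, p, c, d; split=> //; split=> [z1 z2|z|z].
- have [u <-] := p's z1; have [v <-] := p's z2; rewrite !cE => /eqP.
  rewrite -subr_eq0 -linearB => /eqP/ep[y].
  rewrite iE -[RHS]/(row_mx (u - v) 0) => /eq_row_mx[h1].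
  rewrite -(linear0 i'') => /i''i/eab[y' yE].
  apply/eqP; rewrite -subr_eq0 -linearB; apply/eqP/e'; exists y'.
  by rewrite -beE yE.
- split=> [|[z' <-]].
    have [u <-] := ps z; rewrite dE => /e''[y''].
    have [y <-] := bs y'' => yE.
    exists (p' (lsubmx u - be y)); rewrite cE -[LHS]/(p (row_mx (lsubmx u - be y) 0)).
    apply/eqP; rewrite -subr_eq0 -linearB; apply/eqP/ep; exists (- y).
    rewrite linearN iE.
    rewrite -[X in _ = _ - X](hsubmxK u) !opp_row_mx add_row_mx.
    by rewrite yE -[mklin linr u]/(rsubmx u) addrAC subrr !add0r.
  have [u <-] := p's z'.
  by rewrite cE dE -[LHS]/(p'' (rsubmx (row_mx u 0))) row_mxKr linear0.
- have [u <-] := p''s z; exists (p (row_mx 0 u)).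
  by rewrite dE -[LHS]/(p'' (rsubmx (row_mx 0 u))) row_mxKr.
Qed.

(* Modules with a coresolution by finite free modules all of whose cosyzygies
   have no higher Ext into R; Q is the set of cosyzygies. *)
Definition totally_coresolved X := exists Q : lmodType R -> Prop, Q X /\
  forall Y, Q Y -> (forall n, ext0 n.+1 Y) /\
    exists n Z (i : {linear Y -> 'rV[R]_n}) (p : {linear 'rV[R]_n -> Z}), ses i p /\ Q Z.

Lemma tcr_unfold X : totally_coresolved X -> (forall n, ext0 n.+1 X) /\
  exists n Z (i : {linear X -> 'rV[R]_n}) (p : {linear 'rV[R]_n -> Z}),
    ses i p /\ totally_coresolved Z.
Proof.
move=> [Q [QX QP]]; have [e [n [Z [i [p [ip QZ]]]]]] := QP X QX; split=> //.
by exists n, Z, i, p; split=> //; exists Q.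
Qed.

(** Coinduction: the class of extensions of one totally coresolved module by another is closed under
    the cosyzygies that [ses_embed] produces. *)
Lemma tcr_ses Y' Y Y'' (a : {linear Y' -> Y}) (b : {linear Y -> Y''}) : ses a b ->
  totally_coresolved Y' -> totally_coresolved Y'' -> totally_coresolved Y.
Proof.
move=> ab t' t''; exists (fun Y => exists Y' Y'' (a : {linear Y' -> Y}) (b : {linear Y -> Y''}),
  [/\ ses a b, totally_coresolved Y' & totally_coresolved Y'']).
split=> [|{ab a b t' t''}{}Y]; first by exists Y', Y'', a, b.
move=> [{}Y' [{}Y'' [a [b [ab t' t'']]]]].
have [e' [n' [Z' [i' [p' [s' q']]]]]] := tcr_unfold t'.
have [e'' [n'' [Z'' [i'' [p'' [s'' q'']]]]]] := tcr_unfold t''.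
split=> [n|]; first by apply: (les_mid ab (mulcl1 R)); [exact: e'|exact: e''].
have [Z [i [p [c [d [ip cd]]]]]] := ses_embed ab s' s'' (e'' 0%N).
by exists (n' + n'')%N, Z, i, p; split=> //; exists Z', Z'', c, d.
Qed.

Lemma tcr_trivial X : is_trivial X -> totally_coresolved X.
Proof.
move=> X0; exists (fun Y : lmodType R => is_trivial Y); split=> // Y Y0; split=> [n|].
  by apply: ext0_projective => A B g f gs; exists 0 => x; rewrite (Y0 x) !linear0.
exists 0%N, ('rV[R]_0), 0, idfun; split; last by move=> x; exact: rV0_eq0.
split=> [x y _|y|y]; first by rewrite (Y0 x) (Y0 y).
  by split=> _; [exists 0; rewrite linear0|]; apply/esym; rewrite ?[LHS]rV0_eq0 ?[RHS]rV0_eq0.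
by exists y.
Qed.

Lemma tcr_iso X Y (u : {linear X -> Y}) : bijective u -> totally_coresolved X ->
  totally_coresolved Y.
Proof.
move=> [v uK vK] tX.
apply: (@tcr_ses _ _ ('rV[R]_0) u 0) tX _; last by apply: tcr_trivial => x; exact: rV0_eq0.
split=> [|y|z]; first exact: can_inj uK.
  by split=> // _; exists (v y).
by exists 0; rewrite [RHS]rV0_eq0 linear0.
Qed.

Fixpoint finite_free_res k X := match k with
  | 0 => exists n (u : {linear 'rV[R]_n -> X}), bijective u
  | k.+1 => exists n X1 (i : {linear X1 -> 'rV[R]_n}) (q : {linear 'rV[R]_n -> X}),
     ses i q /\ finite_free_res k X1
  end.

Fixpoint tcr_res k X := match k with
  | 0 => totally_coresolved X
  | k.+1 => exists X1 G (i : {linear X1 -> G}) (q : {linear G -> X}),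
     [/\ ses i q, totally_coresolved G & tcr_res k X1]
  end.

(** The hull of finite projective dimension of Auslander and Buchweitz. In the step, N = G0 / N1
    with N1 in H1. Embed G0 in R^n0, and H1 in R^(n0 + n1) compatibly on N1; then H is the quotient
    by H1. It contains R^n0 / N1, which contains N, and the cokernel of N in H is an extension of
    cosyzygies of G0 and G1. *)
Lemma tcr_approx k N : tcr_res k N -> exists H G (i : {linear N -> H}) (q : {linear H -> G}),
  [/\ ses i q, finite_free_res k H & totally_coresolved G].
Proof.
elim: k N => [|k IHk] N /=.
  move=> /tcr_unfold[_ [n [Z [i [p [ip tZ]]]]]].
  exists ('rV[R]_n), Z, i, p; split=> //=; exists n, idfun; by exists idfun.
move=> [N1 [G0 [i [q [iq tG0 /IHk[H1 [G1 [j1 [q1 [s1 fH tG1]]]]]]]]]].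
have [e0 [n0 [G0' [i0 [p0 [s0 tG0']]]]]] := tcr_unfold tG0.
have [e1 [n1 [G1' [i1 [p1 [s1' tG1']]]]]] := tcr_unfold tG1.
have [[ii eiq qs] [i0i e0' p0s]] := (iq, s0).
have [|Z' [p' s']] := @coker_exists _ _ (i0 \o i : {linear _ -> _}).
  exact: inj_comp.
have [_ e' p's] := s'.
have [|nu nuE] := @factor_surj _ _ _ _ q (p' \o i0 : {linear _ -> _}) qs.
  by move=> g /eiq[x <-]; exact: (ses0 s').
have [|de deE] := @factor_surj _ _ _ _ p' p0 p's.
  by move=> u /e'[x <-]; exact: (ses0 s0).
have snd : ses nu de.
  split=> [x y|z|z].
  - have [u <-] := qs x; have [v <-] := qs y; rewrite !nuE /= => /eqP.
    rewrite -subr_eq0 -!linearB => /eqP/e'[w /= /i0i wE].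
    by apply/eqP; rewrite -subr_eq0 -linearB -wE; apply/eqP/(ses0 iq).
  - split=> [|[x <-]].
      by have [u <-] := p's z; rewrite deE => /e0'[g <-]; exists (q g); rewrite nuE.
    by have [g <-] := qs x; rewrite nuE deE; exact: (ses0 s0).
  - by have [u <-] := p0s z; exists (p' u).
have [Z [i2 [p2 [c [d [s2 cd]]]]]] := ses_embed s1 s' s1' (e1 0%N).
have [W [r [a [b [sr ab]]]]] := ses_comp snd cd.
exists Z, W, (c \o nu : {linear _ -> _}), r; split=> //.
  by exists (n0 + n1)%N, H1, i2, p2.
exact: tcr_ses ab _ _.
Qed.

Lemma tcr_res_complex k X (Gs : nat -> lmodType R) (d : forall i, {linear Gs i.+1 -> Gs i})
    (e : {linear Gs 0 -> X}) :
  (forall i, (i <= k)%N -> totally_coresolved (Gs i)) ->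
  (forall i, (k < i)%N -> is_trivial (Gs i)) ->
  surj_map e -> exact_at (d 0) e -> (forall i, exact_at (d i.+1) (d i)) -> tcr_res k X.
Proof.
elim: k X Gs d e => [|k IHk] X Gs d e tG G0 es ede ed /=.
  apply: (@tcr_iso (Gs 0%N) _ e); last exact: tG.
  have ei : injective e.
    move=> x y /eqP; rewrite -subr_eq0 -linearB => /eqP/ede[z].
    by rewrite (G0 1%N _ z) // linear0 => /esym/eqP; rewrite subr_eq0 => /eqP.
  exists (fun y => projT1 (cid (es y))) => x.
    by apply: ei; exact: projT2 (cid (es _)).
  exact: projT2 (cid (es x)).
have [X1 [i ie]] := kernel_exists es; have [ii eie _] := ie.
have [|d' d'E] := @factor_inj _ _ _ _ i (d 0%N) ii.
  by move=> z; apply/eie/ede; exists z.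
exists X1, (Gs 0%N), i, e; split=> //; first exact: tG.
apply: (IHk X1 (fun i => Gs i.+1) (fun i => d i.+1) d').
- by move=> j jk; exact: tG.
- by move=> j jk; exact: G0.
- move=> x; have /ede[z zE] : e (i x) = 0 by exact: (ses0 ie).
  by exists z; apply: ii; rewrite d'E.
- move=> y; rewrite -(ed 0%N); split=> [y0|y0]; first by rewrite -d'E y0 linear0.
  by apply: ii; rewrite d'E y0 linear0.
- by move=> j; exact: ed.
Qed.
End ShortExact.

(** * Modules of Gorenstein dimension zero *)

Section ReflexivePairing.
Variable R : pzRingType.
Implicit Types X Y : lmodType R.

(* b : V x Y -> R identifies the right module V with Y^* and Y with V^* *)
Record reflexive_pairing Y (V : lmodType R^c) (b : V -> Y -> R) : Prop := {
  rp_linl : forall (a : R) v w y, b ((a : R^c) *: v + w) y = b v y * a + b w y;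
  rp_linr : forall a v y z, b v (a *: y + z) = a * b v y + b v z;
  rp_injl : forall v, (forall y, b v y = 0) -> v = 0;
  rp_injr : forall y, (forall v, b v y = 0) -> y = 0;
  rp_surjl : forall f : {linear Y -> R^o}, exists v, forall y, f y = b v y;
  rp_surjr : forall f : {linear V -> (R^c)^o}, exists y, forall v, f v = b v y;
  rp_fin : fin_gen V;
  rp_extl : forall n, ext0 n.+1 V;
  rp_extr : forall n, ext0 n.+1 Y
}.

(** A free cover of V, the dual of Y, with kernel K dualizes to an embedding of Y in R^n with
    cokernel Z, and K and Z are again dual to each other. The pairing keeps both identifications
    explicit, so the step can be repeated without passing through biduals. *)
Lemma pairing_coresolve Y (V : lmodType R^c) (b : V -> Y -> R) :
  noetherian R^c -> reflexive_pairing b ->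
  exists n (Z : lmodType R) (i : {linear Y -> 'rV[R]_n}) (p : {linear 'rV[R]_n -> Z})
    (K : lmodType R^c) (c : K -> Z -> R), ses i p /\ reflexive_pairing c.
Proof.
move=> nR [bl br bil bir bsl bsr bf bel ber].
have [n [q qs]] := (fin_genP V).1 bf.
have [K [k kq]] := kernel_exists qs; have [ki ek _] := kq.
pose v j := q (delta_mx 0 j).
have b0 y : b 0 y = 0.
  have := bl 1 0 0 y; rewrite scale1r addr0 mulr1 => h.
  by apply: (addrI (b 0 y)); rewrite addr0 -h.
have bD u w y : b (u + w) y = b u y + b w y.
  by have := bl 1 u w y; rewrite scale1r mulr1.
have bZ (a : R) u y : b ((a : R^c) *: u) y = b u y * a.
  by have := bl a u 0 y; rewrite addr0 b0 addr0.
have bq (c : 'rV[R^c]_n) y : b (q c) y = \sum_j b (v j) y * (c 0 j : R).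
  rewrite rv_expand; elim/big_rec2: _ => [|j u w _ <-]; first exact: b0.
  by rewrite bD bZ.
have li : linear (fun y => \row_j b (v j) y : 'rV[R]_n).
  by move=> a x y; apply/rowP => j; rewrite !mxE br.
pose i := mklin li.
have iE y j : i y 0 j = b (v j) y by rewrite -[i y]/(\row_j b (v j) y) mxE.
have ii : injective i.
  move=> x y /eqP; rewrite -subr_eq0 -linearB => /eqP h; apply/eqP.
  rewrite -subr_eq0; apply/eqP/bir => u; have [c <-] := qs u.
  by rewrite bq big1 // => j _; rewrite -iE h mxE mul0r.
have [Z [p ip]] := coker_exists ii; have [_ ei ps] := ip.
pose pr (c : 'rV[R^c]_n) (x : 'rV[R]_n) : R := \sum_j x 0 j * (c 0 j : R).
have prlinr c : linear (pr c : 'rV[R]_n -> R^o).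
  move=> a x y; rewrite /pr [X in _ = X + _]mulr_sumr -big_split; apply: eq_bigr => j _.
  by rewrite !mxE mulrDl mulrA.
have prlinl x : linear ((fun c => pr c x) : 'rV[R^c]_n -> (R^c)^o).
  move=> a c d; rewrite /pr [X in _ = X + _]mulr_suml -big_split; apply: eq_bigr => j _.
  by rewrite !mxE mulrDr mulrA.
have pri c y : pr c (i y) = b (q c) y.
  by rewrite bq; apply: eq_bigr => j _; rewrite iE.
have prK u x y : p x = p y -> pr (k u) x = pr (k u) y.
  move=> /eqP; rewrite -subr_eq0 -linearB => /eqP/ei[z zE].
  rewrite -[LHS]/(mklin (prlinr (k u)) x) -[RHS]/(mklin (prlinr (k u)) y).
  apply/eqP; rewrite -subr_eq0 -linearB -zE.
  apply/eqP; by rewrite -[LHS]/(pr (k u) (i z)) pri (ses0 kq) b0.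
(* The pairing of K with Z is computed on chosen preimages in R^n; by [prK] the choice is
   immaterial, as K pairs to zero with the image of Y. *)
pose r z := projT1 (cid (ps z)).
have rE z : p (r z) = z by exact: projT2 (cid (ps z)).
pose c u z := pr (k u) (r z).
have cE u x : c u (p x) = pr (k u) x by apply: prK; rewrite rE.
exists n, Z, i, p, K, c; split=> //; split.
- by move=> a u w z; rewrite /c linearP; exact: (prlinl (r z)).
- move=> a u y z; have [x <-] := ps y; have [w <-] := ps z.
  by rewrite -linearP !cE; exact: prlinr.
- move=> u u0; apply: ki; rewrite linear0; apply/rowP => j.
  have := u0 (p (delta_mx 0 j)); rewrite cE /pr (bigD1 j) //= !mxE !eqxx mul1r.
  rewrite big1 ?addr0 // => l lj.
  by rewrite mxE (negPf lj) andbF mul0r.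
- move=> z; have [x <-] := ps z => x0; apply/ei.
  (* Pairing with x kills K, so it descends to a functional on V, that is, an element y of Y. *)
  have [|f fE] := @factor_surj _ _ _ _ q (mklin (prlinl x)) qs.
    by move=> d /ek[u <-]; rewrite -[LHS]/(pr (k u) x) -cE x0.
  have [y yE] := bsr f; exists y; apply/rowP => j.
  rewrite iE -yE fE -[LHS]/(pr (delta_mx 0 j) x) /pr (bigD1 j) //= !mxE !eqxx mulr1.
  by rewrite big1 ?addr0 // => l lj; rewrite mxE (negPf lj) andbF mulr0.
- move=> f; pose d : 'rV[R^c]_n := \row_j f (p (delta_mx 0 j)).
  have fE x : f (p x) = pr d x.
    rewrite -[LHS]/((f \o p : {linear _ -> _}) x) rv_expand.
    by apply: eq_bigr => j _; rewrite mxE.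
  have /ek[u uE] : q d = 0.
    by apply: bil => y; rewrite -pri -fE (ses0 ip) linear0.
  by exists u => z; have [x <-] := ps z; rewrite fE cE uE.
(* As Ext^1(V, R) = 0, a functional on K extends to the free module, where it is the pairing with a
   row. *)
- move=> f; have [s -> [F FE]] := ext1_extend kq f (bel 0%N).
  exists (p (\row_j F (delta_mx 0 j))) => u.
  rewrite cE -[LHS]mulr1 -FE [LHS]rv_expand /pr.
  by apply: eq_bigr => j _; rewrite mxE.
- exact: (sub_fin_gen nR (rV_fin_gen _ n) ki).
- move=> m; apply: (les_left kq (mulcl1 _)) (bel m.+1).
  by apply: ext0_projective; exact: rV_projective.
- case=> [|m]; last first.
    apply: (les_right ip (mulcl1 _)) (ber m).
    by apply: ext0_projective; exact: rV_projective.
  apply: (extend_ext1 ip (mulcl1 _)).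
    by apply: ext0_projective; exact: rV_projective.
  (* Functionals on Y extend to R^n: each is given by some u in V, and u lifts along q. *)
  move=> f; exists 1 => //; have [u uE] := bsl f; have [d dE] := qs u.
  by exists (mklin (prlinr d)) => y; rewrite mulr1 -[LHS]/(pr d (i y)) pri dE uE.
Qed.

Lemma pairing_tcr Y (V : lmodType R^c) (b : V -> Y -> R) :
  noetherian R^c -> reflexive_pairing b -> totally_coresolved Y.
Proof.
move=> nR bP; exists (fun Y : lmodType R => exists (V : lmodType R^c) (b : V -> Y -> R),
  reflexive_pairing b); split=> [|{bP b V}{}Y [V [b bP]]]; first by exists V, b.
split=> [n|]; first exact: (rp_extr bP).
have [n [Z [i [p [K [c [ip cP]]]]]]] := pairing_coresolve nR bP.
by exists n, Z, i, p; split=> //; exists K, c.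
Qed.

Hypothesis comm : forall a b : R, a * b = b * a.

Lemma noetherian_conv : noetherian R -> noetherian R^c.
Proof.
move=> nR I I0 IP; have [|n [g gP]] := nR I I0.
  by move=> a x y Ix Iy; rewrite comm; exact: (IP a x y).
exists n, g => x; split.
  by move=> /gP[c ->]; exists c; apply: eq_bigr => i _; rewrite comm.
by move=> [c ->]; apply/gP; exists c; apply: eq_bigr => i _; rewrite comm.
Qed.

Lemma dual_fin_gen X : noetherian R -> fin_gen X -> fin_gen (dual X : lmodType R^c).
Proof.
move=> nR [n [g gP]].
have lin : linear (fun f : dual X => \row_k dual_fun f (g k) : 'rV[R^c]_n).
  by move=> a f h; apply/rowP => k; rewrite !mxE.
apply: (@sub_fin_gen _ _ _ (mklin lin) (noetherian_conv nR) (rV_fin_gen _ n)).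
move=> f h /rowP fh; apply: linear_ext => x; have [c ->] := gP x.
rewrite !linear_sum_eq; apply: eq_bigr => k _; congr (_ *: _).
by have := fh k; rewrite -[mklin _ _]/(\row_k dual_fun f (g k))
  -[mklin lin h]/(\row_k dual_fun h (g k)) !mxE.
Qed.

Lemma Gdim0_tcr X : noetherian R -> fin_gen X -> Gdim_eq0 X -> totally_coresolved X.
Proof.
move=> nR fX [[binv bK Kb] e e'].
apply: (@pairing_tcr X (dual X) (fun f x => dual_fun f x)); first exact: noetherian_conv.
split.
- by [].
- by move=> a v y z; rewrite /dual_fun linearP.
- by move=> f f0; exact: linear_ext.
- move=> x x0; rewrite -[x]bK -[RHS]bK; congr (binv _); apply: linear_ext => f.
  by rewrite -[LHS]/(dual_fun f x) x0 -[RHS]/(dual_fun f 0) /dual_fun linear0.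
- by move=> f; exists f.
- move=> f; exists (binv (f : dual (dual X))) => v.
  by rewrite -[LHS]/((f : {linear _ -> _}) v) -{1}[f](Kb f).
- exact: dual_fin_gen.
- by move=> n; apply/Ext_trivialP; [exact: std_resolution|exact: e'].
- by move=> n; apply/Ext_trivialP; [exact: std_resolution|exact: e].
Qed.

Lemma Gdim_tcr_res X : noetherian R -> fin_gen X -> Gdim X <> None ->
  exists k, tcr_res k X.
Proof.
move=> nR fX; rewrite /Gdim /nat_inf; case: pselect => // -[k /asboolP Gk] _.
exists k; case: k Gk => [|k] /=; first exact: Gdim0_tcr.
move=> [G [d [e [Gf G0 es ede ed]]]].
apply: (@tcr_res_complex _ k.+1 X G d e) => // i ik.
by have [fG gG] := Gf i ik; exact: Gdim0_tcr.
Qed.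
End ReflexivePairing.

(** * Commutative Noetherian rings *)

Section PrimeRank.
Variable R : comPzRingType.

Definition ideal_pred (p : R -> Prop) := submod (p : R^o -> Prop).

Record prime_pred (p : R -> Prop) : Prop := {
  pp_ideal : ideal_pred p;
  pp_one : ~ p 1;
  pp_mul : forall a b, p (a * b) -> p a \/ p b
}.

Lemma prime_compl_mulcl p : prime_pred p -> mulcl (fun s : R => ~ p s).
Proof. by move=> [_ p1 pM]; split=> // s t ps pt /pM[]. Qed.

(* Gaussian elimination over the fraction field of R/p, denominators cleared *)
Lemma rank_mod_prime p n m (M : 'M[R]_(n, m)) : prime_pred p ->
  (exists x : 'rV_n, (exists i, ~ p (x 0 i)) /\ forall j, p ((x *m M) 0 j)) \/
  (exists (G : 'M_(m, n)) (t : R), ~ p t /\ M *m G = t%:M).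
Proof.
move=> pp; elim: n M => [|n IHn] M.
  right; exists 0, 1; split; first exact: pp_one pp.
  by apply/matrixP => -[].
rewrite -[n.+1]/(1 + n)%N in M *.
pose u := usubmx M; pose M1 := dsubmx M.
have ME : M = col_mx u M1 by rewrite vsubmxK.
have [[x [[i xi] xP]]|[G [t [pt GE]]]] := IHn M1.
  left; exists (row_mx 0 x); split; first by exists (rshift 1 i); rewrite row_mxEr.
  by move=> j; rewrite ME mul_row_col mul0mx add0r.
(* Over the fraction field of R/p, the row u lies in the span of the rows of M1 exactly when u'
   vanishes. *)
pose u' := t *: u - u *m G *m M1.
have [u'p|] := pselect (forall j, p (u' 0 j)).
  left; exists (row_mx t%:M (- (u *m G))); split.
    by exists (lshift n 0); rewrite row_mxEl mxE eqxx mulr1n.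
  by move=> j; rewrite ME mul_row_col mulNmx mul_scalar_mx; exact: u'p.
move=> /existsNP[j u'j]; right.
pose e : 'cV[R]_m := delta_mx j 0.
(* A column killed by M1 with u c = a, the pivot; up to a factor it becomes the first column of the
   new right inverse, and it corrects G in the others. *)
pose c : 'cV[R]_m := t *: e - G *m (M1 *m e).
pose a := u' 0 j.
have M1c : M1 *m c = 0.
  by rewrite mulmxBr -scalemxAr [M1 *m (G *m _)]mulmxA GE mul_scalar_mx subrr.
have uc : u *m c = a%:M.
  have -> : u *m c = u' *m e.
    by rewrite mulmxBr mulmxBl -scalemxAr -scalemxAl !mulmxA.
  apply/matrixP => k l; rewrite !ord1 [RHS]mxE eqxx mulr1n.
  rewrite mxE (bigD1 j) //= [e j 0]mxE !eqxx mulr1 big1 ?addr0 // => k' k'j.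
  by rewrite [e _ _]mxE (negPf k'j) mulr0.
have sAr r1 r2 r3 (x : R) (A : 'M_(r1, r2)) (B : 'M_(r2, r3)) :
    A *m (x *: B) = x *: (A *m B) by rewrite scalemxAr.
have pa : ~ p a by [].
clearbody c a; clear e u' u'j; clearbody u M1.
exists (row_mx (t *: c) (a *: G - c *m (u *m G))), (a * t); split.
  by move=> /(pp_mul pp)[].
rewrite ME mul_col_row (@scalar_mx_block _ 1 n); congr block_mx.
- by rewrite sAr uc scale_scalar_mx mulrC.
- by rewrite mulmxBr sAr [u *m (c *m _)]mulmxA uc mul_scalar_mx subrr.
- by rewrite sAr M1c scaler0.
- by rewrite mulmxBr sAr [M1 *m (c *m _)]mulmxA M1c mul0mx subr0 GE scale_scalar_mx.
Qed.

Lemma ideal_max (F : (R -> Prop) -> Prop) : noetherian R ->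
  (forall a, F a -> ideal_pred a) -> (exists a, F a) ->
  exists2 a, F a & forall b, F b -> (forall x, a x -> b x) -> forall x, b x -> a x.
Proof.
move=> nR FI [a0 Fa0]; apply: contrapT => H.
have next (a : {a | F a}) : {b : {b | F b} | (forall x, sval a x -> sval b x) /\
    exists x, sval b x /\ ~ sval a x}.
  apply: cid; case: a => a Fa; apply: contrapT => H1; apply: H; exists a => // b Fb ab x bx.
  apply: contrapT => ax; apply: H1; exists (exist _ b Fb); split=> //.
  by exists x.
pose a n := iter n (fun a => sval (next a)) (exist _ a0 Fa0).
have [|||N NP] := @chain_stable R R^o (fun n => sval (a n)).
- apply: noeth_fin_gen => //; exists 1%N, (fun=> 1) => x.
  by exists (fun=> x); rewrite big_ord1 [RHS]mulr1.
- by move=> n; apply: FI; exact: svalP.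
- by move=> n x; exact: (svalP (next (a n))).1.
by have [x [xN]] := (svalP (next (a N))).2; apply; exact: (NP N.+1 x xN).
Qed.

End PrimeRank.

(** * Ext over a commutative ring, and projectivity at a prime *)

Section CommExt.
Variable R : comPzRingType.
Implicit Types X Y Z N : lmodType R.

Lemma scal_linear X (s : R) : linear (fun x : X => s *: x).
Proof. by move=> a x y; rewrite scalerDr !scalerA mulrC. Qed.
Definition scal X s : {linear X -> X} := mklin (@scal_linear X s).

Lemma scal_lift X (P : resolution X) s :
  exists phi : lift_of P P (scal X s), forall n x, phi n x = s *: x.
Proof.
unshelve eexists (@Lift _ _ _ _ _ _ (fun n => scal (P n) s) _ _).
- by move=> x; exact: linearZ.
- by move=> n x; exact: linearZ.
by [].
Qed.

Lemma zero_lift X (P : resolution X) :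
  exists phi : lift_of P P (0 : {linear X -> X}), forall n x, phi n x = 0.
Proof.
unshelve eexists (@Lift _ _ _ _ _ _ (fun n => (0 : {linear P n -> P n})) _ _).
- by move=> x; exact: linear0.
- by move=> n x; exact: linear0.
by [].
Qed.

(** On P, multiplication by s lifts both s and 0 on X, hence is homotopic to zero. *)
Lemma annih_cob X (P : resolution X) s n (f : {linear P n -> R^o}) :
  (forall x : X, s *: x = 0) -> coc f -> cob (fun x => f x * s : R^o).
Proof.
move=> s0 cf; have [phi phiE] := scal_lift P s.
have [psi psiE] := zero_lift P.
have aug0 x : res_aug P (phi 0%N x) = (0 : {linear X -> X}) (res_aug P x).
  by rewrite lf_aug; exact: s0.
pose phi' := Lift aug0 (lf_d phi).
apply: cob_ext (lift_unique phi' psi cf) => x.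
by rewrite psiE linear0 subr0 [LHS](_ : _ = f (phi n x)) // phiE linearZ mulrC.
Qed.

Lemma ext0_trivial X n : is_trivial X -> ext0 n X.
Proof.
move=> X0; case: n => [|n]; last first.
  by apply: ext0_projective => A B g f gs; exists 0 => x; rewrite (X0 x) !linear0.
move=> P f cf; exists 1 => // x; rewrite mulr1.
have /res_exact0[y <-] : res_aug P x = 0 by exact: X0.
exact: cf.
Qed.

(** Here Y stands for R / a, up to isomorphism. *)
Definition cyclic_ext0 (I : R -> Prop) j := forall a : R -> Prop, ideal_pred a ->
  (forall x, I x -> a x) -> forall Y (q : {linear R^o -> Y}), surj_map q ->
  (forall x, q x = 0 <-> a x) -> ext0 j Y.

Lemma cyclic_ext0_fg I j Y : cyclic_ext0 I j -> fin_gen Y ->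
  (forall a, I a -> forall y : Y, a *: y = 0) -> ext0 j Y.
Proof.
move=> V; pose T Y := (forall a, I a -> forall y : Y, a *: y = 0) -> ext0 j Y.
move=> fY; apply: (@fg_ind _ T _ _ Y fY) => [B q qs IB|X' X X'' i q iq T' T'' IX].
  apply: (V (fun x => q x = 0) _ _ B q) => //.
    by split=> [|a x y qx qy]; rewrite ?linear0 // linearP qx qy scaler0 addr0.
  by move=> x Ix; rewrite -[x]mulr1 -[x * 1]/(x *: (1 : R^o)) linearZ; exact: IB.
have [ii _ qs] := iq.
apply: (les_mid iq (mulcl1 R)).
  by apply: T' => a Ia y; apply: ii; rewrite linearZ linear0; exact: IX.
by apply: T'' => a Ia y; have [x <-] := qs y; rewrite -linearZ (IX a Ia) linear0.
Qed.

Section SecondVariable.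
Variables (Y0 : lmodType R) (P : resolution Y0).

Definition ext_in X j := forall f : {linear P j -> X}, coc f -> cob f.

(** From the long exact sequence in the second variable: when Ext^(j-1)(Y0, Z) = 0, a primitive h of
    i f can be corrected so that q h = 0, and it then comes from X. *)
Lemma cob_inj X Y Z (i : {linear X -> Y}) (q : {linear Y -> Z}) j
    (f : {linear P j -> X}) : ses i q -> (forall k, j = k.+1 -> ext_in Z k) ->
  coc f -> cob (fun x => i (f x)) -> cob f.
Proof.
move=> iq; have [ii ei qs] := iq; case: j f => [|k] f eZ cf /=.
  by move=> f0 x; apply: ii; rewrite f0 linear0.
move=> [h hE].
have [h' h'E] : exists h' : {linear P k -> Y}, (forall x, q (h' x) = 0) /\
    forall x, i (f x) = h' (res_d P k x).
  have /(eZ k erefl) : coc (q \o h : {linear _ -> _}) by move=> x /=; rewrite -hE (ses0 iq).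
  case: k f eZ cf h hE => [|k] f eZ cf h hE /=; first by move=> h0; exists h.
  move=> [t tE]; have [t' t'E] := @res_proj _ _ P k _ _ q t qs.
  exists (h \- (t' \o res_d P k)); split=> x /=.
    by rewrite linearB t'E -tE subrr.
  by rewrite res_dd linear0 subr0 hE.
have [|g gE] := @factor_inj _ _ _ _ i h' ii.
  by move=> z; apply/ei; case: h'E.
by exists g => x; apply: ii; rewrite gE; case: h'E.
Qed.

Lemma cob_rV n j (f : {linear P j -> 'rV[R]_n}) :
  (forall k, cob (fun x => f x 0 k : R^o)) -> cob f.
Proof.
case: j f => [|j] f /= fk; first by move=> x; apply/rowP => k; rewrite mxE fk.
pose g k := projT1 (cid (fk k)).
have gE k x : f x 0 k = g k (res_d P j x) by exact: projT2 (cid (fk k)) x.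
have lin : linear (fun y => \row_k (g k y : R)).
  by move=> a x y; apply/rowP => k; rewrite !mxE linearP.
by exists (mklin lin) => x; apply/rowP => k; rewrite mxE gE.
Qed.

Lemma ext_in_rV n j : ext_in R^o j -> ext_in ('rV[R]_n) j.
Proof.
move=> e f cf; apply: cob_rV => k.
have lin : linear (fun x => f x 0 k : R^o) by move=> a x y; rewrite linearP !mxE.
by apply: (e (mklin lin)) => x; rewrite -[LHS]/(f _ 0 k) cf mxE.
Qed.

Fixpoint nth_syzygy m X := match m with
  | 0 => True
  | m.+1 => exists n X' (i : {linear X -> 'rV[R]_n}) (q : {linear 'rV[R]_n -> X'}),
      ses i q /\ nth_syzygy m X'
  end.

(** Depth count: Ext^j(Y0, X) lies between Ext^(j-1)(Y0, X') and Ext^j(Y0, R^n) = 0, so every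
    passage to a syzygy gains one degree, up to g. *)
Lemma syzygy_ext_in g m X : (forall j, (j < g)%N -> ext_in R^o j) -> nth_syzygy m X ->
  forall j, (j < m)%N -> (j < g)%N -> ext_in X j.
Proof.
move=> eR; elim: m X => [|m IHm] X //= [n [X' [i [q [iq sX']]]]] j jm jg f cf.
apply: (cob_inj iq) => //.
  move=> k jk; apply: IHm => //; rewrite jk in jm jg; first by [].
  exact: ltnW.
have cif : coc (i \o f : {linear P j -> 'rV[R]_n}) by move=> x /=; rewrite cf linear0.
exact: (ext_in_rV (eR j jg) cif).
Qed.

End SecondVariable.

Section AtPrime.
Variables (p : R -> Prop).
Hypothesis pp : prime_pred p.
Let S s := ~ p s.

(* projective after inverting an element s outside p *)
Definition almost_projective X := exists n (si : {linear X -> 'rV[R]_n})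
  (pi : {linear 'rV[R]_n -> X}) (s : R), S s /\ forall x, pi (si x) = s *: x.

(** Multiplication by s on X factors through a free module, whose resolution is concentrated in
    degree 0. *)
Lemma almost_projective_ext X i : almost_projective X -> ext_null S i.+1 X.
Proof.
move=> [n [si [pi [s [Ss piE]]]]] P f cf; exists s => //.
have [Q Q0] := projective_resolution (@rV_projective R n).
have [phi _] := lift_exists P Q si; have [psi _] := lift_exists Q P pi.
have [xi xiE] := lift_comp phi psi (w := scal X s) (fun x => esym (piE x)).
have [th thE] := scal_lift P s.
have := lift_unique th xi cf; apply: cob_ext => x.
by rewrite xiE thE (Q0 _ (phi i.+1 x)) (linear0 (psi _)) (linear0 f) subr0 linearZ mulrC.
Qed.

Variables (Y0 : lmodType R) (q0 : {linear R^o -> Y0}).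
Hypothesis q0s : surj_map q0.
Hypothesis q0p : forall x, q0 x = 0 <-> p x.
Variable g : nat.
Variables (P : resolution Y0) (om : {linear P g -> R^o}).
Hypothesis com : coc om.
Hypothesis omS : forall s, cob (fun x => om x * s : R^o) -> p s.
Hypothesis eR : forall j, (j < g)%N -> ext_in P R^o j.

Lemma killed_cob s : p s -> cob (fun x => om x * s : R^o).
Proof.
move=> ps; apply: annih_cob => // y; have [x <-] := q0s y.
rewrite -linearZ; apply/q0p; rewrite -[s *: x]/(s * x) mulrC.
exact: (submodZ (pp_ideal pp)).
Qed.

Lemma tens_linear X (x : X) : linear (fun y => (om y : R) *: x).
Proof. by move=> a u v; rewrite linearP scalerDl scalerA. Qed.
(** The product of the class of [om] with x under Ext^g(Y0, R) x X -> Ext^g(Y0, X). *)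
Definition tens X (x : X) : {linear P g -> X} := mklin (tens_linear x).

Lemma tens_coc X (x : X) : coc (tens x).
Proof. by move=> y; rewrite -[LHS]/(om _ *: x) com scale0r. Qed.

Lemma tens_cob n (x : 'rV[R]_n) : (forall k, p (x 0 k)) -> cob (tens x).
Proof.
move=> px; apply: cob_rV => k; apply: cob_ext (killed_cob (px k)) => y.
by rewrite -[tens x y]/(om y *: x) mxE.
Qed.

(* With si and pi as in almost_projective, c |-> (i (pi c), s c - si (pi c)) is
   injective modulo p: if the image of x is in p, then om x dies in Ext^g(A/p, R^m),
   hence in Ext^g(A/p, X), hence s om x = 0.  By rank_mod_prime it is then split up to
   an element outside p, and so is i. *)
Lemma almost_projective_step m X X' (i : {linear X -> 'rV[R]_m})
    (q : {linear 'rV[R]_m -> X'}) : ses i q ->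
  (forall k, g = k.+1 -> ext_in P X' k) ->
  almost_projective X -> almost_projective X'.
Proof.
move=> iq eX' [n [si [pi [s [Ss piE]]]]].
have lin : linear (fun c : 'rV[R]_n => row_mx (i (pi c)) (s *: c - si (pi c))).
  move=> a x y; rewrite (linearP pi) (linearP si) (linearP i) scale_row_mx add_row_mx.
  by rewrite [s *: (_ + _)]scalerDr scalerBr !scalerA [s * a]mulrC opprD addrACA -!scalerA.
pose M := lin1_mx (mklin lin).
have ME c : c *m M = row_mx (i (pi c)) (s *: c - si (pi c)) by rewrite mul_rV_lin1.
have [[x [[k xk] xP]]|[G [t [St GE]]]] := rank_mod_prime M pp.
  case: xk; suff : p (s * x 0 k) by case/(pp_mul pp).
  have c1 : cob (tens (pi x)).
    apply: (cob_inj iq eX' (@tens_coc _ (pi x))).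
    have px j : p (i (pi x) 0 j) by have := xP (lshift n j); rewrite ME row_mxEl.
    by apply: cob_ext (tens_cob px) => y; rewrite -[RHS]/(i (om y *: pi x)) linearZ.
  have c2 : cob (tens (s *: x - si (pi x))).
    by apply: tens_cob => j; have := xP (rshift m j); rewrite ME row_mxEr.
  have c3 : cob (tens (s *: x)).
    have := cobD c2 (cob_comp si c1); apply: cob_ext => y.
    rewrite -[LHS]/(om y *: (s *: x - si (pi x)) + si (om y *: pi x)).
    by rewrite linearZ -scalerDr subrK.
  apply: omS; have lk : linear (fun u : 'rV[R]_n => u 0 k : R^o).
    by move=> a u v; rewrite !mxE.
  have := cob_comp (mklin lk) c3; apply: cob_ext => y.
  by rewrite -[LHS]/((om y *: (s *: x)) 0 k) !mxE.
pose G1 := usubmx G; pose G2 := dsubmx G.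
have G12 c : i (pi c) *m G1 + (s *: c - si (pi c)) *m G2 = t *: c.
  by rewrite -mul_row_col vsubmxK -ME -mulmxA GE mul_mx_scalar.
(* For c = si x the second block drops out of [G12]: multiplication by G1 followed by s pi is a
   retraction of i up to the factor t s. *)
have gam x : s *: pi (i x *m G1) = (t * s) *: x.
  have := G12 (si x); rewrite piE (linearZZ i) (linearZZ si) subrr mul0mx addr0 -scalemxAl => /(congr1 pi).
  by rewrite !(linearZZ pi) piE scalerA.
(* The projection off the image of i given by that retraction; it descends to a section of q up to t
   s. *)
have lT : linear (fun u : 'rV[R]_m => (t * s) *: u - i (s *: pi (u *m G1))).
  move=> a u v; rewrite mulmxDl -scalemxAl (linearP pi).
  rewrite (scal_linear s) (linearP i) (scal_linear (t * s)) scalerBr.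
  by rewrite opprD addrACA.
have [_ ei qs] := iq.
have [|si' si'E] := @factor_surj _ _ _ _ q (mklin lT) qs.
  move=> u /ei[x <-]; rewrite -[LHS]/((t * s) *: i x - i (s *: pi (i x *m G1))).
  by rewrite gam linearZ subrr.
exists m, si', q, (t * s); split; first exact: (prime_compl_mulcl pp).2.
move=> x; have [u <-] := qs x.
rewrite si'E -[mklin lT u]/((t * s) *: u - i (s *: pi (u *m G1))).
by rewrite linearB (ses0 iq) subr0 linearZ.
Qed.

Lemma free_almost_projective n X (u : {linear 'rV[R]_n -> X}) : bijective u ->
  almost_projective X.
Proof.
move=> [v uK vK]; have [||w wE] := @factor_surj _ _ _ _ u idfun.
- by move=> x; exists (v x).
- by move=> x ux; apply: (can_inj uK); rewrite ux linear0.
exists n, w, u, 1; split=> [|x]; first exact: pp_one pp.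
by rewrite scale1r -[x in LHS]vK wE vK.
Qed.

(** Takes the place of the Auslander-Buchsbaum formula: the kernel X1 is an (m+1)-th syzygy, almost
    projective by induction on k, and Ext^(g-1)(Y0, X) = 0 by the depth count lets
    [almost_projective_step] pass to X. *)
Lemma finite_res_syzygy k m X : finite_free_res k X -> nth_syzygy m X -> (g <= m)%N ->
  almost_projective X.
Proof.
elim: k m X => [|k IHk] m X /= => [[n [u ub]] _ _|].
  exact: free_almost_projective ub.
move=> [n [X1 [i [q [iq fX1]]]]] sX gm.
apply: (almost_projective_step iq).
  move=> j gj; apply: (syzygy_ext_in eR sX); last by rewrite gj.
  by rewrite gj in gm.
apply: (IHk m.+1) => //; first by exists n, X, i, q.
exact: leqW.
Qed.

(** Dimension shifting from (m, i) to (m+1, i-1) until m reaches g, where [finite_res_syzygy]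
    applies. *)
Lemma finite_res_ext k m X i : finite_free_res k X -> nth_syzygy m X -> (g < m + i)%N ->
  (0 < i)%N -> ext_null S i X.
Proof.
elim: k m X i => [|k IHk] m X i fX sX gmi i0.
  case: i i0 gmi => // i _ _; apply: almost_projective_ext.
  by case: fX => n [u ub]; exact: free_almost_projective ub.
have [gm|mg] := leqP g m.
  by case: i i0 gmi => // i _ _; apply: almost_projective_ext; exact: finite_res_syzygy fX sX gm.
case: fX => n [X1 [a [q [iq fX1]]]].
case: i i0 gmi => // -[|i] _ gmi.
  by move: gmi; rewrite addn1 ltnS leqNgt mg.
apply: (les_right iq (prime_compl_mulcl pp)).
  apply: ext0_null; first exact: prime_compl_mulcl.
  by apply: ext0_projective; exact: rV_projective.
apply: (IHk m.+1) => //; last by rewrite addSnnS.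
by exists n, X, a, q.
Qed.

End AtPrime.
End CommExt.

(** * The critical degree and prime *)

Section Dichotomy.
Variable R : comPzRingType.
Hypothesis nR : noetherian R.
Implicit Types X Y Z N : lmodType R.

Section Maximal.
Variables (I : R -> Prop) (g : nat) (p : R -> Prop).
Hypothesis pI : ideal_pred p.
Hypothesis Ip : forall x, I x -> p x.
Hypothesis maxp : forall b, ideal_pred b -> (forall x, p x -> b x) ->
  (exists x, b x /\ ~ p x) -> forall Y (q : {linear R^o -> Y}), surj_map q ->
  (forall x, q x = 0 <-> b x) -> ext0 g Y.
Variables (Y0 : lmodType R) (q0 : {linear R^o -> Y0}).
Hypothesis q0s : surj_map q0.
Hypothesis q0p : forall x, q0 x = 0 <-> p x.
Hypothesis Y0n : ~ ext0 g Y0.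

(** The kernel of R -> Z contains p strictly, so maximality of p applies. *)
Lemma ext0_proper_quot Z (r : {linear Y0 -> Z}) a : surj_map r -> ~ p a ->
  r (q0 a) = 0 -> ext0 g Z.
Proof.
move=> rs pa ra; apply: (maxp (b := fun x => r (q0 x) = 0) _ _ _ (q := r \o q0)).
- by split=> [|c x y hx hy]; rewrite ?linear0 // !linearP hx hy scaler0 addr0.
- by move=> x /q0p ->; rewrite linear0.
- by exists a.
- by move=> z; have [y <-] := rs z; have [x <-] := q0s y; exists x.
- by [].
Qed.

Lemma scal_q0 s x : s *: q0 x = q0 (s * x).
Proof. by rewrite -linearZ. Qed.

(** If x were outside p, then p : s and p + (s) would both contain p strictly, and 0 -> R/(p : s) ->
    R/p -> R/(p + (s)) -> 0 would force Ext^g(R/p, R) = 0. *)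
Lemma colon_max s x : ~ p s -> p (s * x) -> p x.
Proof.
move=> ps psx; apply: contrapT => px.
have lin : linear (fun x : R^o => s *: q0 x) by move=> a u v; rewrite linearP scal_linear.
pose f := mklin lin.
have kP : ideal_pred (fun x => p (s * x)).
  split; first by rewrite mulr0; exact: (submod0 pI).
  move=> a u v hu hv; rewrite mulrDr mulrCA.
  by apply: (submodD pI) => //; exact: (submodZ pI).
have [B [qB [qBs qBk]]] := quotient_exists kP.
have [|i iE] := @factor_surj _ _ _ _ qB f qBs.
  by move=> u /qBk h; rewrite -[LHS]/(s *: q0 u) scal_q0; apply/q0p.
have ii : injective i.
  move=> u v; have [c <-] := qBs u; have [d <-] := qBs v; rewrite !iE => /eqP.
  rewrite -subr_eq0 -linearB -[f _]/(s *: q0 (c - d)) scal_q0 => /eqP/q0p h.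
  by apply/eqP; rewrite -subr_eq0 -linearB; apply/eqP/qBk.
have [Z [r ir]] := coker_exists ii; have [_ _ rs] := ir.
apply: Y0n; apply: (les_mid ir (mulcl1 R)).
  apply: (maxp kP _ _ qBs qBk); last by exists x.
  by move=> u pu; exact: (submodZ pI).
apply: (ext0_proper_quot rs ps).
suff -> : q0 s = i (qB 1) by rewrite (ses0 ir).
by rewrite iE -[f _]/(s *: q0 1) scal_q0 mulr1.
Qed.

Lemma max_prime : prime_pred p.
Proof.
split=> // [p1|a b pab].
  apply: Y0n; apply: ext0_trivial => y; have [x <-] := q0s y; apply/q0p.
  by rewrite -[x]mulr1; exact: (submodZ pI).
have [pa|pa] := pselect (p a); first by left.
by right; exact: colon_max pab.
Qed.

(** Multiplication by s is injective on R/p and Ext^g of its cokernel vanishes, so s acts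
    injectively on Ext^g(R/p, R). *)
Lemma compl_torsionfree (P : resolution Y0) (f : {linear P g -> R^o}) s : ~ p s ->
  coc f -> cob (fun x => f x * s : R^o) -> cob f.
Proof.
move=> ps cf cfs.
have ii : injective (scal Y0 s).
  move=> u v; have [c <-] := q0s u; have [d <-] := q0s v => /eqP.
  rewrite -subr_eq0 -!linearB -[scal _ _ _]/(s *: q0 (c - d)) scal_q0 => /eqP/q0p h.
  by apply/eqP; rewrite -subr_eq0 -linearB; apply/eqP/q0p; exact: colon_max h.
have [Z [r ir]] := coker_exists ii; have [_ _ rs] := ir.
have eZ : ext0 g Z.
  apply: (ext0_proper_quot rs ps).
  suff -> : q0 s = scal Y0 s (q0 1) by rewrite (ses0 ir).
  by rewrite -[RHS]/(s *: q0 1) scal_q0 mulr1.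
have [phi phiE] := scal_lift P s.
have [|t -> ct] := les_mid_elt ir (phi := phi) eZ cf.
  by apply: cob_ext cfs => x; rewrite phiE linearZ mulrC.
by apply: cob_ext ct => x; rewrite mulr1.
Qed.

Variable N : lmodType R.
Hypothesis fN : fin_gen N.
Hypothesis IE : forall a, I a <-> forall x : N, a *: x = 0.
Hypothesis V : forall j, (j < g)%N -> cyclic_ext0 I j.

(** Apply [rank_mod_prime] to a presentation matrix of N: a left null vector modulo p is a nonzero
    map to R/p, while a right inverse up to t outside p would put t in the annihilator I of N, which
    lies in p. *)
Lemma nonzero_hom : exists (h : {linear N -> Y0}) (x : N), h x <> 0.
Proof.
have [n [q qs]] := (fin_genP N).1 fN.
have kP : submod (fun c => q c = 0).
  by split=> [|a x y qx qy]; rewrite ?linear0 // linearP qx qy scaler0 addr0.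
have [m [gs gsP]] := noeth_fin_gen nR (rV_fin_gen R n) kP.
pose M : 'M[R]_(n, m) := \matrix_(k, l) gs l 0 k.
have [[x [[k xk] xP]]|[G [t [pt GE]]]] := rank_mod_prime M max_prime.
  have lin : linear (fun c : 'rV[R]_n => q0 (\sum_j c 0 j * x 0 j)).
    move=> a c d; rewrite -linearP; congr (q0 _).
    rewrite [X in _ = X + _]mulr_sumr -big_split; apply: eq_bigr => j _.
    by rewrite !mxE mulrDl mulrA.
  have [|h hE] := @factor_surj _ _ _ _ q (mklin lin) qs.
    move=> c /gsP[d ->]; rewrite linear_sum_eq big1 // => l _.
    have -> : mklin lin (gs l) = 0; last by rewrite scaler0.
    apply/q0p; suff -> : \sum_j gs l 0 j * x 0 j = (x *m M) 0 l by [].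
    by rewrite mxE; apply: eq_bigr => j _; rewrite mxE mulrC.
  exists h, (q (delta_mx 0 k)); rewrite hE => /q0p pk; apply: xk.
  suff <- : \sum_j (delta_mx 0 k : 'rV[R]_n) 0 j * x 0 j = x 0 k by [].
  rewrite (bigD1 k) //= !mxE !eqxx mul1r big1 ?addr0 // => j jk.
  by rewrite mxE (negPf jk) andbF mul0r.
case: pt; apply/Ip/IE => x; have [c <-] := qs x; rewrite -linearZ; apply/gsP.
exists (fun l => (c *m G^T) 0 l).
have GE' : G^T *m M^T = t%:M by rewrite -trmx_mul GE tr_scalar_mx.
rewrite -mul_mx_scalar -GE' mulmxA [LHS]mulmx_sum_row; apply: eq_bigr => l _.
by congr (_ *: _); apply/rowP => j; rewrite !mxE.
Qed.

(** Factor h as N -> J -> R/p, with kernel K. Since Ext^(g-1)(K, R) = 0, torsion passes from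
    Ext^g(N, R) to Ext^g(J, R), and on to Ext^g(R/p, R) because (R/p)/J is a proper quotient. That
    group is torsion-free, so it would vanish. *)
Lemma crit_not_null : ~ ext_null (fun s => ~ p s) g N.
Proof.
move=> eN; have Sm := prime_compl_mulcl max_prime.
have [h [x0 hx0]] := nonzero_hom.
have kP : submod (fun x => h x = 0).
  by split=> [|a x y qx qy]; rewrite ?linear0 // linearP qx qy scaler0 addr0.
have [J [qJ [qJs qJk]]] := quotient_exists kP.
have [K [k kq]] := kernel_exists qJs; have [ki _ _] := kq.
have [|i iE] := @factor_surj _ _ _ _ qJ h qJs; first by move=> x /qJk.
have ii : injective i.
  move=> u v; have [c <-] := qJs u; have [d <-] := qJs v; rewrite !iE => /eqP.
  rewrite -subr_eq0 -linearB => /eqP hcd.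
  by apply/eqP; rewrite -subr_eq0 -linearB; apply/eqP/qJk.
have eJ : ext_null (fun s => ~ p s) g J.
  case: g V eN => [|g'] V' eN; first exact: (les_right0 kq eN).
  apply: (les_right kq Sm eN); apply: ext0_null => //.
  apply: (cyclic_ext0_fg (V' g' (leqnn _))); first exact: sub_fin_gen nR fN ki.
  by move=> a Ia y; apply: ki; rewrite linearZ linear0; exact: (IE a).1.
have [Z [r ir]] := coker_exists ii; have [_ _ rs] := ir.
have eZ : ext0 g Z.
  have [a aE] := q0s (h x0).
  apply: (ext0_proper_quot rs (a := a)).
    by move=> /q0p; rewrite aE.
  by rewrite aE -iE (ses0 ir).
have eY : ext_null (fun s => ~ p s) g Y0.
  by apply: (les_mid ir Sm eJ); exact: ext0_null.
apply: Y0n; apply/(ext0P g (std_resolution Y0)) => f cf.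
have [s ps cs] := eY (std_resolution Y0) f cf.
exact: compl_torsionfree ps cf cs.
Qed.

Lemma crit_lt j : (j < g)%N -> ext0 j N.
Proof. by move=> jg; apply: (cyclic_ext0_fg (V jg) fN) => a /IE. Qed.

Lemma crit_next k : tcr_res k N -> ext_null (fun s => ~ p s) g.+1 N.
Proof.
move=> /tcr_approx[H [G [i [q [iq fH tG]]]]].
have Sm := prime_compl_mulcl max_prime.
apply: (les_left iq Sm); last first.
  by apply: ext0_null => //; have [e _] := tcr_unfold tG; exact: e.
pose P := std_resolution Y0.
have [f cf nf] : exists2 f : {linear P g -> R^o}, coc f & ~ cob f.
  apply: contrapT => H1; apply: Y0n; apply/(ext0P g P) => f cf.
  by apply: contrapT => nf; apply: H1; exists f.
apply: (@finite_res_ext R p max_prime Y0 q0 q0s q0p g P f cf _ _ k 0 H) => //.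
  (* By torsion-freeness the annihilator of the nonzero class of f lies in p. *)
  by move=> s cs; apply: contrapT => ps; apply: nf; exact: compl_torsionfree cs.
move=> j jg; apply/(ext0P j P); apply: (V jg pI Ip q0s q0p).
Qed.
End Maximal.

Lemma ext_dichotomy N k : fin_gen N -> tcr_res k N ->
  (forall j, ext0 j N) \/ exists g p, [/\ prime_pred p, forall j, (j < g)%N -> ext0 j N,
     ~ ext_null (fun s => ~ p s) g N & ext_null (fun s => ~ p s) g.+1 N].
Proof.
move=> fN tN; pose I a := forall x : N, a *: x = 0.
have [Vall|] := pselect (forall j, cyclic_ext0 I j).
  by left=> j; apply: (cyclic_ext0_fg (Vall j)).
move=> /existsNP[j0 Vj0]; right.
have exg : exists j, `[< ~ cyclic_ext0 I j >] by exists j0; apply/asboolP.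
case: (ex_minnP exg) => g /asboolP Vg ming.
have V j : (j < g)%N -> cyclic_ext0 I j.
  by move=> jg; apply: contrapT => /asboolP/ming; rewrite leqNgt jg.
pose F (a : R -> Prop) := [/\ ideal_pred a, forall x, I x -> a x &
  ~ (forall Y (q : {linear R^o -> Y}), surj_map q ->
  (forall x, q x = 0 <-> a x) -> ext0 g Y)].
have [||p [pI Ip pF] maxF] := @ideal_max R F nR.
- by move=> a [].
- apply: contrapT => H; apply: Vg => a aI Ia Y q qs qa.
  by apply: contrapT => nY; apply: H; exists a; split=> // /(_ Y q qs qa).
have [Y0 [q0 [q0s q0p Y0n]]] : exists Y0 (q0 : {linear R^o -> Y0}),
    [/\ surj_map q0, forall x, q0 x = 0 <-> p x & ~ ext0 g Y0].
  apply: contrapT => H; apply: pF => Y q qs qp; apply: contrapT => nY.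
  by apply: H; exists Y, q.
have maxp b : ideal_pred b -> (forall x, p x -> b x) ->
    (exists x, b x /\ ~ p x) -> forall Y (q : {linear R^o -> Y}), surj_map q ->
    (forall x, q x = 0 <-> b x) -> ext0 g Y.
  move=> bI pb [x [bx px]] Y q qs qb; apply: contrapT => nY; apply: px.
  apply: (maxF b) bx => //; split=> //; first by move=> y /Ip; exact: pb.
  by move=> /(_ Y q qs qb).
exists g, p; split.
- exact: (max_prime pI maxp q0s q0p Y0n).
- by move=> j; exact: (crit_lt fN _ V).
- exact: (crit_not_null pI Ip maxp q0s q0p Y0n fN _ V).
- exact: (crit_next pI Ip maxp q0s q0p Y0n V tN).
Qed.
End Dichotomy.

(** * Symbols and filtrations *)

Section GradedLifts.
Variables (V : zmodType) (F : int -> subgrp V).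
Hypothesis Fincr : forall p x, F (p - 1) x -> F p x.

(** Computations in the graded object are done on representatives, one degree at a time; by
    [lift_at_ext] two elements agree once they share a representative in each degree. *)
Definition lift_at (a : grd F) q x := F q x /\ a q = sq_class (F q) (F (q - 1)) x.

Lemma lift_at_rep (a : grd F) q : lift_at a q (sq_rep (a q)).
Proof. by split; [exact: sq_repP|rewrite sq_repK]. Qed.

Lemma lift_at_add (a b : grd F) q x y : lift_at a q x -> lift_at b q y ->
  lift_at (a + b) q (x + y).
Proof.
move=> [Fx ax] [Fy ay]; split; first exact: sgD.
by rewrite grdDE ax ay sq_classD.
Qed.

Lemma lift_at0 q : lift_at 0 q 0.
Proof. by split; [exact: sg0|rewrite sq_class0]. Qed.

Lemma lift_at_sum I (r : seq I) (P : pred I) (a : I -> grd F) x q :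
  (forall i, P i -> lift_at (a i) q (x i)) ->
  lift_at (\sum_(i <- r | P i) a i) q (\sum_(i <- r | P i) x i).
Proof.
move=> h; elim/big_rec2: _ => [|i y1 y2 Pi IH]; first exact: lift_at0.
by apply: lift_at_add => //; exact: h.
Qed.

Lemma lift_at_sum0 I (r : seq I) (P : pred I) (a : I -> grd F) q :
  (forall i, P i -> lift_at (a i) q 0) -> lift_at (\sum_(i <- r | P i) a i) q 0.
Proof.
move=> h; elim/big_ind: _ => [|x y hx hy|//]; first exact: lift_at0.
by rewrite -[X in lift_at _ _ X]addr0; exact: lift_at_add.
Qed.

Lemma lift_at_eq (a : grd F) q x y : lift_at a q x -> lift_at a q y -> F (q - 1) (x - y).
Proof. by move=> [Fx ax] [Fy ay]; apply: (sq_class_eqP Fx Fy); rewrite -ax -ay. Qed.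

Lemma lift_at_mod (a : grd F) q x y : lift_at a q x -> F (q - 1) (x - y) -> lift_at a q y.
Proof.
move=> [Fx ax] Fxy; have Fy : F q y.
  by rewrite -(subKr x y); apply: sgB => //; exact: Fincr.
by split=> //; rewrite ax; exact: sq_class_eq.
Qed.

Lemma lift_at_hom p x : F p x -> lift_at (gr_hom F p x) p x.
Proof. by move=> Fx; split=> //; rewrite gr_homE eqxx. Qed.

Lemma lift_at_hom_neq p q x : q != p -> lift_at (gr_hom F p x) q 0.
Proof.
by move=> /negPf qp; split; [exact: sg0|rewrite gr_homE qp sq_class0].
Qed.

Lemma lift_at_ext (a b : grd F) : (forall q, exists x, lift_at a q x /\ lift_at b q x) ->
  a = b.
Proof. by move=> h; apply: grdP => q; have [x [[_ ->] [_ ->]]] := h q. Qed.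

Lemma grd_decomp (a : grd F) : exists s : seq int, [/\ uniq s,
  forall q, q \notin s -> a q = 0 & a = \sum_(q <- s) gr_hom F q (sq_rep (a q))].
Proof.
have [s0 s0E] : exists s : seq int, [set i | a i != 0] = [set` s].
  by have /finite_seqP := grd_finite a.
have a0 q : q \notin undup s0 -> a q = 0.
  rewrite mem_undup => qs; apply/eqP; apply: contraNT qs => aq.
  by have : [set i | a i != 0] q by []; rewrite s0E.
exists (undup s0); split=> //; first exact: undup_uniq.
apply: lift_at_ext => q; exists (sq_rep (a q)); split; first exact: lift_at_rep.
have [qs|qs] := boolP (q \in undup s0); last first.
  apply: (lift_at_mod (x := 0)); last first.
    apply: sq_class_eqP; [exact: sg0|exact: sq_repP|].
    by rewrite sq_repK (a0 _ qs) sq_class0.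
  rewrite big_seq; apply: lift_at_sum0 => r rs; apply: lift_at_hom_neq.
  by apply: contraNneq qs => ->.
rewrite (bigD1_seq q) ?undup_uniq //= -[sq_rep _ in X in lift_at _ _ X]addr0.
apply: lift_at_add; first by apply: lift_at_hom; exact: sq_repP.
by apply: lift_at_sum0 => r rq; apply: lift_at_hom_neq; rewrite eq_sym.
Qed.
End GradedLifts.

Section ProductLifts.
Variables (U V W : zmodType) (b : U -> V -> W).
Variables (FU : int -> subgrp U) (FV : int -> subgrp V) (FW : int -> subgrp W).
Hypothesis bDl : forall x y z, b (x + y) z = b x z + b y z.
Hypothesis bDr : forall x y z, b x (y + z) = b x y + b x z.
Hypothesis Fb : forall p q x y, FU p x -> FV q y -> FW (p + q) (b x y).
Hypothesis FUi : forall p x, FU (p - 1) x -> FU p x.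
Hypothesis FVi : forall p x, FV (p - 1) x -> FV p x.
Hypothesis FWi : forall p x, FW (p - 1) x -> FW p x.

Let mul := gr_mul bDl bDr Fb.

Let bBl x y z : b (x - y) z = b x z - b y z.
Proof. by apply: (addIr (b y z)); rewrite -bDl !subrK. Qed.
Let bBr x y z : b x (y - z) = b x y - b x z.
Proof. by apply: (addIr (b x z)); rewrite -bDr !subrK. Qed.

Let mul_suml I (r : seq I) (a : I -> grd FU) m :
  mul (\sum_(i <- r) a i) m = \sum_(i <- r) mul (a i) m.
Proof.
elim: r => [|i r IH]; first by rewrite !big_nil /mul gr_mul0l.
by rewrite !big_cons -IH /mul gr_mulDl.
Qed.
Let mul_sumr I (r : seq I) a (m : I -> grd FV) :
  mul a (\sum_(i <- r) m i) = \sum_(i <- r) mul a (m i).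
Proof.
elim: r => [|i r IH]; first by rewrite !big_nil /mul gr_mul0r.
by rewrite !big_cons -IH /mul gr_mulDr.
Qed.

(** One factor is homogeneous, so only one term of the convolution contributes to degree t + q. *)
Lemma lift_at_mul_homl t u (m : grd FV) q x : FU t u -> lift_at m q x ->
  lift_at (mul (gr_hom FU t u) m) (t + q) (b u x).
Proof.
move=> Fu lx; apply: (lift_at_mod FWi (x := b u (sq_rep (m q)))); last first.
  rewrite -bBr -addrA; apply: Fb => //.
  exact: (lift_at_eq (lift_at_rep _ _) lx).
have [s [us s0 mE]] := grd_decomp FVi m.
rewrite {1}mE mul_sumr.
have hE r : mul (gr_hom FU t u) (gr_hom FV r (sq_rep (m r))) =
    gr_hom FW (t + r) (b u (sq_rep (m r))).
  by rewrite /mul gr_mul_hom //; exact: sq_repP.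
have FWb : FW (t + q) (b u (sq_rep (m q))) by apply: Fb => //; exact: sq_repP.
have [qs|qs] := boolP (q \in s).
  rewrite (bigD1_seq q) //= -[b _ _ in X in lift_at _ _ X]addr0.
  apply: lift_at_add; first by rewrite hE; exact: lift_at_hom.
  apply: lift_at_sum0 => r rq; rewrite hE; apply: lift_at_hom_neq.
  by rewrite (inj_eq (addrI t)) eq_sym.
apply: (lift_at_mod FWi (x := 0)); last first.
  rewrite sub0r; apply: sgN; rewrite -addrA; apply: Fb => //.
  rewrite -[sq_rep _]subr0; apply: sq_class_eqP; [exact: sq_repP|exact: sg0|].
  by rewrite sq_repK (s0 _ qs) sq_class0.
rewrite big_seq; apply: lift_at_sum0 => r rs; rewrite hE; apply: lift_at_hom_neq.
by rewrite (inj_eq (addrI t)); apply: contraNneq qs => ->.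
Qed.

Lemma lift_at_mul_homr t u (m : grd FU) q x : FV t u -> lift_at m q x ->
  lift_at (mul m (gr_hom FV t u)) (q + t) (b x u).
Proof.
move=> Fu lx; apply: (lift_at_mod FWi (x := b (sq_rep (m q)) u)); last first.
  rewrite -bBl addrAC; apply: Fb => //.
  exact: (lift_at_eq (lift_at_rep _ _) lx).
have [s [us s0 mE]] := grd_decomp FUi m.
rewrite {1}mE mul_suml.
have hE r : mul (gr_hom FU r (sq_rep (m r))) (gr_hom FV t u) =
    gr_hom FW (r + t) (b (sq_rep (m r)) u).
  by rewrite /mul gr_mul_hom //; exact: sq_repP.
have FWb : FW (q + t) (b (sq_rep (m q)) u) by apply: Fb => //; exact: sq_repP.
have [qs|qs] := boolP (q \in s).
  rewrite (bigD1_seq q) //= -[b _ _ in X in lift_at _ _ X]addr0.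
  apply: lift_at_add; first by rewrite hE; exact: lift_at_hom.
  apply: lift_at_sum0 => r rq; rewrite hE; apply: lift_at_hom_neq.
  by rewrite (inj_eq (addIr t)) eq_sym.
apply: (lift_at_mod FWi (x := 0)); last first.
  rewrite sub0r; apply: sgN; rewrite addrAC; apply: Fb => //.
  rewrite -[sq_rep _]subr0; apply: sq_class_eqP; [exact: sq_repP|exact: sg0|].
  by rewrite sq_repK (s0 _ qs) sq_class0.
rewrite big_seq; apply: lift_at_sum0 => r rs; rewrite hE; apply: lift_at_hom_neq.
by rewrite (inj_eq (addIr t)); apply: contraNneq qs => ->.
Qed.
End ProductLifts.

Section GradedMatrices.
Variables (L : pzRingType) (FL : ring_filtration L).
Local Notation A := (gr_ring FL).
Local Notation Fz := (rfz FL).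
Local Notation sig := (gr_hom Fz).

Lemma rfz_incr p x : Fz (p - 1) x -> Fz p x.
Proof.
case: p => [[|p]|p]; last by case: p.
  by move=> /= ->; exact: sg0.
have -> : Posz p.+1 - 1 = p by rewrite -addn1 PoszD addrK.
exact: rf_incr.
Qed.

Lemma rfz_le p q x : p <= q -> Fz p x -> Fz q x.
Proof.
move=> pq; have [n ->] : exists n : nat, q = p + n%:Z.
  by exists `|q - p|%N; lia.
elim: n => [|n IH] Fx; first by rewrite addr0.
by apply: rfz_incr; rewrite intS [1 + _]addrC addrA addrK; exact: IH.
Qed.

Lemma rfz_neg p x : p < 0 -> Fz p x -> x = 0.
Proof. by case: p. Qed.

Lemma rfz_exh x : exists p : nat, Fz p x.
Proof. exact: rf_exh. Qed.

(** [e] encodes the degrees of the basis elements; [q] is the degree of the matrix as a filtered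
    map. *)
Definition mxF m n (e : 'I_m -> 'I_n -> int) q (X : 'M[L]_(m, n)) :=
  forall i j, Fz (q + e i j) (X i j).
Definition symb m n (e : 'I_m -> 'I_n -> int) q (X : 'M[L]_(m, n)) : 'M[A]_(m, n) :=
  \matrix_(i, j) (sig (q + e i j) (X i j) : A).
Definition mlift m n (e : 'I_m -> 'I_n -> int) q (Y : 'M[A]_(m, n)) (X : 'M[L]_(m, n)) :=
  forall i j, lift_at (Y i j : grd Fz) (q + e i j) (X i j).

Section OneShape.
Variables (m n : nat) (e : 'I_m -> 'I_n -> int).
Implicit Types (X : 'M[L]_(m, n)) (Y : 'M[A]_(m, n)).

Lemma mxF0 q : mxF e q 0. Proof. by move=> i j; rewrite mxE; exact: sg0. Qed.
Lemma mxFD q X X' : mxF e q X -> mxF e q X' -> mxF e q (X + X').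
Proof. by move=> h h' i j; rewrite mxE; exact: sgD. Qed.
Lemma mxFN q X : mxF e q X -> mxF e q (- X).
Proof. by move=> h i j; rewrite mxE; exact: sgN. Qed.
Lemma mxFB q X X' : mxF e q X -> mxF e q X' -> mxF e q (X - X').
Proof. by move=> h h'; apply: mxFD => //; exact: mxFN. Qed.
Lemma mxF_le q q' X : q <= q' -> mxF e q X -> mxF e q' X.
Proof. by move=> qq h i j; apply: rfz_le (h i j); rewrite lerD2r. Qed.

Let bnd := \sum_i \sum_j `|e i j|%N.
Let bndP i j : (`|e i j| <= bnd)%N.
Proof.
rewrite /bnd (bigD1 i) //=; apply: leq_trans (leq_addr _ _).
by rewrite (bigD1 j) //=; exact: leq_addr.
Qed.

(** Below some degree every entry has negative degree, as there are finitely many shifts; this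
    starts the inductions on degree. *)
Lemma mxF_bounded : exists B : int, forall q X, q <= B -> mxF e q X -> X = 0.
Proof.
exists (- (bnd.+1)%:Z) => q X qB h; apply/matrixP => i j; rewrite mxE.
apply: rfz_neg (h i j); have := bndP i j; rewrite -lez_nat abszE => h1.
have := ler_norm (e i j); lia.
Qed.

Lemma mxF_exh X : exists N : nat, forall q : int, N%:Z <= q -> mxF e q X.
Proof.
pose N i j := projT1 (cid (rfz_exh (X i j))).
have NP i j : Fz (N i j) (X i j) by exact: projT2 (cid (rfz_exh (X i j))).
exists (bnd + \sum_i \sum_j N i j)%N => q qN i j; apply: rfz_le (NP i j).
have : (N i j <= \sum_i \sum_j N i j)%N.
  rewrite (bigD1 i) //=; apply: leq_trans (leq_addr _ _).
  by rewrite (bigD1 j) //=; exact: leq_addr.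
have := bndP i j; rewrite -!lez_nat abszE => h1 h2.
have := ler_norm (- e i j); rewrite normrN; lia.
Qed.

Lemma mlift_rep q Y : exists X, mlift e q Y X.
Proof.
exists (\matrix_(i, j) sq_rep ((Y i j : grd Fz) (q + e i j))) => i j.
by rewrite mxE; exact: lift_at_rep.
Qed.

Lemma mliftF q Y X : mlift e q Y X -> mxF e q X.
Proof. by move=> h i j; case: (h i j). Qed.

Lemma mlift_add q Y X Y' X' : mlift e q Y X -> mlift e q Y' X' -> mlift e q (Y + Y') (X + X').
Proof. by move=> h h' i j; rewrite !mxE; exact: lift_at_add. Qed.

Lemma mlift0 q : mlift e q 0 0.
Proof. by move=> i j; rewrite !mxE; exact: lift_at0. Qed.

Lemma mlift_eq q Y X X' : mlift e q Y X -> mlift e q Y X' -> mxF e (q - 1) (X - X').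
Proof.
by move=> h h' i j; rewrite !mxE addrAC; exact: lift_at_eq (h i j) (h' i j).
Qed.

Lemma mlift_mod q Y X X' : mlift e q Y X -> mxF e (q - 1) (X - X') -> mlift e q Y X'.
Proof.
move=> h h' i j; apply: (lift_at_mod rfz_incr (h i j)).
by have := h' i j; rewrite !mxE addrAC.
Qed.

Lemma mlift_symb q X : mxF e q X -> mlift e q (symb e q X) X.
Proof. by move=> h i j; rewrite mxE; exact: lift_at_hom. Qed.

Lemma mlift_symb_neq q q' X : q' != q -> mlift e q' (symb e q X) 0.
Proof.
by move=> qq i j; rewrite !mxE; apply: lift_at_hom_neq; rewrite (inj_eq (addIr _)).
Qed.

Lemma mlift_ext Y Y' : (forall q, exists X, mlift e q Y X /\ mlift e q Y' X) -> Y = Y'.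
Proof.
move=> h; apply/matrixP => i j; apply: lift_at_ext => q.
have [X [h1 h2]] := h (q - e i j); exists (X i j).
by have := h1 i j; have := h2 i j; rewrite subrK.
Qed.

Lemma symb_eq q Y X : mlift e q Y X -> (forall q', q' != q -> mlift e q' Y 0) ->
  Y = symb e q X.
Proof.
move=> h h'; apply: mlift_ext => q'; have [->|qq] := eqVneq q' q.
  by exists X; split=> //; apply: mlift_symb; exact: mliftF h.
by exists 0; split; [exact: h'|exact: mlift_symb_neq].
Qed.

Lemma symb_cong q X X' : mxF e q X -> mxF e (q - 1) (X - X') -> symb e q X = symb e q X'.
Proof.
move=> h h'; apply: symb_eq; last by move=> q' qq; exact: mlift_symb_neq.
by apply: mlift_mod h'; exact: mlift_symb.
Qed.

Lemma symb_sub0 q X : mxF e (q - 1) X -> symb e q X = 0.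
Proof.
move=> h; apply/esym/symb_eq; last by move=> q' _; exact: mlift0.
by apply: mlift_mod (mlift0 q) _; rewrite sub0r; exact: mxFN.
Qed.

(** Reduces additive statements on Y to its homogeneous components, written as symbols of the chosen
    representatives. *)
Lemma mx_hom_ind (P : 'M[A]_(m, n) -> Prop) Y (X : int -> 'M[L]_(m, n)) :
  (forall q, mlift e q Y (X q)) -> P 0 -> (forall a b, P a -> P b -> P (a + b)) ->
  (forall q, P (symb e q (X q))) -> P Y.
Proof.
move=> lX P0 PD Ps.
have supp i j : exists s : seq int, forall q, q \notin s -> (Y i j : grd Fz) (q + e i j) = 0.
  have [s [_ s0 _]] := grd_decomp rfz_incr (Y i j : grd Fz).
  exists [seq q - e i j | q <- s] => q qs; apply: s0; apply: contra qs => qs.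
  by apply/mapP; exists (q + e i j) => //; rewrite addrK.
pose s i j := projT1 (cid (supp i j)).
have s0 i j q : q \notin s i j -> (Y i j : grd Fz) (q + e i j) = 0.
  exact: projT2 (cid (supp i j)) q.
pose T := undup (flatten [seq s x.1 x.2 | x <- enum {: 'I_m * 'I_n}]).
have T0 i j q : q \notin T -> (Y i j : grd Fz) (q + e i j) = 0.
  move=> qT; apply: s0; apply: contra qT => qs; rewrite mem_undup.
  by apply/flattenP; exists (s i j) => //; apply/mapP; exists (i, j); rewrite ?mem_enum.
suff -> : Y = \sum_(q <- T) symb e q (X q).
  by apply: big_ind => // q _; exact: Ps.
have sumlift I (r : seq I) (Q : pred I) (Z : I -> 'M[A]_(m, n)) q :
    (forall k, Q k -> mlift e q (Z k) 0) -> mlift e q (\sum_(k <- r | Q k) Z k) 0.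
  move=> h; elim/big_ind: _ => [|a b ha hb|//]; first exact: mlift0.
  by rewrite -[X in mlift _ _ _ X]addr0; exact: mlift_add.
apply: mlift_ext => q; exists (X q); split=> //.
have [qT|qT] := boolP (q \in T).
  rewrite (bigD1_seq q) ?undup_uniq //= -[X q in X in mlift _ _ _ X]addr0.
  apply: mlift_add; first by apply: mlift_symb; exact: mliftF (lX q).
  by apply: sumlift => r rq; apply: mlift_symb_neq; rewrite eq_sym.
apply: (mlift_mod (X := 0)).
  rewrite big_seq; apply: sumlift => r rT; apply: mlift_symb_neq.
  by apply: contraNneq qT => ->.
apply: (mlift_eq (Y := Y)) (lX q) => i j; split; first by rewrite mxE; exact: sg0.
by rewrite (T0 _ _ _ qT) mxE sq_class0.
Qed.
End OneShape.

Section Products.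
Variables (m n k : nat) (e1 : 'I_m -> 'I_n -> int) (e2 : 'I_n -> 'I_k -> int).
Variable e : 'I_m -> 'I_k -> int.
Hypothesis eE : forall i j l, e1 i j + e2 j l = e i l.

Lemma mxF_mul q t X Y : mxF e1 q X -> mxF e2 t Y -> mxF e (q + t) (X *m Y).
Proof.
move=> hX hY i l; rewrite mxE; elim/big_ind: _ => [|u v hu hv|j _].
- exact: sg0.
- exact: sgD.
by rewrite -(eE i j l) addrACA; apply: rfzM.
Qed.

Lemma mlift_mull q t X (Yb : 'M[A]_(n, k)) Y : mxF e1 t X -> mlift e2 q Yb Y ->
  mlift e (t + q) (symb e1 t X *m Yb) (X *m Y).
Proof.
move=> hX hY i l; rewrite !mxE; apply: lift_at_sum => j _.
rewrite mxE -(eE i j l) addrACA.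
exact: (lift_at_mul_homl _ _ _ rfz_incr rfz_incr).
Qed.

Lemma mlift_mulr q t (Xb : 'M[A]_(m, n)) X Y : mlift e1 q Xb X -> mxF e2 t Y ->
  mlift e (q + t) (Xb *m symb e2 t Y) (X *m Y).
Proof.
move=> hX hY i l; rewrite !mxE; apply: lift_at_sum => j _.
rewrite [symb _ _ _ _ _]mxE -(eE i j l) addrACA.
exact: (lift_at_mul_homr _ _ _ rfz_incr rfz_incr).
Qed.

Lemma symb_mul q t X Y : mxF e1 q X -> mxF e2 t Y ->
  symb e1 q X *m symb e2 t Y = symb e (q + t) (X *m Y).
Proof.
move=> hX hY; apply: symb_eq; first by apply: mlift_mull => //; exact: mlift_symb.
move=> q' qq; rewrite -(mulmx0 _ X) -[q'](subrKC q); apply: mlift_mull => //.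
by apply: mlift_symb_neq; rewrite subr_eq addrC.
Qed.
End Products.
End GradedMatrices.

(** * Filtered free resolutions and their symbols *)

Section StrictGenerators.
Variables (L : pzRingType) (FL : ring_filtration L).
Local Notation A := (gr_ring FL).
Local Notation Fz := (rfz FL).
Local Notation sig := (gr_hom Fz).

(** [sc] is abstract because rows are scaled on the left, while the images D z of columns are stable
    under scaling on the right. *)
Lemma graded_submod m n (e : 'I_m -> 'I_n -> int) (Q : int -> 'M[L]_(m, n) -> Prop)
    (sc : L -> 'M[L]_(m, n) -> 'M[L]_(m, n)) :
  (forall q, Q q 0) -> (forall q X X', Q q X -> Q q X' -> Q q (X + X')) ->
  (forall t u q X, Fz t u -> Q q X -> Q (q + t) (sc u X)) ->
  (forall t u q (Y : 'M[A]_(m, n)) X, Fz t u -> mlift e q Y X ->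
     mlift e (q + t) ((sig t u : A) *: Y) (sc u X)) ->
  submod (fun Y : 'M[A]_(m, n) => forall q, exists X, Q q X /\ mlift e q Y X).
Proof.
move=> Q0 QD Qs ls.
pose U (Y : 'M[A]_(m, n)) := forall q, exists X, Q q X /\ mlift e q Y X.
have U0 : U 0 by move=> q; exists 0; split; [exact: Q0|exact: mlift0].
have UD Y Y' : U Y -> U Y' -> U (Y + Y').
  move=> h h' q; have [X [QX lX]] := h q; have [X' [QX' lX']] := h' q.
  by exists (X + X'); split; [exact: QD|exact: mlift_add].
split=> // a Y Y' UY; apply: (UD).
elim/(@grd_ind _ Fz): (a : grd Fz) => [|b c hb hc|t u Fu].
- by have := U0; rewrite -(scale0r Y).
- by have := UD _ _ hb hc; rewrite -scalerDl.
- move=> q; have [X [QX lX]] := UY (q - t); exists (sc u X).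
  by rewrite -[q](subrK t); split; [exact: Qs|exact: ls].
Qed.

Lemma mlift_scalel m n (e : 'I_m -> 'I_n -> int) t u q (Y : 'M[A]_(m, n)) X :
  Fz t u -> mlift e q Y X -> mlift e (q + t) ((sig t u : A) *: Y) (u *: X).
Proof.
move=> Fu lX i j; rewrite !mxE [q + t]addrC -addrA.
exact: (lift_at_mul_homl _ _ _ (@rfz_incr _ FL) (@rfz_incr _ FL)).
Qed.

(** Conventions for a free module whose k-th basis vector has degree [ps k]: rows are its elements,
    columns the functionals on it, and [emx] is the shape of a map between two such modules. *)
Definition erow r (ps : 'I_r -> int) : 'I_1 -> 'I_r -> int := fun _ k => - ps k.
Definition ecol r (ps : 'I_r -> int) : 'I_r -> 'I_1 -> int := fun k _ => ps k.
Definition emx r' r (ps' : 'I_r' -> int) (ps : 'I_r -> int) : 'I_r' -> 'I_r -> int :=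
  fun i k => ps' i - ps k.

Lemma erow_emx r' r (ps' : 'I_r' -> int) (ps : 'I_r -> int) i j l :
  erow ps' i j + emx ps' ps j l = erow ps i l.
Proof. exact: addKr. Qed.

Lemma emx_ecol r' r (ps' : 'I_r' -> int) (ps : 'I_r -> int) i j l :
  emx ps' ps i j + ecol ps j l = ecol ps' i l.
Proof. exact: subrK. Qed.

Section Rows.
Variables (r : nat) (ps : 'I_r -> int).
Local Notation e := (erow ps).
Implicit Types (gs : seq (int * 'rV[L]_r)) (Y : 'rV[A]_r) (X : 'rV[L]_r).

Fixpoint gr_span gs Y := match gs with
  | [::] => Y = 0
  | g :: gs => exists (a : A) Y', gr_span gs Y' /\ Y = a *: symb FL e g.1 g.2 + Y'
  end.

Fixpoint fil_span q gs X := match gs with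
  | [::] => X = 0
  | g :: gs => exists (a : L) X', [/\ Fz (q - g.1) a, fil_span q gs X' & X = a *: g.2 + X']
  end.

Lemma gr_span_submod gs : submod (gr_span gs).
Proof.
elim: gs => [|g gs [s0 sP]] /=; first by split=> // a x y -> ->; rewrite scaler0 addr0.
split; first by exists 0, 0; split=> //; rewrite scale0r addr0.
move=> a x y [b [x' [sx ->]]] [c [y' [sy ->]]].
exists (a * b + c), (a *: x' + y'); split; first exact: sP.
by rewrite scalerDl scalerDr scalerA addrACA.
Qed.

Lemma gr_span_catl gs gs' Y : gr_span gs Y -> gr_span (gs ++ gs') Y.
Proof.
elim: gs Y => [|g gs IH] Y /=; first by move=> ->; exact: (gr_span_submod _).1.
by move=> [a [Y' [sY ->]]]; exists a, Y'; split=> //; exact: IH.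
Qed.

Lemma gr_span_catr gs gs' Y : gr_span gs' Y -> gr_span (gs ++ gs') Y.
Proof.
elim: gs Y => [|g gs IH] Y //= sY; exists 0, Y; split; first exact: IH.
by rewrite scale0r add0r.
Qed.

Lemma gr_span_lift gs q Y : (forall g, g \in gs -> mxF FL e g.1 g.2) -> gr_span gs Y ->
  exists X, fil_span q gs X /\ mlift e q Y X.
Proof.
elim: gs Y => [|g gs IH] Y hg /= => [->|[a [Y' [sY ->]]]].
  by exists 0; split=> //; exact: mlift0.
have [|X' [sX lX]] := IH Y' _ sY; first by move=> g' h; apply: hg; rewrite inE h orbT.
pose u := sq_rep ((a : grd Fz) (q - g.1)).
exists (u *: g.2 + X'); split; first by exists u, X'; split=> //; exact: sq_repP.
apply: mlift_add lX => i j; rewrite !mxE.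
have -> : q + e i j = (q - g.1) + (g.1 + e i j) by rewrite addrA subrK.
apply: (lift_at_mul_homr _ _ _ (@rfz_incr _ FL) (@rfz_incr _ FL)).
  by apply: hg; rewrite mem_head.
exact: lift_at_rep.
Qed.

Lemma fil_span_add q gs X X' : fil_span q gs X -> fil_span q gs X' -> fil_span q gs (X + X').
Proof.
elim: gs X X' => [|g gs IH] X X' /= => [-> ->|]; first by rewrite addr0.
move=> [a [Y [Fa sY ->]]] [b [Z [Fb sZ ->]]].
by exists (a + b), (Y + Z); split; [exact: sgD|exact: IH|rewrite scalerDl addrACA].
Qed.

Lemma fil_span_le q q' gs X : q <= q' -> fil_span q gs X -> fil_span q' gs X.
Proof.
move=> qq; elim: gs X => [|g gs IH] X //= [a [Y [Fa sY ->]]].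
by exists a, Y; split=> //; [apply: rfz_le Fa; rewrite lerD2r|exact: IH].
Qed.

Lemma fil_span_in q gs X (K : 'rV[L]_r -> Prop) : submod K ->
  (forall g, g \in gs -> K g.2) -> fil_span q gs X -> K X.
Proof.
move=> [K0 KP]; elim: gs X => [|g gs IH] X hg /= => [->//|[a [Y [_ sY ->]]]].
apply: KP; first by apply: hg; rewrite mem_head.
by apply: IH => // g' h; apply: hg; rewrite inE h orbT.
Qed.

Lemma fil_span_sum q gs X : fil_span q gs X -> exists c : nat -> L,
  (forall i, Fz (q - (nth (0, 0) gs i).1) (c i)) /\
  X = \sum_(i < size gs) c i *: (nth (0, 0) gs i).2.
Proof.
elim: gs X => [|g gs IH] X /= => [->|[a [Y [Fa /IH[c [Fc ->]] ->]]]].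
  by exists (fun=> 0); split=> [i|]; [exact: sg0|rewrite big_ord0].
exists (fun i => if i is j.+1 then c j else a); split; first by case.
by rewrite big_ord_recl.
Qed.

Hypothesis nA : noetherian A.

(** The symbols of K form a graded submodule of A^r, generated by finitely many symbols of elements
    of K. Subtracting a combination of these elements lowers the degree, and the filtration is
    bounded below, so they generate K with control of degrees. *)
Lemma strict_generators (K : 'rV[L]_r -> Prop) : submod K ->
  exists r' (ps' : 'I_r' -> int) (D : 'M[L]_(r', r)),
  [/\ forall i, K (row i D), mxF FL (emx ps' ps) 0 D &
      forall q X, K X -> mxF FL e q X -> exists y : 'rV_r',
        mxF FL (erow ps') q y /\ X = y *m D].
Proof.
move=> KP; pose U Y := forall q, exists X, K X /\ mlift e q Y X.
have UP : submod U.
  apply: (@graded_submod 1 r e (fun _ X => K X) (fun u X => u *: X)).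
  - by move=> _; exact: (submod0 KP).
  - by move=> _ X X'; exact: (submodD KP).
  - by move=> t u _ X _; exact: (submodZ KP).
  - by move=> t u q Y X; exact: mlift_scalel.
pose good gs := forall g, g \in gs -> K g.2 /\ mxF FL e g.1 g.2.
have good_cat gs gs' : good gs -> good gs' -> good (gs ++ gs').
  by move=> h h' g; rewrite mem_cat => /orP[/h|/h'].
have spanU Y : U Y -> exists gs, good gs /\ gr_span gs Y.
  move=> UY; pose X q := projT1 (cid (UY q)).
  have XP q : K (X q) /\ mlift e q Y (X q) by exact: projT2 (cid (UY q)).
  apply: (mx_hom_ind (P := fun Y => exists gs, good gs /\ gr_span gs Y) (e := e) (X := X)).
  - by move=> q; case: (XP q).
  - by exists [::].
  - move=> a b [gs [gg sa]] [gs' [gg' sb]]; exists (gs ++ gs'); split; first exact: good_cat.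
    by apply: (submodD (gr_span_submod _)); [exact: gr_span_catl|exact: gr_span_catr].
  - move=> q; exists [:: (q, X q)]; split.
      move=> g; rewrite inE => /eqP -> /=; split; first by case: (XP q).
      by have [_ /mliftF] := XP q.
    by exists 1, 0; split=> //; rewrite scale1r addr0.
have [n [g gP]] := noeth_fin_gen nA (rV_fin_gen A r) UP.
(* Arbitrary generators are replaced by their homogeneous components, which are symbols of elements
   of K with a given degree. *)
have [gs [gg gsP]] : exists gs, good gs /\ forall k, gr_span gs (g k).
  have gU k : U (g k) by exact: (gen_in gP).
  elim: n g gU {gP} => [|n IH] g gU; first by exists [::]; split=> // -[].
  have [gs [gg h]] := IH (fun k => g (lift ord0 k)) (fun k => gU _).
  have [gs' [gg' h']] := spanU _ (gU ord0).
  exists (gs' ++ gs); split; first exact: good_cat.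
  move=> k; case: (unliftP ord0 k) => [j ->|->]; first exact: gr_span_catr.
  exact: gr_span_catl.
have UgsP Y : U Y -> gr_span gs Y.
  move=> /gP[c ->]; apply: (submod_sum (gr_span_submod _)) => k _.
  exact: (submodZ (gr_span_submod _)).
have step q X : K X -> mxF FL e q X -> exists X', [/\ fil_span q gs X', K X' &
    mxF FL e (q - 1) (X - X')].
  move=> KX FX; have /UgsP sX : U (symb FL e q X).
    move=> q'; have [->|qq] := eqVneq q' q; first by exists X; split=> //; exact: mlift_symb.
    by exists 0; split; [exact: (submod0 KP)|exact: mlift_symb_neq].
  have [|X' [sX' lX']] := @gr_span_lift gs q _ _ sX; first by move=> g' /gg[].
  exists X'; split=> //; first by apply: fil_span_in sX' => // g' /gg[].
  by apply: mlift_eq lX'; exact: mlift_symb.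
have [B BP] := mxF_bounded FL e.
(* N counts the degrees above the bound B, at which only 0 is left. *)
have all (N : nat) : forall q X, q <= B + N%:Z -> K X -> mxF FL e q X -> fil_span q gs X.
  elim: N => [|N IH] q X.
    rewrite addr0 => qB KX /(BP _ _ qB) ->.
    by elim: (gs) => //= g' gs' s0; exists 0, 0; split=> //; [exact: sg0|rewrite scale0r addr0].
  move=> qB KX FX; have [X' [sX' KX' FX']] := step q X KX FX.
  rewrite -[X](subrKC X'); apply: fil_span_add => //.
  apply: (@fil_span_le (q - 1)); first by rewrite lerBlDr lerDl.
  apply: IH => //; last exact: (submodB KP).
  by rewrite lerBlDr -addrA -PoszD addn1.
exists (size gs), (fun i => (nth (0, 0) gs i).1), (\matrix_(i, k) (nth (0, 0) gs i).2 0 k).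
have rowE (i : 'I_(size gs)) : row i (\matrix_(i < size gs, k < r) (nth (0, 0) gs i).2 0 k) =
    (nth (0, 0) gs i).2 by apply/rowP => k; rewrite !mxE.
split.
- by move=> i; rewrite rowE; case: (gg _ (mem_nth (0, 0) (ltn_ord i))).
- move=> i k; rewrite mxE add0r.
  by case: (gg _ (mem_nth (0, 0) (ltn_ord i))) => _ h; have := h 0 k.
move=> q X KX FX.
have /fil_span_sum[c [Fc XE]] : fil_span q gs X.
  by apply: (all `|q - B|%N) => //; lia.
exists (\row_i c i); split; first by move=> i k; rewrite mxE; exact: Fc.
rewrite XE mulmx_sum_row; apply: eq_bigr => i _.
by rewrite rowE mxE.
Qed.
End Rows.
End StrictGenerators.

(** * Ext computed with matrices *)

Section MatrixResolution.
Variables (R : pzRingType) (X : lmodType R) (r : nat -> nat).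
Variables (D : forall n, 'M[R]_(r n.+1, r n)) (aug : {linear 'rV[R]_(r 0) -> X}).
Hypothesis aug_surj : surj_map aug.
Hypothesis aug_exact : forall x, aug x = 0 <-> exists y, y *m D 0 = x.
Hypothesis D_exact : forall n (x : 'rV_(r n.+1)), x *m D n = 0 <-> exists y, y *m D n.+1 = x.

Lemma mxd_linear n : linear (fun x : 'rV[R]_(r n.+1) => x *m D n : 'rV[R]_(r n)).
Proof. by move=> a x y; rewrite mulmxDl scalemxAl. Qed.

Definition mxres : resolution X :=
  @Resolution R X (fun n => 'rV[R]_(r n)) (fun n => mklin (@mxd_linear n)) aug
    (fun n => @rV_projective R (r n)) aug_surj aug_exact D_exact.

(* C^0 = 0, C^(n+1) = Hom(P_n, R): the group Ext^n lives in C^(n+1) *)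
Definition crank n := if n is k.+1 then r k else 0%N.
Definition cdiff n : 'M[R]_(crank n.+1, crank n) :=
  match n with 0 => 0 | k.+1 => D k end.

Lemma col_functional n (z : 'cV[R]_n) : linear (fun x : 'rV[R]_n => (x *m z) 0 0 : R^o).
Proof. by move=> a x y; rewrite mulmxDl -scalemxAl !mxE. Qed.

Lemma functional_col n (f : {linear 'rV[R]_n -> R^o}) x :
  f x = (x *m \col_k f (delta_mx 0 k)) 0 0.
Proof. by rewrite rv_expand mxE; apply: eq_bigr => k _; rewrite mxE. Qed.

Lemma row_col_eq n (z z' : 'cV[R]_n) : (forall x : 'rV_n, (x *m z) 0 0 = (x *m z') 0 0) -> z = z'.
Proof.
move=> h; apply/colP => k; have := h (delta_mx 0 k).
by rewrite -!rowE !mxE.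
Qed.

Definition mx_null (S : R -> Prop) n := forall z : 'cV[R]_(crank n.+1),
  cdiff n.+1 *m z = 0 -> exists2 s, S s & exists y, z *m s%:M = cdiff n *m y.

Lemma mul_col_scalar n (z : 'cV[R]_n) (s : R) (x : 'rV_n) :
  (x *m (z *m s%:M)) 0 0 = (x *m z) 0 0 * s.
Proof. by rewrite mulmxA mxE big_ord1 [s%:M _ _]mxE eqxx mulr1n. Qed.

Lemma mxres_nullP S n : nullP S mxres n <-> mx_null S n.
Proof.
have cE (z : 'cV[R]_(r n)) : coc (P := mxres) (mklin (col_functional z)) <->
    cdiff n.+1 *m z = 0.
  split=> [h|h x].
    by apply: row_col_eq => x; rewrite mulmxA mulmx0 [RHS]mxE; exact: (h x).
  by rewrite -[LHS]/((x *m D n *m z) 0 0) -mulmxA [D n *m z]h mulmx0 mxE.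
have bE (z : 'cV[R]_(r n)) s : cob (P := mxres) (n := n)
    (fun x => (x *m z) 0 0 * s : R^o) <-> exists y, z *m s%:M = cdiff n *m y.
  clear cE; case: n z => [|n] z /=.
    split=> [h|[y h] x].
      exists 0; apply: row_col_eq => x; rewrite mul_col_scalar mulmx0 mulmx0 [RHS]mxE.
      exact: h.
    by rewrite -mul_col_scalar h mul0mx mulmx0 mxE.
  split=> [[g gE]|[y h]].
    exists (\col_k g (delta_mx 0 k)); apply: row_col_eq => x.
    by rewrite mul_col_scalar gE functional_col mulmxA.
  exists (mklin (col_functional y)) => x.
  by rewrite -mul_col_scalar h -[RHS]/((x *m D n *m y) 0 0) mulmxA.
split=> [nP z zc|nP f cf].
  have [s Ss cs] := nP (mklin (col_functional z)) ((cE z).2 zc).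
  by exists s => //; apply/bE.
pose z : 'cV[R]_(r n) := \col_k (f : {linear 'rV_(r n) -> R^o}) (delta_mx 0 k).
have fE x : f x = (x *m z) 0 0 := functional_col f x.
have [|s Ss /bE cs] := nP z.
  by apply/cE => x; rewrite -[LHS]/((_ *m z) 0 0) -fE; exact: cf.
by exists s => //; apply: cob_ext cs => x; rewrite fE.
Qed.

Lemma mxres_ext_nullP S n : ext_null S n X <-> mx_null S n.
Proof.
split=> [e|h]; first by apply/mxres_nullP; exact: e.
by apply: (ext_nullI (P := mxres)); apply/mxres_nullP.
Qed.

Lemma mxres_ext0P n : ext0 n X <-> forall z : 'cV[R]_(crank n.+1),
  cdiff n.+1 *m z = 0 -> exists y, z = cdiff n *m y.
Proof.
rewrite /ext0 mxres_ext_nullP; split=> h z /h; last first.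
  by move=> [y yE]; exists 1 => //; exists y; rewrite mulmx1.
by move=> [s -> [y]]; rewrite mulmx1; exists y.
Qed.
End MatrixResolution.

Section FilteredResolution.
Variables (L : pzRingType) (FL : ring_filtration L) (M : lmodType L).
Variable FM : mod_filtration FL M.
Local Notation A := (gr_ring FL).
Local Notation Fz := (rfz FL).
Local Notation sig := (gr_hom Fz).

(** Exactness is required with control of degrees: this strictness makes the complex of symbols
    exact as well. *)
Record filtered_resolution := FilteredResolution {
  fr_rank : nat -> nat;
  fr_deg : forall n, 'I_(fr_rank n) -> int;
  fr_d : forall n, 'M[L]_(fr_rank n.+1, fr_rank n);
  fr_gen : 'I_(fr_rank 0) -> M;
  fr_genP : forall q x, FM q x <-> exists a : 'rV_(fr_rank 0),
    mxF FL (erow (@fr_deg 0)) q a /\ x = rvlin fr_gen a;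
  fr_dF : forall n, mxF FL (emx (@fr_deg n.+1) (@fr_deg n)) 0 (fr_d n);
  fr_aug_d : forall y, rvlin fr_gen (y *m fr_d 0) = 0;
  fr_dd : forall n, fr_d n.+1 *m fr_d n = 0;
  fr_exact0 : forall q x, rvlin fr_gen x = 0 -> mxF FL (erow (@fr_deg 0)) q x ->
    exists y, mxF FL (erow (@fr_deg 1)) q y /\ x = y *m fr_d 0;
  fr_exact : forall n q x, x *m fr_d n = 0 -> mxF FL (erow (@fr_deg n.+1)) q x ->
    exists y, mxF FL (erow (@fr_deg n.+2)) q y /\ x = y *m fr_d n.+1
}.

(** The last free module built, with the submodule that the next one has to cover. *)
Record fstate := FState {
  fs_rank : nat;
  fs_deg : 'I_fs_rank -> int;
  fs_sub : 'rV[L]_fs_rank -> Prop;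
  fs_submod : submod fs_sub
}.

Lemma ker_mx_submod r r' (D : 'M[L]_(r', r)) : submod (fun y : 'rV_r' => y *m D = 0).
Proof.
split=> [|a x y hx hy]; first by rewrite mul0mx.
by rewrite mulmxDl -scalemxAl hx hy scaler0 addr0.
Qed.

Lemma filtered_resolution_exists : noetherian A -> good_filtration FM ->
  exists _ : filtered_resolution, True.
Proof.
move=> nA [r0 [ps0 [ms gP]]].
(* [strict_generators] as a choice function, so that the resolution can be defined by iteration. *)
have pack (st : fstate) : {x : {r' & (('I_r' -> int) * 'M[L]_(r', fs_rank st))%type} |
  let ps' := (projT2 x).1 in let D := (projT2 x).2 in
  [/\ forall i, fs_sub (row i D), mxF FL (emx ps' (@fs_deg st)) 0 D &
      forall q X, fs_sub X -> mxF FL (erow (@fs_deg st)) q X -> exists y : 'rV_(projT1 x),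
        mxF FL (erow ps') q y /\ X = y *m D]}.
  apply: cid; have [r' [ps' [D h]]] := strict_generators (@fs_deg st) nA (@fs_submod st).
  by exists (existT _ r' (ps', D)).
pose next st := FState (projT2 (sval (pack st))).1 (ker_mx_submod (projT2 (sval (pack st))).2).
have K0P : submod (fun x => rvlin ms x = 0).
  by split=> [|a x y hx hy]; rewrite ?linear0 // linearP hx hy scaler0 addr0.
pose st n := iter n next (FState ps0 K0P).
pose D n : 'M[L]_(fs_rank (st n.+1), fs_rank (st n)) := (projT2 (sval (pack (st n)))).2.
have DP n := svalP (pack (st n)).
have Ksub n (y : 'rV_(fs_rank (st n.+1))) : fs_sub (y *m D n).
  have [h _ _] := DP n; rewrite mulmx_sum_row; apply: (submod_sum (@fs_submod (st n))) => i _.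
  by apply: (submodZ (@fs_submod (st n))); exact: h.
unshelve eexists (@FilteredResolution (fun n => fs_rank (st n)) (fun n => @fs_deg (st n)) D ms
  _ _ _ _ _ _) => //.
- move=> q x; rewrite gP; split=> [[a [Fa ->]]|[a [Fa ->]]].
    exists (\row_k a k); split; first by move=> i k; rewrite mxE; exact: Fa.
    by rewrite rvlinE; apply: eq_bigr => k _; rewrite mxE.
  by exists (fun k => a 0 k); split=> [k|//]; exact: Fa.
- by move=> n; case: (DP n).
- by move=> y; exact: (Ksub 0%N y).
- by move=> n; apply/row_matrixP => i; rewrite row_mul row0 rowE; exact: (Ksub n.+1).
- by move=> q x hx Fx; case: (DP 0%N) => _ _; apply.
- by move=> n q x hx Fx; case: (DP n.+1) => _ _; apply.
Qed.

Lemma mf_decr p x : FM (p - 1) x -> FM p x.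
Proof. by move=> h; rewrite -(subrK 1 p); exact: mf_incr. Qed.

Variable Fr : filtered_resolution.
Local Notation r := (fr_rank Fr).
Local Notation ps n := (@fr_deg Fr n).
Local Notation D := (fr_d Fr).
Local Notation ms := (@fr_gen Fr).
Local Notation er n := (erow (ps n)).

Definition gr_d n : 'M[A]_(r n.+1, r n) := symb FL (emx (ps n.+1) (ps n)) 0 (D n).
Definition gr_gen (k : 'I_(r 0)) : gr_mod FM := gr_hom FM (ps 0 k) (ms k).
Local Notation aug := (rvlin ms).
Local Notation augb := (rvlin gr_gen).

Lemma FM_gen k : FM (ps 0 k) (ms k).
Proof.
apply/(@fr_genP Fr); exists (delta_mx 0 k); rewrite rvlin_delta; split=> // i j.
rewrite mxE ord1 eqxx /=; case: eqP => [->|_]; last exact: sg0.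
by rewrite /erow subrr; exact: rf1.
Qed.

Lemma aug_lift q (xb : 'rV[A]_(r 0)) x : mlift (er 0) q xb x ->
  lift_at (augb xb : grd FM) q (aug x).
Proof.
move=> h; rewrite !rvlinE; apply: lift_at_sum => k _.
rewrite -{1}[q](subrK (ps 0 k)).
apply: (lift_at_mul_homr _ _ _ (@rfz_incr _ FL) mf_decr); first exact: FM_gen.
exact: h.
Qed.

Lemma rowd_lift n q (xb : 'rV[A]_(r n.+1)) x : mlift (er n.+1) q xb x ->
  mlift (er n) q (xb *m gr_d n) (x *m D n).
Proof.
move=> h; rewrite -[q]addr0; apply: mlift_mulr h (@fr_dF Fr n); exact: erow_emx.
Qed.

Lemma row_symb_d n q y : mxF FL (er n.+1) q y ->
  symb FL (er n.+1) q y *m gr_d n = symb FL (er n) q (y *m D n).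
Proof.
move=> h; rewrite -[in RHS](addr0 q); apply: symb_mul h (@fr_dF Fr n); exact: erow_emx.
Qed.

Lemma aug_surj : surj_map aug.
Proof.
by move=> x; have [q /(@fr_genP Fr)[a [_ ->]]] := mf_exh FM x; exists a.
Qed.

Lemma aug_exact x : aug x = 0 <-> exists y, y *m D 0 = x.
Proof.
split=> [x0|[y <-]]; last exact: (@fr_aug_d Fr).
have [N hN] := mxF_exh FL (er 0) x.
by have [y [_ ->]] := @fr_exact0 Fr _ _ x0 (hN N (lexx _)); exists y.
Qed.

Lemma d_exact n (x : 'rV_(r n.+1)) : x *m D n = 0 <-> exists y, y *m D n.+1 = x.
Proof.
split=> [x0|[y <-]]; last by rewrite -mulmxA fr_dd mulmx0.
have [N hN] := mxF_exh FL (er n.+1) x.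
by have [y [_ ->]] := @fr_exact Fr _ _ _ x0 (hN N (lexx _)); exists y.
Qed.

Lemma augb_surj : surj_map augb.
Proof.
move=> m; elim/(@grd_ind _ FM): (m : grd FM) => [|x y [a ha] [b hb]|q x Fx].
- by exists 0; rewrite linear0.
- by exists (a + b); rewrite linearD ha hb.
have /(@fr_genP Fr)[a [Fa xE]] := Fx.
exists (symb FL (er 0) q a); apply: lift_at_ext => q'.
have [->|qq] := eqVneq q' q.
  exists x; split; last exact: lift_at_hom.
  by rewrite xE; apply: aug_lift; exact: mlift_symb.
exists 0; split; last exact: lift_at_hom_neq.
by rewrite -(linear0 aug); apply: aug_lift; exact: mlift_symb_neq.
Qed.

Lemma augb_exact x : augb x = 0 <-> exists y, y *m gr_d 0 = x.
Proof.
split=> [x0|[y <-]]; last first.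
  apply: lift_at_ext => q; exists 0; split; last exact: lift_at0.
  have [z lz] := mlift_rep (er 1) q y.
  by rewrite -(@fr_aug_d Fr z); apply/aug_lift/rowd_lift.
pose X q := projT1 (cid (mlift_rep (er 0) q x)).
have lx q : mlift (er 0) q x (X q) := projT2 (cid (mlift_rep (er 0) q x)).
apply: (mx_hom_ind (P := fun x => exists y, y *m gr_d 0 = x) lx).
- by exists 0; rewrite mul0mx.
- by move=> a b [y <-] [z <-]; exists (y + z); rewrite mulmxDl.
move=> q; have := aug_lift (lx q); rewrite x0 => h.
(* The symbol of X q is killed, so aug (X q) has lower degree and equals aug x' with x' of lower
   degree. Then X q - x' lies in the kernel and has the symbol of X q, and strict exactness lifts
   it. *)
have : FM (q - 1) (aug (X q)).
  by rewrite -[aug _]subr0; apply: lift_at_eq h _; exact: lift_at0.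
move=> /(@fr_genP Fr)[x' [Fx' x'E]].
have FX := mliftF (lx q).
have Fx'q : mxF FL (er 0) q x' by apply: mxF_le Fx'; rewrite lerBlDr lerDl.
have [||y [Fy yE]] := @fr_exact0 Fr q (X q - x').
- by rewrite linearB x'E subrr.
- exact: mxFB.
exists (symb FL (er 1) q y); rewrite row_symb_d // -yE.
by apply/esym/symb_cong => //; rewrite subKr.
Qed.

Lemma gr_dd n : gr_d n.+1 *m gr_d n = 0.
Proof.
rewrite /gr_d (@symb_mul _ _ _ _ _ _ _ (emx (ps n.+2) (ps n))) ?fr_dd //.
- by apply: symb_sub0; exact: mxF0.
- by move=> i j l; rewrite /emx addrA subrK.
- exact: (@fr_dF Fr).
- exact: (@fr_dF Fr).
Qed.

(** x D is a cycle of degree q, so exactness with degrees supplies a preimage of degree q. *)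
Lemma img_strict n q (x : 'rV_(r n.+1)) : mxF FL (er n) q (x *m D n) ->
  exists y, mxF FL (er n.+1) q y /\ x *m D n = y *m D n.
Proof.
case: n x => [|n] x FD; first by apply: (@fr_exact0 Fr) => //; exact: (@fr_aug_d Fr).
by apply: (@fr_exact Fr) => //; rewrite -mulmxA fr_dd mulmx0.
Qed.

Lemma gr_d_exact n (x : 'rV_(r n.+1)) : x *m gr_d n = 0 <-> exists y, y *m gr_d n.+1 = x.
Proof.
split=> [x0|[y <-]]; last by rewrite -mulmxA gr_dd mulmx0.
pose X q := projT1 (cid (mlift_rep (er n.+1) q x)).
have lx q : mlift (er n.+1) q x (X q) := projT2 (cid (mlift_rep (er n.+1) q x)).
apply: (mx_hom_ind (P := fun x => exists y, y *m gr_d n.+1 = x) lx).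
- by exists 0; rewrite mul0mx.
- by move=> a b [y <-] [z <-]; exists (y + z); rewrite mulmxDl.
move=> q; have := rowd_lift (lx q); rewrite x0 => h.
have FD : mxF FL (er n) (q - 1) (X q *m D n).
  by rewrite -[X q *m _]subr0; apply: mlift_eq h _; exact: mlift0.
have [x' [Fx' x'E]] := img_strict FD.
have FX := mliftF (lx q).
have Fx'q : mxF FL (er n.+1) q x' by apply: mxF_le Fx'; rewrite lerBlDr lerDl.
have [||y [Fy yE]] := @fr_exact Fr n q (X q - x').
- by rewrite mulmxBl x'E subrr.
- exact: mxFB.
exists (symb FL (er n.+2) q y); rewrite row_symb_d // -yE.
by apply/esym/symb_cong => //; rewrite subKr.
Qed.

Lemma gr_mod_fin_gen : fin_gen (gr_mod FM).
Proof. by apply/fin_genP; exists (r 0), augb; exact: augb_surj. Qed.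

End FilteredResolution.

(** * The dual complex *)

Section DualComplex.
Variables (L : pzRingType) (FL : ring_filtration L) (M : lmodType L).
Variables (FM : mod_filtration FL M) (Fr : filtered_resolution FM).
Local Notation A := (gr_ring FL).
Local Notation Fz := (rfz FL).
Local Notation sig := (gr_hom Fz).
Local Notation r := (fr_rank Fr).
Local Notation rk := (crank r).
Local Notation D := (cdiff (fr_d Fr)).
Local Notation Db := (cdiff (gr_d Fr)).

Definition cdeg n : 'I_(rk n) -> int :=
  match n return 'I_(rk n) -> int with 0 => fun=> 0 | k.+1 => @fr_deg _ _ _ _ Fr k end.
Arguments cdeg n : clear implicits.
Local Notation ec n := (ecol (cdeg n)).

Lemma cdiffF n : mxF FL (emx (cdeg n.+1) (cdeg n)) 0 (D n).
Proof. by case: n => [|n]; [move=> i []|exact: fr_dF]. Qed.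

Lemma cdiff_gr n : Db n = symb FL (emx (cdeg n.+1) (cdeg n)) 0 (D n).
Proof. by case: n => [|n] //; apply/matrixP => i []. Qed.

Lemma cdiff_cdiff n : D n.+1 *m D n = 0.
Proof. by case: n => [|n] /=; [rewrite mulmx0|exact: fr_dd]. Qed.

Lemma col_diff_lift n q zb z : mlift (ec n) q zb z -> mlift (ec n.+1) q (Db n *m zb) (D n *m z).
Proof.
move=> h; rewrite cdiff_gr -[q]add0r.
by apply: (mlift_mull (e2 := ec n)) (@cdiffF n) h; exact: emx_ecol.
Qed.

Lemma col_diff_symb n q z : mxF FL (ec n) q z ->
  Db n *m symb FL (ec n) q z = symb FL (ec n.+1) q (D n *m z).
Proof.
move=> h; rewrite cdiff_gr -[q in RHS]add0r.
by apply: symb_mul (@cdiffF n) h; exact: emx_ecol.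
Qed.

Let e1 : 'I_1 -> 'I_1 -> int := fun _ _ => 0.
Let e1E n i j l : ec n i j + e1 j l = ec n i l. Proof. exact: addr0. Qed.

Lemma scalar1F t u : Fz t u -> mxF FL e1 t (u%:M).
Proof. by move=> Fu i j; rewrite mxE !ord1 eqxx mulr1n /e1 addr0. Qed.

Lemma scalar1_lift t (s : A) u : lift_at (s : grd Fz) t u -> mlift e1 t (s%:M) (u%:M).
Proof. by move=> lu i j; rewrite !mxE !ord1 eqxx !mulr1n /e1 addr0. Qed.

Lemma scalar1_symb t u : symb FL e1 t (u%:M) = (sig t u : A)%:M.
Proof. by apply/matrixP => i j; rewrite !mxE !ord1 eqxx !mulr1n /e1 addr0. Qed.

Lemma col_scaleF n q t (z : 'cV_(rk n)) u : mxF FL (ec n) q z -> Fz t u ->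
  mxF FL (ec n) (q + t) (z *m u%:M).
Proof. by move=> Fz' Fu; apply: mxF_mul Fz' (scalar1F Fu); exact: e1E. Qed.

Lemma col_scale_lift n q t zb (z : 'cV_(rk n)) u : mlift (ec n) q zb z -> Fz t u ->
  mlift (ec n) (q + t) (zb *m (sig t u : A)%:M) (z *m u%:M).
Proof.
move=> lz Fu; rewrite -scalar1_symb; apply: mlift_mulr lz (scalar1F Fu); exact: e1E.
Qed.

Lemma col_symb_scale n q t (z : 'cV_(rk n)) u : mxF FL (ec n) q z -> Fz t u ->
  symb FL (ec n) q z *m (sig t u : A)%:M = symb FL (ec n) (q + t) (z *m u%:M).
Proof.
move=> Fz' Fu; rewrite -scalar1_symb; apply: symb_mul Fz' (scalar1F Fu); exact: e1E.
Qed.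

Lemma col_symb_scale_lift n q t (z : 'cV_(rk n)) (s : A) u : mxF FL (ec n) q z ->
  lift_at (s : grd Fz) t u ->
  mlift (ec n) (q + t) (symb FL (ec n) q z *m s%:M) (z *m u%:M).
Proof.
by move=> Fz' lu; apply: (mlift_mull (e2 := e1)) Fz' (scalar1_lift lu); exact: e1E.
Qed.

(** In terms of matrices this is Ext^n(N, A) = 0, and [fil_exact] is Ext^n(M, L) = 0. *)
Definition gr_exact n := forall zb : 'cV[A]_(rk n.+1),
  Db n.+1 *m zb = 0 -> exists y, zb = Db n *m y.
Definition fil_exact n := forall z : 'cV[L]_(rk n.+1),
  D n.+1 *m z = 0 -> exists y, z = D n *m y.
(** Only a drop by one degree is asked for; [fil_strict_iter] iterates it. *)
Definition fil_strict n := forall q y, mxF FL (ec n) (q + 1) y ->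
  mxF FL (ec n.+1) q (D n *m y) -> exists y', mxF FL (ec n) q y' /\ D n *m y' = D n *m y.

(** The symbol of z is a cocycle, hence a coboundary of some yb; any representative of yb in degree
    q corrects z. *)
Lemma gr_exact_lift n q z : gr_exact n -> mxF FL (ec n.+1) q z ->
  mxF FL (ec n.+2) (q - 1) (D n.+1 *m z) ->
  exists y, mxF FL (ec n) q y /\ mxF FL (ec n.+1) (q - 1) (z - D n *m y).
Proof.
move=> ex Fz' Dz; have [|yb yE] := ex (symb FL (ec n.+1) q z).
  by rewrite col_diff_symb // symb_sub0.
have [y ly] := mlift_rep (ec n) q yb; exists y; split; first exact: mliftF ly.
apply: mlift_eq (mlift_symb Fz') _; rewrite yE; exact: col_diff_lift.
Qed.

Lemma gr_exact_fil_exact n : gr_exact n -> fil_exact n.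
Proof.
move=> ex z; have [B BP] := mxF_bounded FL (ec n.+1).
suff all (N : nat) : forall q z, q <= B + N%:Z -> mxF FL (ec n.+1) q z ->
    D n.+1 *m z = 0 -> exists y, z = D n *m y.
  have [K hK] := mxF_exh FL (ec n.+1) z.
  by apply: (all `|K%:Z - B|%N K%:Z); [lia|exact: hK].
elim: N => [|N IH] q w qB Fw Dw.
  by exists 0; rewrite mulmx0; apply: (BP q) => //; rewrite addr0 in qB.
have [|y [Fy Fwy]] := gr_exact_lift ex Fw; first by rewrite Dw; exact: mxF0.
have [||y' y'E] := IH (q - 1) (w - D n *m y) _ Fwy; first by lia.
  by rewrite mulmxBr Dw mulmxA cdiff_cdiff mul0mx subrr.
by exists (y + y'); rewrite mulmxDr -y'E subrKC.
Qed.

Lemma fil_strict0 : fil_strict 0.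
Proof.
move=> q y _ _; exists y; split=> // i; by case: i.
Qed.

(** A cochain y of degree q + 1 with D y of degree q has a cocycle as symbol; subtracting a
    coboundary lowers y without changing D y. *)
Lemma gr_exact_strict n : gr_exact n -> fil_strict n.+1.
Proof.
move=> ex q y Fy FDy; have [|w [Fw Fyw]] := gr_exact_lift ex Fy; first by rewrite addrK.
exists (y - D n *m w); split; first by rewrite addrK in Fyw.
by rewrite mulmxBr mulmxA cdiff_cdiff mul0mx subr0.
Qed.

Lemma fil_strict_iter n : fil_strict n -> forall (N : nat) q y,
  mxF FL (ec n) (q + N%:Z) y -> mxF FL (ec n.+1) q (D n *m y) ->
  exists y', mxF FL (ec n) q y' /\ D n *m y' = D n *m y.
Proof.
move=> st; elim=> [|N IH] q y Fy FDy; first by exists y; split=> //; rewrite addr0 in Fy.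
have [||y1 [Fy1 y1E]] := st (q + N%:Z) y.
- by rewrite -addrA -PoszD addn1.
- by apply: mxF_le FDy; rewrite lerDl.
by have [||y2 [Fy2 y2E]] := IH q y1 => //; rewrite ?y1E //; exists y2; rewrite y2E.
Qed.

Lemma fil_strict_all n q y : fil_strict n -> mxF FL (ec n.+1) q (D n *m y) ->
  exists y', mxF FL (ec n) q y' /\ D n *m y' = D n *m y.
Proof.
move=> st FDy; have [K hK] := mxF_exh FL (ec n) y.
by apply: (fil_strict_iter st (N := `|K%:Z - q|%N)) => //; apply: hK; lia.
Qed.

Hypothesis comm : forall a b : A, a * b = b * a.
Hypothesis nA : noetherian A.

(* Artin-Rees: the image of D n carries two good filtrations *)
Lemma artin_rees n : exists N : nat, forall q z, mxF FL (ec n.+1) q (D n *m z) ->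
  exists z', mxF FL (ec n) (q + N%:Z) z' /\ D n *m z' = D n *m z.
Proof.
(* Images of cochains at most c degrees higher. Their symbols [U c] form an ascending chain of
   submodules of a finite free module; the stage N where it stops is the Artin-Rees constant. *)
pose Q c (q : int) X := exists z, mxF FL (ec n) (q + c%:Z) z /\ X = D n *m z.
pose U c (Y : 'cV[A]_(rk n.+1)) := forall q, exists X, Q c q X /\ mlift (ec n.+1) q Y X.
have UP c : submod (U c).
  apply: (graded_submod (sc := fun u X => X *m u%:M)).
  - by move=> q; exists 0; split; [exact: mxF0|rewrite mulmx0].
  - move=> q X X' [z [Fz1 ->]] [z' [Fz2 ->]]; exists (z + z').
    by split; [exact: mxFD|rewrite mulmxDr].
  - move=> t u q X Fu [z [Fz1 ->]]; exists (z *m u%:M); split; last by rewrite mulmxA.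
    by rewrite addrAC; exact: col_scaleF.
  - move=> t u q Y X Fu lX; have := col_scale_lift (n := n.+1) lX Fu.
    suff -> : Y *m (sig t u : A)%:M = (sig t u : A) *: Y by [].
    apply/matrixP => i j; rewrite !mxE big_ord1 [X in _ * X]mxE !ord1 eqxx mulr1n.
    exact: comm.
have [||N NP] := chain_stable (U := U) _ UP.
- apply: (noeth_fin_gen nA); apply/fin_genP; exists (rk n.+1).
  have lin : linear (fun x : 'rV[A]_(rk n.+1) => x^T) by move=> a x y; rewrite linearP.
  by exists (mklin lin) => y; exists y^T; rewrite -[LHS]/(y^T^T) trmxK.
- move=> c Y UY q; have [X [[z [Fz1 ->]] lX]] := UY q.
  exists (D n *m z); split=> //; exists z; split=> //.
  by apply: mxF_le Fz1; rewrite lerD2l lez_nat leqnSn.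
exists N => q z; have [B BP] := mxF_bounded FL (ec n.+1).
suff all (K : nat) : forall q z, q <= B + K%:Z -> mxF FL (ec n.+1) q (D n *m z) ->
  exists z', mxF FL (ec n) (q + N%:Z) z' /\ D n *m z' = D n *m z.
  by apply: (all `|q - B|%N); lia.
elim: K {q z} => [|K IH] q z qB FDz.
  exists 0; split; first exact: mxF0.
  by rewrite mulmx0 (BP q _ _ FDz) //; rewrite addr0 in qB.
have [c Fzc] : exists c : nat, mxF FL (ec n) (q + c%:Z) z.
  by have [J hJ] := mxF_exh FL (ec n) z; exists `|J%:Z - q|%N; apply: hJ; lia.
have /NP UN : U c (symb FL (ec n.+1) q (D n *m z)).
  move=> q'; have [->|qq] := eqVneq q' q.
    by exists (D n *m z); split; [exists z|exact: mlift_symb].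
  exists 0; split; last exact: mlift_symb_neq.
  by exists 0; split; [exact: mxF0|rewrite mulmx0].
(* z1 realizes the symbol of D z within N degrees, and D (z - z1) has lower degree. *)
have [X [[z1 [Fz1 ->]] lX]] := UN q.
have FDz1 := mlift_eq (mlift_symb FDz) lX.
have [||z2 [Fz2 z2E]] := IH (q - 1) (z - z1); first by lia.
  by rewrite mulmxBr.
exists (z1 + z2); split; last by rewrite mulmxDr z2E mulmxBr subrKC.
by apply: mxFD => //; apply: mxF_le Fz2; lia.
Qed.

Variable p : A -> Prop.
Hypothesis p0 : p 0.
Hypothesis pD : forall a b, p a -> p b -> p (a + b).
Hypothesis pM : mulcl (fun s => ~ p s).

(** p need not be graded, but it is closed under sums, so it cannot contain all homogeneous
    components of s. *)
Lemma homogeneous_notin (s : A) : ~ p s -> exists t u, lift_at (s : grd Fz) t u /\ ~ p (sig t u).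
Proof.
move=> ps; have [l [_ _ sE]] := grd_decomp (@rfz_incr _ FL) (s : grd Fz).
apply: contrapT => H; apply: ps; rewrite sE.
elim: (l) => [|q l' IH]; first by rewrite big_nil.
rewrite big_cons; apply: pD => //; apply: contrapT => ps; apply: H.
by exists q, (sq_rep ((s : grd Fz) q)); split=> //; exact: lift_at_rep.
Qed.

(* Induction on j: multiply z by an element outside p to make the symbol of D z a
   coboundary, which is subtracted.  Once j exceeds the Artin-Rees constant N,
   D z = D z0 with z0 of lower degree than z. *)
Lemma lift_cocycle n : mx_null (gr_d Fr) (fun s => ~ p s) n.+1 -> exists N : nat,
  forall (k j : nat) q z, (N < j + k)%N -> (0 < j)%N -> mxF FL (ec n.+1) q z ->
    mxF FL (ec n.+2) (q - j%:Z) (D n.+1 *m z) ->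
    exists t u z', [/\ Fz t u, ~ p (sig t u), mxF FL (ec n.+1) (q + t) z',
      D n.+1 *m z' = 0 & mxF FL (ec n.+1) (q + t - 1) (z' - z *m u%:M)].
Proof.
move=> nu; have [N NP] := artin_rees n.+1; exists N.
elim=> [|k IH] j q z Nj j0 Fz1 FDz.
  (* Here j > N, so z0 has degree q - j + N < q, and z - z0 is a cocycle with the symbol of z. *)
  have [z0 [Fz0 z0E]] := NP _ _ FDz.
  have Fz0' : mxF FL (ec n.+1) (q - 1) z0 by apply: mxF_le Fz0; lia.
  exists 0, 1, (z - z0); split.
  - exact: rf1.
  - exact: pM.1.
  - by rewrite addr0; apply: mxFB => //; apply: mxF_le Fz0'; lia.
  - by rewrite mulmxBr z0E subrr.
  - by rewrite addr0 mulmx1 addrAC subrr add0r; exact: mxFN.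
have [|s ps [yb yE]] := nu (symb FL (ec n.+2) (q - j%:Z) (D n.+1 *m z)).
  rewrite col_diff_symb // mulmxA cdiff_cdiff mul0mx; apply: symb_sub0; exact: mxF0.
have [t [u [lu pu]]] := homogeneous_notin ps.
have Fu := lu.1.
have l1 := col_symb_scale_lift FDz lu.
have [y ly] := mlift_rep (ec n.+1) (q - j%:Z + t) yb.
have l2 := col_diff_lift ly; rewrite -yE in l2.
have Fd := mlift_eq l1 l2.
have Fy := mliftF ly.
(* As j > 0, y has degree q - j + t < q + t, so z1 has the symbol of z u, while D z1 drops by one
   more degree. *)
pose z1 := z *m u%:M - y.
have Fz1' : mxF FL (ec n.+1) (q + t) z1.
  by apply: mxFB; [exact: col_scaleF|apply: mxF_le Fy; lia].
have FDz1 : mxF FL (ec n.+2) (q + t - j.+1%:Z) (D n.+1 *m z1).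
  rewrite mulmxBr mulmxA; apply: mxF_le Fd; lia.
have [||t1 [u1 [z' [Fu1 pu1 Fz' Dz' Fz'z]]]] := IH j.+1 (q + t) z1 _ _ Fz1' FDz1 => //.
  by rewrite addSnnS.
exists (t + t1), (u * u1), z'; split=> //.
- exact: rfzM.
- have -> : sig (t + t1) (u * u1) = ((sig t u : A) * (sig t1 u1 : A)).
    by symmetry; exact: gr_mul_hom.
  exact: pM.2.
- by rewrite addrA.
have -> : z' - z *m (u * u1)%:M = (z' - z1 *m u1%:M) - y *m u1%:M.
  by rewrite /z1 mulmxBl -mulmxA -scalar_mxM opprB addrA [RHS]addrAC addrK.
apply: mxFB; first by apply: mxF_le Fz'z; lia.
by apply: mxF_le (col_scaleF Fy Fu1); lia.
Qed.

(** For z homogeneous, [lift_cocycle] makes a multiple of z by an element outside p the symbol of a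
    cocycle z'. By [fil_exact] z' is a coboundary D y, with y of the same degree by strictness, and
    the symbol of y bounds the multiple of z. *)
Lemma gr_null_descent n : fil_exact n -> fil_strict n ->
  mx_null (gr_d Fr) (fun s => ~ p s) n.+1 -> mx_null (gr_d Fr) (fun s => ~ p s) n.
Proof.
move=> fe fs nu zb Dzb; have [N NP] := lift_cocycle nu.
pose X q := projT1 (cid (mlift_rep (ec n.+1) q zb)).
have lX q : mlift (ec n.+1) q zb (X q) := projT2 (cid (mlift_rep (ec n.+1) q zb)).
apply: (mx_hom_ind (P := fun zb => exists2 s, ~ p s & exists y, zb *m s%:M = Db n *m y) lX).
- by exists 1; [exact: pM.1|exists 0; rewrite mul0mx mulmx0].
(* The product of the multipliers serves for the sum. *)
- move=> a b [s ps [y yE]] [t pt [w wE]]; exists (s * t); first exact: pM.2.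
  exists (y *m t%:M + w *m s%:M); rewrite mulmxDr mulmxDl !mulmxA -yE -wE.
  by rewrite -!mulmxA -!scalar_mxM [t * s]comm.
move=> q; have FX := mliftF (lX q).
have FDX : mxF FL (ec n.+2) (q - 1) (D n.+1 *m X q).
  have := col_diff_lift (lX q); rewrite Dzb => h.
  by rewrite -[D _ *m _]subr0; apply: mlift_eq h _; exact: mlift0.
(* The symbol of X q being a cocycle, D (X q) drops by j = 1 degree at the start; k = N then
   satisfies N < j + k. *)
have [||t [u [z' [Fu pu Fz' Dz' Fz'z]]]] := NP N 1%N q (X q) _ _ FX FDX => //.
exists (sig t u) => //; rewrite col_symb_scale //.
have [y0 y0E] := fe z' Dz'.
have [|y [Fy yE]] := @fil_strict_all n (q + t) y0 fs; first by rewrite -y0E.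
exists (symb FL (ec n) (q + t) y); rewrite col_diff_symb // yE -y0E.
by apply/esym/symb_cong.
Qed.

End DualComplex.

(** * Comparison of the grades *)

Lemma nat_inf_least (P : nat -> Prop) n : P n -> (forall k, (k < n)%N -> ~ P k) ->
  nat_inf P = Some n.
Proof.
move=> Pn Pk; rewrite /nat_inf; case: pselect => [exP|[]]; last by exists n; apply/asboolP.
case: ex_minnP => m /asboolP Pm mmin; congr Some; apply/eqP.
rewrite eqn_leq mmin ?andbT; last exact/asboolP.
by rewrite leqNgt; apply/negP => /Pk.
Qed.

Lemma nat_inf_none (P : nat -> Prop) : (forall k, ~ P k) -> nat_inf P = None.
Proof. by move=> H; rewrite /nat_inf; case: pselect => // exP; have [n /asboolP/H] := exP. Qed.

Lemma grade_none (R : pzRingType) (X : lmodType R) : (forall j, ext0 j X) -> grade X = None.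
Proof.
by move=> e; apply: nat_inf_none => k; apply; apply/Ext_trivialP => //; exact: std_resolution.
Qed.

Lemma grade_least (R : pzRingType) (X : lmodType R) g : ~ ext0 g X ->
  (forall j, (j < g)%N -> ext0 j X) -> grade X = Some g.
Proof.
move=> ng e; apply: nat_inf_least => [tr|k /e ek]; last first.
  by apply; apply/Ext_trivialP => //; exact: std_resolution.
by apply: ng; apply/(Ext_trivialP g (std_resolution X)).
Qed.

Section Main.
Variables (L : pzRingType) (FL : ring_filtration L) (M : lmodType L).
Variable FM : mod_filtration FL M.
Local Notation A := (gr_ring FL).
Hypothesis comm : forall a b : A, a * b = b * a.
Hypothesis nA : noetherian A.

Definition gr_comPzRing : comPzRingType :=
  HB.pack A (GRing.PzRing_hasCommutativeMul.Build A comm).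

Lemma gr_ext_dichotomy (N : lmodType A) k : fin_gen N -> tcr_res k N ->
  (forall j, ext0 j N) \/ exists g (p : A -> Prop), [/\ p 0, forall a b, p a -> p b -> p (a + b),
     mulcl (fun s => ~ p s) & [/\ forall j, (j < g)%N -> ext0 j N,
     ~ ext_null (fun s => ~ p s) g N & ext_null (fun s => ~ p s) g.+1 N]].
Proof.
move=> fN tN.
have [|[g [p [pp e1 e2 e3]]]] := @ext_dichotomy gr_comPzRing nA N k fN tN; first by left.
right; exists g, p; split.
- exact: (submod0 (pp_ideal pp)).
- by move=> a b; exact: (submodD (pp_ideal pp)).
- exact: (prime_compl_mulcl pp).
- by [].
Qed.
End Main.

Theorem theorem2p8 (L : pzRingType) (FL : ring_filtration L)
    (M : lmodType L) (FM : mod_filtration FL M)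
    (gr_comm : forall a b : gr_ring FL, a * b = b * a)
    (gr_noeth : noetherian (gr_ring FL))
    (FM_good : good_filtration FM)
    (gr_Gdim : Gdim (gr_mod FM) <> None) :
  grade M = grade (gr_mod FM).
Proof.
have [Fr _] := filtered_resolution_exists gr_noeth FM_good.
have extM n : ext0 n M <-> fil_exact Fr n.
  exact: (mxres_ext0P (@aug_surj _ _ _ _ Fr) (@aug_exact _ _ _ _ Fr) (@d_exact _ _ _ _ Fr)).
have extG n : ext0 n (gr_mod FM) <-> gr_exact Fr n.
  exact: (mxres_ext0P (@augb_surj _ _ _ _ Fr) (@augb_exact _ _ _ _ Fr)
    (@gr_d_exact _ _ _ _ Fr)).
have nullG S n : ext_null S n (gr_mod FM) <-> mx_null (gr_d Fr) S n.
  exact: (mxres_ext_nullP (@augb_surj _ _ _ _ Fr) (@augb_exact _ _ _ _ Fr)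
    (@gr_d_exact _ _ _ _ Fr)).
have GM n : ext0 n (gr_mod FM) -> ext0 n M.
  by move=> /extG e; apply/extM; exact: gr_exact_fil_exact.
have fN := gr_mod_fin_gen Fr.
have [k tN] := Gdim_tcr_res gr_comm gr_noeth fN gr_Gdim.
have [e|[g [p [p0 pD pM [e1 e2 e3]]]]] := gr_ext_dichotomy gr_comm gr_noeth fN tN.
  by rewrite !grade_none // => j; exact: GM.
rewrite (@grade_least _ (gr_mod FM) g) //; last by move=> e0; apply: e2; exact: ext0_null.
apply: grade_least => [e0|j jg]; last by apply: GM; exact: e1.
(* If Ext^g(M, L) were 0, the descent from degree g + 1 would make Ext^g(N, A) zero at p, against
   the choice of p. *)
apply/e2/nullG; apply: (gr_null_descent gr_comm gr_noeth p0 pD pM).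
- by apply/extM.
(* Strictness of D g comes from Ext^(g-1)(N, A) = 0; for g = 0 the source of D 0 is the zero
   module. *)
- by case: g e1 {e0 e2 e3} => [|g] e1; [exact: fil_strict0|apply/gr_exact_strict/extG/e1].
- by apply/nullG.
Qed.
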